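(* Let $\Omega\subset\mathbb{R}^d$ be an open set of finite measure, and let $\lambda_1(\Omega)$ be the first eigenvalue of the operator $\mathcal H=\frac12\log(-\Delta)$ in $\Omega$ with Dirichlet condition $\varphi=0$ on $\mathbb{R}^d\setminus\Omega$. Then $$\lambda_1(\Omega)\ge\frac1d\log\frac{(2\pi)^d}{e\,|\Omega|\,|B_d|}.$$ In particular, if $|\Omega|\le\frac{(2\pi)^d}{e\,|B_d|}$, then the operator $\mathcal H$ does not have negative eigenvalues.
   Context: Here $d\ge1$ is an integer, $\Omega$ is nonempty, $|\cdot|$ of a set is Lebesgue measure, and $B_d$ is the unit ball in $\mathbb{R}^d$. The Fourier transform is $\widehat\varphi(\xi)=\int_{\mathbb{R}^d}e^{-ix\cdot\xi}\varphi(x)\,dx$, and $L^2(\Omega)$ is identified with the functions in $L^2(\mathbb{R}^d)$ vanishing on $\mathbb{R}^d\setminus\Omega$. Let $\mathbb{H}(\Omega)\subset L^2(\Omega)$ be the closure (completion) of $C_c^\infty(\Omega)$ with respect to the norm $\|\varphi\|_*$ given by $\|\varphi\|_*^2=\int_{\mathbb{R}^d}\log(e+|\xi|)\,|\widehat\varphi(\xi)|^2\,d\xi$. The quadratic form $$(\varphi,\varphi)_{\log}=\frac{1}{(2\pi)^d}\int_{\mathbb{R}^d}\log(|\xi|)\,|\widehat\varphi(\xi)|^2\,d\xi$$ (with associated sesquilinear form $(\varphi,\psi)_{\log}=\frac{1}{(2\pi)^d}\int_{\mathbb{R}^d}\log(|\xi|)\,\widehat\varphi(\xi)\overline{\widehat\psi(\xi)}\,d\xi$)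 with domain $\mathbb{H}(\Omega)$ is closed, symmetric and semibounded in $L^2(\Omega)$; $\mathcal H$ is the associated self-adjoint operator in $L^2(\Omega)$. Eigenvalues are understood weakly: $\varphi\in\mathbb{H}(\Omega)\setminus\{0\}$ is an eigenfunction with eigenvalue $\lambda$ if $(\varphi,\psi)_{\log}=\lambda\int_\Omega\varphi\overline{\psi}\,dx$ for all $\psi\in\mathbb{H}(\Omega)$. The spectrum is discrete: there is a sequence of eigenvalues (counted with multiplicity) $\lambda_1(\Omega)<\lambda_2(\Omega)\le\dots$, $\lambda_k(\Omega)\to\infty$, with a corresponding complete orthonormal system of eigenfunctions in $L^2(\Omega)$. *)

(* Defs.v *)
From HB Require Import structures.
From mathcomp Require Import all_boot all_order all_algebra.
From mathcomp Require Import complex.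
From mathcomp Require Import all_classical all_reals all_analysis.
Import Order.TTheory GRing.Theory Num.Theory.
Import numFieldNormedType.Exports.

Set Implicit Arguments.
Unset Strict Implicit.
Unset Printing Implicit Defensive.

Local Open Scope classical_set_scope.
Local Open Scope ring_scope.

(* Row vectors carry the sigma-algebra generated by the coordinate maps, as
   tuples do in the library; over R it is the Borel sigma-algebra of R^n. *)
Section measurable_rV.
Context {d : measure_display} {T : measurableType d} (n : nat).

Let coors : 'I_n -> 'rV[T]_n -> T := fun i x => x ord0 i.

Let rV_set0 : g_sigma_preimage coors set0.
Proof. exact: sigma_algebra0. Qed.

Let rV_setC A : g_sigma_preimage coors A -> g_sigma_preimage coors (~` A).
Proof. exact: sigma_algebraC. Qed.

Let rV_bigcup (F : (set 'rV[T]_n)^nat) :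
  (forall i, g_sigma_preimage coors (F i)) ->
  g_sigma_preimage coors (\bigcup_i (F i)).
Proof. exact: sigma_algebra_bigcup. Qed.

HB.instance Definition _ := @isMeasurable.Build (measure_tuple_display d)
  'rV[T]_n (g_sigma_preimage coors) rV_set0 rV_setC rV_bigcup.

Lemma measurable_coord (i : 'I_n) :
  measurable_fun [set: 'rV[T]_n] (fun x : 'rV[T]_n => x ord0 i).
Proof.
move=> _ Y mY; rewrite setTI; apply: sub_sigma_algebra => /=.
rewrite -bigcup_seq/=; exists i => /=; first by rewrite mem_index_enum.
by exists Y => //; rewrite setTI.
Qed.

Lemma measurable_fun_rV d' (T' : measurableType d') (f : T' -> 'rV[T]_n) :
  (forall i, measurable_fun [set: T'] (fun x => f x ord0 i)) ->
  measurable_fun [set: T'] f.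
Proof.
move=> mf.
apply: (measurability
  (\big[setU/set0]_(i < n) preimage_set_system setT (coors i) measurable)).
  by [].
move=> _ [A + <-]; rewrite -bigcup_seq/= => -[i _ [B mB <-]].
by rewrite !setTI; have := mf i measurableT B mB; rewrite setTI.
Qed.

End measurable_rV.

Section lebesgue_rV.
Variable R : realType.

Definition rVcons n (p : (measurableTypeR R * 'rV[R]_n)%type) : 'rV[R]_n.+1 :=
  row_mx (p.1 : R)%:M p.2 : 'rV_(1 + n).

Fixpoint lebesgue_rV n : set 'rV[R]_n -> \bar R :=
  if n is m.+1 then
    pushforward (lebesgue_measure \x @lebesgue_rV m)%E (@rVcons m)
  else dirac (0 : 'rV[R]_0).

Lemma rVcons0 n (p : (measurableTypeR R * 'rV[R]_n)%type) : rVcons p ord0 ord0 = p.1.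
Proof.
rewrite /rVcons (_ : ord0 = lshift n (ord0 : 'I_1)); last exact/val_inj.
by rewrite (@row_mxEl _ 1 1 n) mxE eqxx mulr1n.
Qed.

Lemma rVcons_lift n (p : (measurableTypeR R * 'rV[R]_n)%type) (i : 'I_n) :
  rVcons p ord0 (lift ord0 i) = p.2 ord0 i.
Proof.
rewrite /rVcons (_ : lift ord0 i = rshift 1 i); last exact/val_inj.
by rewrite (@row_mxEr _ 1 1 n).
Qed.

Lemma measurable_rVcons n : measurable_fun setT (@rVcons n).
Proof.
apply: measurable_fun_rV => i; case: (unliftP ord0 i) => [j|] ->.
  under eq_fun do rewrite rVcons_lift.
  by apply: (measurableT_comp (measurable_coord j)); exact: measurable_snd.
by under eq_fun do rewrite rVcons0; exact: measurable_fst.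
Qed.

Definition rVuncons n (x : 'rV[R]_n.+1) :
    (measurableTypeR R * 'rV[R]_n)%type :=
  (x ord0 ord0, \row_i x ord0 (lift ord0 i)).

Lemma rVconsK n : cancel (@rVcons n) (@rVuncons n).
Proof.
move=> [x v]; rewrite /rVuncons rVcons0; congr pair.
by apply/rowP => i; rewrite mxE rVcons_lift.
Qed.

Lemma measurable_rVuncons n : measurable_fun setT (@rVuncons n).
Proof.
apply: measurable_fun_pair; first exact: measurable_coord.
apply: measurable_fun_rV => i; under eq_fun do rewrite mxE.
exact: measurable_coord.
Qed.

Let lebesgue_rV_sigma_finite_measure n :
  exists mu : {sigma_finite_measure set 'rV[R]_n -> \bar R},
    mu = @lebesgue_rV n :> (set 'rV[R]_n -> \bar R).
Proof.
elim: n => [|n [mu IH]] /=; first by exists (dirac (0 : 'rV[R]_0)).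
rewrite -IH.
pose lam : {sigma_finite_measure set (measurableTypeR R) -> \bar R} :=
  lebesgue_measure.
pose nu : {measure set (measurableTypeR R * 'rV[R]_n)%type -> \bar R} :=
  lebesgue_integral_fubini_product_measure1__canonical__measure_function_Measure
    lam mu.
pose m : {measure set 'rV[R]_n.+1 -> \bar R} :=
  measure_function_pushforward__canonical__measure_function_Measure nu
    (@measurable_rVcons n).
have msf : sigma_finite setT m.
  have /sigma_finiteP[F [TF ndF Foo]] := sigma_finiteT lam.
  have /sigma_finiteP[G [TG ndG Goo]] := sigma_finiteT mu.
  exists (fun k => @rVuncons n @^-1` (F k `*` G k)).
    rewrite -preimage_bigcup -(preimage_setT (@rVuncons n)).
    congr (_ @^-1` _); rewrite -setXTT TF TG predeqE => -[x y]; split.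
      move=> [/= [i _ Fnx] [k _ Gky]]; exists (maxn i k) => //; split.
      - by move: x Fnx; exact/subsetPset/ndF/leq_maxl.
      - by move: y Gky; exact/subsetPset/ndG/leq_maxr.
    by move=> [i _ []/= ? ?]; split; exists i.
  move=> k; have [mF Flt] := Foo k; have [mG Glt] := Goo k; split.
    rewrite -[X in measurable X]setTI; apply: measurable_rVuncons => //.
    exact: measurableX.
  rewrite /m /= /pushforward (_ : _ @^-1` _ = F k `*` G k); last first.
    by apply/funext => x; exact: (congr1 (F k `*` G k) (rVconsK x)).
  by rewrite /nu/= product_measure1E// lte_mul_pinfty// ge0_fin_numE.
pose H1 := isSigmaFinite.Build _ _ _ _ msf.
pose H2 := isSFinite.Build _ _ _ _ (sfinite_measure_sigma_finite msf).
pose m' : {sigma_finite_measure set 'rV[R]_n.+1 -> \bar R} :=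
  HB.pack_for (SigmaFiniteMeasure.type 'rV[R]_n.+1 R) (Measure.sort m) H1 H2.
by exists m'.
Qed.

Let lebesgue_rV0 n : @lebesgue_rV n set0 = 0%E.
Proof.
by have [mu <-] := lebesgue_rV_sigma_finite_measure n; exact: measure0.
Qed.

Let lebesgue_rV_ge0 n (A : set 'rV[R]_n) : (0 <= lebesgue_rV A)%E.
Proof.
by have [mu <-] := lebesgue_rV_sigma_finite_measure n; exact: measure_ge0.
Qed.

Let lebesgue_rV_sigma_additive n : semi_sigma_additive (@lebesgue_rV n).
Proof.
have [mu <-] := lebesgue_rV_sigma_finite_measure n.
exact: measure_semi_sigma_additive.
Qed.

HB.instance Definition _ n := isMeasure.Build _ _ _ (@lebesgue_rV n)
  (lebesgue_rV0 n) (@lebesgue_rV_ge0 n) (@lebesgue_rV_sigma_additive n).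

Let lebesgue_rV_sigma_finite n : sigma_finite setT (@lebesgue_rV n).
Proof.
by have [mu <-] := lebesgue_rV_sigma_finite_measure n; exact: sigma_finiteT.
Qed.

HB.instance Definition _ n := Measure_isSigmaFinite.Build _ _ _
  (@lebesgue_rV n) (@lebesgue_rV_sigma_finite n).

Lemma lebesgue_rV_box n (A : 'I_n -> set R) : (forall i, measurable (A i)) ->
  lebesgue_rV [set x : 'rV[R]_n | forall i, A i (x ord0 i)] =
  (\prod_(i < n) lebesgue_measure (A i))%E.
Proof.
elim: n A => [|n IH] A mA.
  by rewrite big_ord0 /= /dirac indicE mem_set// => -[].
rewrite big_ord_recl -IH//= /pushforward -product_measure1E//; last 2 first.
- exact: mA.
- rewrite (_ : mkset _ = \bigcap_(i in [set: 'I_n])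
      ((fun x : 'rV[R]_n => x ord0 i) @^-1` A (lift ord0 i))); last first.
    apply/seteqP; split => x /= h i; first by move=> _; exact: h.
    exact: (h i Logic.I).
  apply: fin_bigcap_measurable => // i _.
  by rewrite -[X in measurable X]setTI; exact: measurable_coord.
apply: (congr1 (lebesgue_measure \x @lebesgue_rV n)%E).
apply/seteqP; split => -[a v] /= h.
  by split => [|i] /=; [move: (h ord0)|move: (h (lift ord0 i))];
    rewrite ?rVcons0 ?rVcons_lift.
move=> i; case: (unliftP ord0 i) => [j|] ->.
  by rewrite rVcons_lift; exact: h.2.
by rewrite rVcons0; exact: h.1.
Qed.

End lebesgue_rV.

Import ComplexField.Normc.
Local Open Scope complex_scope.

Section euclidean.
Variables (R : realType) (d : nat).
Implicit Types (x y : 'rV[R]_d) (A : set 'rV[R]_d).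

Definition dot x y : R := \sum_i x ord0 i * y ord0 i.

(* The norm `|x| of the library on row vectors is the sup norm. *)
Definition euclidean_norm x : R := Num.sqrt (dot x x).

Definition euclidean_unit_ball : set 'rV[R]_d := [set x | euclidean_norm x < 1].

Definition volume A : R := fine (lebesgue_rV A).

End euclidean.

Arguments euclidean_unit_ball : clear implicits.

Section complex_functions.
Variables (R : realType) (d : nat).
Implicit Types (f g : 'rV[R]_d -> R[i]) (Omega : set 'rV[R]_d).

(* Library integrals are real-valued: complex ones are taken componentwise. *)
Definition Cintegral Omega f : R[i] :=
  (\int[@lebesgue_rV R d]_(x in Omega) complex.Re (f x))%R +i*
  (\int[@lebesgue_rV R d]_(x in Omega) complex.Im (f x))%R.

Definition expi (t : R) : R[i] := cos t +i* sin t.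

Definition fourier f (xi : 'rV[R]_d) : R[i] :=
  Cintegral setT (fun x => expi (- dot x xi) * f x).

Fixpoint Ck (k : nat) (u : 'rV[R]_d -> R) : Prop :=
  continuous u /\
  if k is k'.+1 then
    forall i : 'I_d, (forall x, derivable u x (delta_mx ord0 i)) /\
      Ck k' (fun x => 'D_(delta_mx ord0 i) u x)
  else True.

Definition Csmooth f : Prop :=
  forall k, Ck k (fun x => complex.Re (f x)) /\ Ck k (fun x => complex.Im (f x)).

Definition closed_support f : set 'rV[R]_d := closure [set x | f x != 0].

Definition Cc_infty Omega : set ('rV[R]_d -> R[i]) :=
  [set f : 'rV[R]_d -> R[i] | [/\ Csmooth f, compact (closed_support f) &
    closed_support f `<=` Omega]].

(* Representatives are chosen to vanish everywhere outside Omega. *)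
Definition L2 Omega : set ('rV[R]_d -> R[i]) :=
  [set f : 'rV[R]_d -> R[i] | [/\
    measurable_fun setT (fun x => complex.Re (f x)),
    measurable_fun setT (fun x => complex.Im (f x)),
    (\int[@lebesgue_rV R d]_x (normc (f x) ^+ 2)%:E < +oo)%E &
    forall x, ~ Omega x -> f x = 0]].

Definition L2_inner Omega f g : R[i] :=
  Cintegral Omega (fun x => f x * (g x)^*%C).

Definition ae_zero f : Prop := {ae @lebesgue_rV R d, forall x, f x = 0}.

Definition star_norm_sq f : \bar R :=
  (\int[@lebesgue_rV R d]_xi
    (ln (expR 1 + euclidean_norm xi) * normc (fourier f xi) ^+ 2)%:E)%E.

(* For |Omega| < oo, L2 Omega is contained in L1, so that the Fourier integral
   converges on all of L2 Omega. Since 1 <= log (e + |xi|), the *-norm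
   dominates the L2 norm and the completion is the closure inside L2 Omega. *)
Definition HH Omega : set ('rV[R]_d -> R[i]) :=
  [set f : 'rV[R]_d -> R[i] | L2 Omega f /\
    forall eps : R, 0 < eps ->
      exists2 g, Cc_infty Omega g &
        (star_norm_sq (fun x => f x - g x)%R < eps%:E)%E].

(* ln 0 = 0 in the library; the value at xi = 0 is irrelevant for d >= 1. *)
Definition log_form f g : R[i] :=
  (((2 * pi) ^+ d)^-1)%:C *
  Cintegral setT (fun xi =>
    (ln (euclidean_norm xi))%:C * fourier f xi * (fourier g xi)^*%C).

Definition dirichlet_eigenfunction Omega (lambda : R) f : Prop :=
  [/\ HH Omega f, ~ ae_zero f &
    forall g, HH Omega g -> log_form f g = lambda%:C * L2_inner Omega f g].

Definition dirichlet_eigenvalue Omega (lambda : R) : Prop :=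
  exists f, dirichlet_eigenfunction Omega lambda f.

Definition complete_orthonormal Omega (phi : nat -> 'rV[R]_d -> R[i]) : Prop :=
  [/\ forall k, L2 Omega (phi k),
    forall j k, L2_inner Omega (phi j) (phi k) = (j == k)%:R &
    forall f, L2 Omega f -> (forall k, L2_inner Omega f (phi k) = 0) ->
      ae_zero f].

(* All eigenvalues repeated according to multiplicity, with indices shifted:
   lambda 0 is the first eigenvalue. *)
Definition eigenvalue_sequence Omega (lambda : nat -> R) : Prop :=
  [/\ lambda 0%N < lambda 1%N, nondecreasing_seq lambda,
    lambda k @[k --> \oo] --> +oo &
    exists2 phi, complete_orthonormal Omega phi &
      forall k, dirichlet_eigenfunction Omega (lambda k) (phi k)].

Definition first_eigenvalue Omega (lambda1 : R) : Prop :=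
  exists2 lambda, eigenvalue_sequence Omega lambda & lambda1 = lambda 0%N.

End complex_functions.

(* Main.v *)
Require Import Defs.
From HB Require Import structures.
From mathcomp Require Import all_boot all_order all_algebra.
From mathcomp Require Import complex.
From mathcomp Require Import all_classical all_reals all_analysis measurable_realfun.
From mathcomp Require Import ring lra.
Import Order.TTheory GRing.Theory Num.Theory.
Import numFieldNormedType.Exports.

Set Implicit Arguments.
Unset Strict Implicit.
Unset Printing Implicit Defensive.

Local Open Scope classical_set_scope.
Local Open Scope ring_scope.

(* Let [N = |f|_2^2] for an eigenfunction [f] with eigenvalue [lambda].  Testing
   the equation with [f] gives [(2 pi)^d lambda N = \int log |xi| |f^|^2], where
   [\int |f^|^2 = (2 pi)^d N] by Plancherel and [|f^|^2 <= |Omega| N] pointwise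
   by Cauchy-Schwarz.  For every [r > 0], integrating the pointwise bound
     [log |xi| |f^|^2 >= log r |f^|^2 - |Omega| N log^+ (r / |xi|)]
   and using [\int log^+ (r / |xi|) = |B_d| r^d / d] gives
     [lambda >= log r - |Omega| |B_d| r^d / (d (2 pi)^d)],
   which is optimal for [r^d = (2 pi)^d / (|Omega| |B_d|)].

   Plancherel is obtained by damping [|f^|^2] with [exp (- e |xi|_1)], whose
   Fourier transform is a product of Poisson kernels [K_e].  The exact identity
     [\int exp (- e |xi|_1) |f^|^2 + 1/2 \iint |f x - f y|^2 K_e (x - y)
        = (2 pi)^d |f|_2^2]
   reduces it to the vanishing of the double integral as [e] tends to [0], which
   passes from Lipschitz functions to all of [L^2].  The rate [O(e)] for test
   functions also shows that their *-norm is finite. *)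

(** * Integration on row vectors *)

(** Real-valued integrals are total, so testing the eigenvalue equation with [f] is informative only
    once [log |xi| |f^|^2] is known to be integrable. At infinity this comes from membership in
    [HH], through one approximating test function of finite *-norm; near the origin it comes from
    the pointwise bound on [|f^|^2].

    The damping uses the l^1 norm so that the factor and its transform both split into
    one-dimensional integrals with elementary antiderivatives. The price is the slow decay
    [e / h ^ 2] of the Poisson kernel, whose second moment is infinite; increments are therefore
    measured by [min 1 (h_i ^ 2)]. Writing the Plancherel defect as an integral of squared
    increments makes it monotone under pointwise comparison of increments and bounded by the L^2
    norm uniformly in [e]. These two properties carry its vanishing from Lipschitz functions to
    indicators, simple functions and L^2.

    Euler's number in the bound is the trace of the optimisation: at the optimal radius the
    subtracted term equals [1 / d], that is, [(log of Euler's number) / d]. *)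

Section lebesgue_rV_integral.
Variable R : realType.
Local Notation mu := (@lebesgue_measure R).
Local Notation lam n := (@lebesgue_rV R n).

Lemma ge0_integral_rV0 (f : 'rV[R]_0 -> \bar R) : (forall x, 0 <= f x)%E ->
  (\int[lam 0]_x f x = f 0%R)%E.
Proof.
move=> f0; rewrite (_ : f = cst (f 0)); last first.
  by apply/funext => x; rewrite (_ : x = 0)//; apply/rowP => -[].
by rewrite integral_cst//= diracT mule1.
Qed.

(** The measure in dimension [n.+1] is the image of a product under [rVcons], so Tonelli peels off
    the first coordinate; this is the induction step of the computations in dimension [n]. *)
Lemma ge0_integral_rVS n (f : 'rV[R]_n.+1 -> \bar R) :
  measurable_fun setT f -> (forall x, 0 <= f x)%E ->
  (\int[lam n.+1]_x f x = \int[mu]_a \int[lam n]_v f (rVcons (a, v)))%E.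
Proof.
move=> mf f0.
rewrite (@ge0_integral_pushforward _ _ _ _ _ _ (@measurable_rVcons R n)
  (mu \x lam n)%E _ _ measurableT)//=.
rewrite fubini_tonelli1//.
by apply: measurableT_comp => //; exact: measurable_rVcons.
Qed.

Lemma measurable_funM_prod n (h : 'I_n -> R -> R) :
  (forall i, measurable_fun setT (h i)) ->
  measurable_fun setT (fun x : 'rV[R]_n => \prod_i h i (x ord0 i)).
Proof.
move=> mh; apply: measurable_prod => i _.
apply: measurableT_comp => //; exact: measurable_coord.
Qed.

Lemma integral_prod_coord n (h : 'I_n -> R -> R) (c : 'I_n -> R) :
  (forall i, measurable_fun setT (h i)) -> (forall i x, 0 <= h i x) ->
  (forall i, \int[mu]_x (h i x)%:E = (c i)%:E)%E ->
  (\int[lam n]_x (\prod_i h i (x ord0 i))%:E = (\prod_i c i)%:E)%E.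
Proof.
elim: n h c => [|n IH] h c mh h0 hc.
  by rewrite ge0_integral_rV0 ?big_ord0// => x; rewrite lee_fin big_ord0.
rewrite ge0_integral_rVS; last 2 first.
- by apply/measurable_EFinP; exact: measurable_funM_prod.
- by move=> x; rewrite lee_fin; apply: prodr_ge0.
under eq_integral => a _ do under eq_integral => v _ do
  (rewrite big_ord_recl rVcons0/=; under eq_bigr do rewrite rVcons_lift/=;
   rewrite EFinM).
under eq_integral => a _.
  rewrite ge0_integralZl//=; last 3 first.
  - by apply/measurable_EFinP; apply: (measurable_funM_prod (h := fun i => h (lift ord0 i))).
  - by move=> v _; rewrite lee_fin; apply: prodr_ge0.
  - by rewrite lee_fin.
  rewrite (IH (fun i => h (lift ord0 i)) (fun i => c (lift ord0 i)))//.
  over.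
rewrite ge0_integralZr//=; last 3 first.
- by apply/measurable_EFinP; exact: mh.
- by move=> a _; rewrite lee_fin.
- rewrite lee_fin; apply: prodr_ge0 => i _.
  by rewrite -lee_fin -hc; apply: integral_ge0 => x _; rewrite lee_fin.
by rewrite hc -EFinM [in RHS]big_ord_recl.
Qed.

Lemma measurable_scale_rV n (t : R) :
  measurable_fun setT (fun x : 'rV[R]_n => t *: x).
Proof.
apply: measurable_fun_rV => i; under eq_fun do rewrite mxE.
by apply: measurable_funM => //; exact: measurable_coord.
Qed.

(** By uniqueness of Lebesgue measure: [t] times the image of [mu] under multiplication by [t] gives
    each interval []a, b]] its length, hence is [mu]. *)
Lemma ge0_integral_lebesgue_scale (t : R) (f : R -> \bar R) : 0 < t ->
  measurable_fun setT f -> (forall x, 0 <= f x)%E ->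
  (t%:E * \int[mu]_x f (t * x)%R = \int[mu]_x f x)%E.
Proof.
move=> t0 mf f0.
have mt : measurable_fun setT (fun x : R => t * x : measurableTypeR R).
  exact: measurable_funM.
pose nu : {measure set (measurableTypeR R) -> \bar R} :=
  mscale (NngNum (ltW t0)) (measure_function_pushforward__canonical__measure_function_Measure mu mt).
have nuE A : measurable A -> mu A = nu A.
  apply: lebesgue_measure_unique => _ [[a b] _ <-].
  rewrite /nu /= /mscale /= /pushforward.
  have -> : (fun x : R => t * x) @^-1` `]a, b]%classic =
      `]a / t, b / t]%classic.
    apply/seteqP; split => x /=; rewrite !in_itv/= ltr_pdivrMr// ler_pdivlMr//;
      by rewrite ![_ * t]mulrC.
  rewrite !lebesgue_measure_itv/= !lte_fin ltr_pM2r ?invr_gt0//.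
  case: ifP => _; last by rewrite mule0.
  rewrite -!EFinB -EFinM; congr EFin; field; exact: lt0r_neq0.
rewrite [RHS](eq_measure_integral nu); last by move=> A mA _; exact: nuE.
rewrite /nu ge0_integral_mscale//; congr (_ * _)%E.
by rewrite ge0_integral_pushforward.
Qed.

Lemma ge0_integral_lebesgue_rV_scale n (t : R) (f : 'rV[R]_n -> \bar R) :
  0 < t -> measurable_fun setT f -> (forall x, 0 <= f x)%E ->
  ((t ^+ n)%:E * \int[lam n]_x f (t *: x)%R = \int[lam n]_x f x)%E.
Proof.
move=> t0; elim: n f => [|n IH] f mf f0.
  by rewrite !ge0_integral_rV0// expr0 mul1e scaler0.
have mfc : measurable_fun setT (f \o @rVcons R n).
  by apply: measurableT_comp => //; exact: measurable_rVcons.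
rewrite !ge0_integral_rVS//; last first.
  by apply: measurableT_comp => //; exact: measurable_scale_rV.
pose g a := (\int[lam n]_v f (rVcons (a, v)))%E.
have mg : measurable_fun setT g.
  by apply: (measurable_fun_fubini_tonelli_F (m2 := lam n) (f \o @rVcons R n)) => //= x; exact: f0.
have g0 a : (0 <= g a)%E by exact: integral_ge0.
rewrite -(ge0_integral_lebesgue_scale t0 mg g0) exprS EFinM -muleA.
congr (_ * _)%E.
rewrite -ge0_integralZl//; last 3 first.
- apply: (measurable_fun_fubini_tonelli_F (fun p => f (t *: rVcons p)%R)) => //.
  apply: measurableT_comp => //.
  by apply: measurableT_comp; [exact: measurable_scale_rV|exact: measurable_rVcons].
- by move=> a _; exact: integral_ge0.
- by rewrite lee_fin exprn_ge0// ltW.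
apply: eq_integral => a _; rewrite /g -[RHS]IH//; last first.
  exact: (measurableT_comp mfc (pair1_measurable (t * a : measurableTypeR R))).
congr (_ * _)%E; apply: eq_integral => v _; congr f.
apply/rowP => i; rewrite mxE; case: (unliftP ord0 i) => [j|] ->.
  by rewrite !rVcons_lift/= mxE.
by rewrite !rVcons0.
Qed.

Lemma lebesgue_rV_scale n (t : R) (A : set 'rV[R]_n) : 0 < t -> measurable A ->
  ((t ^+ n)%:E * lam n [set x | A (t *: x)] = lam n A)%E.
Proof.
move=> t0 mA.
have mtA : measurable [set x : 'rV[R]_n | A (t *: x)].
  by rewrite -[X in measurable X]setTI; exact: measurable_scale_rV.
have indE B : measurable B -> (lam n B = \int[lam n]_x (\1_B x)%:E)%E.
  by move=> mB; rewrite integral_indic// setIT.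
rewrite !indE// -[RHS](@ge0_integral_lebesgue_rV_scale n t)//.
exact/measurable_EFinP/measurable_indic.
Qed.

Lemma ball_rVE n (x : 'rV[R]_n) (e : R) : 0 < e ->
  ball x e = [set y : 'rV[R]_n | forall i, `|x ord0 i - y ord0 i| < e].
Proof.
move=> e0; apply/seteqP; split => y.
  by move=> [_ h] i; exact: h.
by move=> h; split => // i j; rewrite (ord1 i); exact: h.
Qed.

Lemma measurable_box n (A : 'I_n -> set R) : (forall i, measurable (A i)) ->
  measurable [set x : 'rV[R]_n | forall i, A i (x ord0 i)].
Proof.
move=> mA; rewrite (_ : mkset _ = \bigcap_(i in [set: 'I_n])
    ((fun x : 'rV[R]_n => x ord0 i) @^-1` A i)); last first.
  by apply/seteqP; split => x /= h i; [move=> _; exact: h|exact: (h i Logic.I)].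
apply: fin_bigcap_measurable => // i _.
by rewrite -[X in measurable X]setTI; exact: measurable_coord.
Qed.

Lemma measurable_ball_rV n (x : 'rV[R]_n) (e : R) : measurable (ball x e).
Proof.
have [e0|e0] := ltP 0 e; last first.
  rewrite (_ : ball _ _ = set0)//; apply/seteqP; split => // y [/lt_le_trans].
  by move=> /(_ _ e0); rewrite ltxx.
rewrite ball_rVE// (_ : mkset _ = [set y : 'rV[R]_n | forall i, ball (x ord0 i) e (y ord0 i)])//.
exact: (measurable_box (fun i => measurable_ball (x ord0 i) e)).
Qed.

(** The sigma-algebra is generated by the coordinates, so an open set has to be traced back to
    boxes: it is the countable union of the sup-norm balls with rational centre and radius
    [1 / (k + 1)] that it contains. *)
Lemma open_measurable_rV n (U : set 'rV[R]_n) : open U -> measurable U.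
Proof.
move=> oU.
pose c (p : 'rV[rat]_n * nat) : 'rV[R]_n := map_mx ratr p.1.
pose F p := if `[< ball (c p) p.2.+1%:R^-1 `<=` U >]
  then ball (c p) p.2.+1%:R^-1 else set0.
rewrite (_ : U = \bigcup_p F p).
  apply: countable_bigcupT_measurable => // p; rewrite /F; case: ifP => // _.
  exact: measurable_ball_rV.
apply/seteqP; split => [x Ux|x [p _]]; last first.
  by rewrite /F; case: ifPn => // /asboolP; exact.
have /nbhs_ballP[e /= e0 xeU] : nbhs x U by exact: open_nbhs_nbhs.
have [k _ ke] := near_infty_natSinv_lt (PosNum (divr_gt0 e0 (ltr0n R 2))).
have {ke} : k.+1%:R^-1 < e / 2 := ke k (leqnn k).
set k1 : R := k.+1%:R^-1 => ke.
have k10 : 0 < k1 by rewrite invr_gt0.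
have /choice[q hq] : forall i, exists q : rat,
    ratr q \in `]x ord0 i - k1, x ord0 i + k1[.
  by move=> i; apply: rat_in_itvoo; lra.
exists ((\row_i q i), k) => //; rewrite /F /=.
have xq i : `|x ord0 i - ratr (q i)| < k1.
  move: (hq i); rewrite in_itv/= ltr_norml => /andP[? ?]; apply/andP; split; lra.
have xc : ball (c (\row_i q i, k)) k1 x.
  by rewrite ball_rVE// => i; rewrite !mxE distrC.
case: ifPn => // /asboolP; apply => y yc; apply: xeU.
apply: (@le_ball _ _ _ (k1 + k1)); first by rewrite -/k1 in ke *; lra.
by apply: ball_triangle yc; exact: ball_sym.
Qed.

Lemma continuous_measurable_rV n (u : 'rV[R]_n -> R) :
  continuous u -> measurable_fun setT u.
Proof.
move=> cu; apply: (measurability _ (RGenOInfty.measurableE R)) => //.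
move=> _ [_ [r ->] <-]; rewrite setTI; apply: open_measurable_rV.
by move/continuousP : cu; apply; rewrite set_itvoy; exact: open_gt.
Qed.

End lebesgue_rV_integral.

(** * The Poisson kernel *)

Section poisson.
Variable R : realType.
Local Notation mu := (@lebesgue_measure R).
Local Notation lam n := (@lebesgue_rV R n).

(** Reduces integrals over the line to the half-line, where the fundamental theorem of calculus
    applies to an antiderivative with a limit at infinity. *)
Lemma ge0_integralT_halves (f : R -> \bar R) :
  measurable_fun setT f -> (forall x, 0 <= f x)%E ->
  (\int[mu]_x f x = \int[mu]_(x in `[0%R, +oo[) f x +
                    \int[mu]_(x in `[0%R, +oo[) f (- x)%R)%E.
Proof.
move=> mf f0.
have mpos : measurable [set x : R | 0 <= x] by rewrite -set_itvcy.
rewrite -(setUv [set x : R | 0 <= x]) ge0_integral_setU//= ; last 3 first.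
- exact: measurableC.
- by rewrite setUv.
- exact/disj_setPCl.
rewrite -set_itvcy// setCitvr; congr (_ + _)%E.
rewrite integral_itv_bndo_bndc; last exact: measurable_funTS.
rewrite (ge0_integration_by_substitution0 (f := fun x => f (- x)%R))//.
  by apply: eq_integral => x _; rewrite opprK.
by apply: measurableT_comp => //; exact: oppr_measurable.
Qed.

Lemma is_derive1_eq (f g : R -> R) (x a b : R) :
  is_derive x 1 f a -> f =1 g -> a = b -> is_derive x 1 g b.
Proof. by move=> df /funext <- <-. Qed.

Lemma is_derive1_affine (a b x : R) : is_derive x 1 (fun y => a * y + b) a.
Proof.
apply: (is_derive1_eq (is_deriveD (is_deriveZ a (is_derive_id x (1 : R)))
  (is_derive_cst b x (1 : R)))) => //.
by rewrite addr0 /GRing.scale/= mulr1.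
Qed.

Lemma cos1_ge0 (x : R) : 0 <= 1 + cos x.
Proof. by have := cos_geN1 x; lra. Qed.

Lemma measurable_cos_comp d (T : measurableType d) (f : T -> R) :
  measurable_fun setT f -> measurable_fun setT (fun x => cos (f x)).
Proof.
move=> mf; apply: (measurableT_comp (f := @cos R)) => //.
by apply: continuous_measurable_fun; exact: continuous_cos.
Qed.

(* The Fourier transform of [exp (- e |x|)]. *)
Definition poisson (e h : R) := 2 * e / (e ^+ 2 + h ^+ 2).

Lemma poisson_den_gt0 (e h : R) : 0 < e -> 0 < e ^+ 2 + h ^+ 2.
Proof. by move=> e0; rewrite ltr_pwDl ?exprn_gt0// sqr_ge0. Qed.

Lemma poisson_ge0 (e h : R) : 0 < e -> 0 <= poisson e h.
Proof.
move=> e0; rewrite /poisson divr_ge0//; first by rewrite mulr_ge0// ltW.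
by rewrite ltW// poisson_den_gt0.
Qed.

Lemma poissonC (e x y : R) : poisson e (x - y) = poisson e (y - x).
Proof. by rewrite /poisson -[(x - y) ^+ 2]sqrrN opprB. Qed.

Lemma continuous_poisson (e : R) : 0 < e -> continuous (poisson e).
Proof.
move=> e0 x; apply: cvgM; first exact: cvg_cst.
apply: cvgV; first exact/lt0r_neq0/poisson_den_gt0.
by apply: cvgD; [exact: cvg_cst|exact: exprn_continuous].
Qed.

Lemma measurable_poisson (e : R) : 0 < e -> measurable_fun setT (poisson e).
Proof. by move=> e0; apply: continuous_measurable_fun; exact: continuous_poisson. Qed.

Lemma integral_poisson_half (e x : R) : 0 < e ->
  (\int[mu]_(y in `[0%R, +oo[) (poisson e (y - x))%:E =
   (pi + 2 * atan (x / e))%:E)%E.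
Proof.
move=> e0.
pose F (y : R) := 2 * atan ((y - x) / e).
have dF (y : R) : is_derive y 1 F (poisson e (y - x)).
  have d1 := is_derive1_affine e^-1 (- (x / e)) y.
  have d2 : is_derive (e^-1 * y + - (x / e)) 1 (@atan R) _ := is_derive1_atan _.
  have d3 := @is_derive1_comp R atan (fun y => e^-1 * y + - (x / e)) y _ _ d2 d1.
  refine (is_derive1_eq (is_deriveZ 2 d3) _ _).
    by move=> z; rewrite /F mulrBl [z * _]mulrC.
  rewrite /poisson /GRing.scale /=.
  have h := poisson_den_gt0 (y - x) e0.
  by field; rewrite !lt0r_neq0.
rewrite (@ge0_continuous_FTC2y _ _ F 0 pi).
- rewrite /F sub0r mulNr atanN -EFinD; congr EFin; ring.
- by move=> *; exact: poisson_ge0.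
- apply: continuous_subspaceT => y.
  apply: (@continuous_comp _ _ _ (fun y => y - x) (poisson e)).
    by apply: cvgB; [exact: cvg_id|exact: cvg_cst].
  exact: continuous_poisson.
- rewrite (_ : pi = 2 * (pi / 2)); last by rewrite mulrC divfK.
  apply: cvgM; first exact: cvg_cst.
  apply: (@cvg_comp _ _ _ (fun y : R => (y - x) / e) atan _ (pinfty_nbhs R)); last exact: cvgy_atan.
  apply: gt0_cvgMly; first by rewrite invr_gt0.
  exact: cvg_addrr.
- by move=> y _; have [] := dF y.
- apply: cvg_at_right_filter; apply: differentiable_continuous.
  by apply/derivable1_diffP; have [] := dF 0.
- by move=> y _; rewrite derive1E; have [_ ->] := dF y.
Qed.

Lemma integral_poisson (e x : R) : 0 < e ->
  (\int[mu]_y (poisson e (x - y))%:E = (2 * pi)%:E)%E.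
Proof.
move=> e0; rewrite ge0_integralT_halves; last 2 first.
- apply/measurable_EFinP; apply: measurableT_comp; first exact: measurable_poisson.
  exact: measurable_funB.
- by move=> y; rewrite lee_fin poisson_ge0.
under eq_integral do rewrite poissonC.
rewrite integral_poisson_half//.
under eq_integral do rewrite opprK addrC -[X in _ + X]opprK.
rewrite integral_poisson_half// mulNr atanN -EFinD; congr EFin; ring.
Qed.

Lemma integral_expR_cos_half (e z p : R) : 0 < e ->
  (\int[mu]_(x in `[0%R, +oo[) (expR (- (e * x)) * (1 + cos (z * x + p)))%:E =
   (e^-1 + (e * cos p - z * sin p) / (e ^+ 2 + z ^+ 2))%:E)%E.
Proof.
move=> e0; have h0 := poisson_den_gt0 z e0.
pose D := e ^+ 2 + z ^+ 2.
(* The oscillating part of [expR (- e x) * G x] is the real part of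
   [exp ((- e + i z) x + i p) / (- e + i z)], a complex antiderivative of
   [exp ((- e + i z) x + i p)]. *)
pose G (x : R) := - e^-1 + ((z / D) * sin (z * x + p) + (- (e / D)) * cos (z * x + p)).
pose F (x : R) := expR (- e * x + 0) * G x.
have dexp (x : R) : is_derive x 1 (fun x => expR (- e * x + 0)) (expR (- e * x + 0) * - e).
  have d1 := is_derive1_affine (- e) 0 x.
  exact: (@is_derive1_comp R expR (fun x => - e * x + 0) x _ _ (is_derive_expR _) d1).
have dG (x : R) : is_derive x 1 G (0 + ((z / D) *: (cos (z * x + p) * z) +
    (- (e / D)) *: (- sin (z * x + p) * z))).
  have d1 := is_derive1_affine z p x.
  have d2 := @is_derive1_comp R sin (fun x => z * x + p) x _ _ (is_derive_sin _) d1.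
  have d3 := @is_derive1_comp R cos (fun x => z * x + p) x _ _ (is_derive_cos _) d1.
  exact: (is_deriveD (is_derive_cst (- e^-1) x (1 : R)) (is_deriveD (is_deriveZ (z / D) d2)
    (is_deriveZ (- (e / D)) d3))).
have dF (x : R) : is_derive x 1 F (expR (- (e * x)) * (1 + cos (z * x + p))).
  refine (is_derive1_eq (is_deriveM (dexp x) (dG x)) _ _) => //.
  rewrite /G /GRing.scale /= addr0 mulNr.
  by rewrite /D; field; rewrite !lt0r_neq0.
have cts (x : R) : {for x, continuous F}.
  apply: differentiable_continuous.
  by apply/derivable1_diffP; have [] := dF x.
rewrite (@ge0_continuous_FTC2y _ _ F 0 0).
- rewrite /F /G !mulr0 !add0r expR0 mul1r -EFinN; congr EFin.
  by rewrite /D; field; rewrite !lt0r_neq0.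
- by move=> x _; rewrite mulr_ge0 ?expR_ge0 ?cos1_ge0.
- apply: continuous_subspaceT => x; apply: cvgM.
    apply: (@continuous_comp _ _ _ (fun x => - (e * x)) expR); last exact: continuous_expR.
    by apply: cvgN; apply: cvgM; [exact: cvg_cst|exact: cvg_id].
  apply: cvgD; first exact: cvg_cst.
  apply: (@continuous_comp _ _ _ (fun x => z * x + p) cos); last exact: continuous_cos.
  by apply: cvgD; [apply: cvgM; [exact: cvg_cst|exact: cvg_id]|exact: cvg_cst].
- pose M := e^-1 + (`|z / D| + `|e / D|).
  have GM x : `|G x| <= M.
    rewrite (le_trans (ler_normD _ _))// /M normrN lerD//.
      by rewrite ger0_norm// invr_ge0 ltW.
    rewrite (le_trans (ler_normD _ _))//; apply: lerD.
      by rewrite normrM ler_piMr// ler_norml sin_geN1 sin_le1.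
    by rewrite normrM normrN ler_piMr// ler_norml cos_geN1 cos_le1.
  have eM : M * expR (- (e * x)) @[x --> +oo] --> M * 0.
    apply: cvgM; first exact: cvg_cst.
    apply: (@cvg_comp _ _ _ (fun x => e * x) (fun x : R => expR (- x)) _ (pinfty_nbhs R)); last exact: cvgr_expR.
    exact: gt0_cvgMry.
  rewrite mulr0 in eM.
  apply/norm_cvg0P/(squeeze_cvgr _ (cvg_cst 0) eM).
  near=> x; rewrite normr_ge0/= /F normrM mulrC addr0 mulNr [`|expR _|]ger0_norm ?expR_ge0//.
  by rewrite ler_wpM2r ?expR_ge0.
- by move=> x _; have [] := dF x.
- by apply: cvg_at_right_filter; exact: cts.
- by move=> x _; rewrite derive1E; have [_ ->] := dF x.
Unshelve. all: by end_near. Qed.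

Lemma measurable_expR_abs (e : R) :
  measurable_fun setT (fun x : R => expR (- (e * `|x|))).
Proof.
apply: measurableT_comp => //; apply: measurableT_comp; first exact: oppr_measurable.
by apply: measurable_funM => //; exact: normr_measurable.
Qed.

(** The reflected half-line carries the frequency [- z] with the same phase, so the sine terms of
    the two halves cancel and only [cos p] survives. *)
Lemma integral_expR_cos (e z p : R) : 0 < e ->
  (\int[mu]_x (expR (- (e * `|x|)) * (1 + cos (z * x + p)))%:E =
   (2 / e + cos p * poisson e z)%:E)%E.
Proof.
move=> e0; rewrite ge0_integralT_halves; last 2 first.
- apply/measurable_EFinP/measurable_funM; first exact: measurable_expR_abs.
  apply: measurable_funD => //; apply: measurable_cos_comp.
  by apply: measurable_funD => //; exact: measurable_funM.
- by move=> x; rewrite lee_fin mulr_ge0 ?expR_ge0 ?cos1_ge0.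
have -> : (\int[mu]_(x in `[0%R, +oo[) (expR (- (e * `|x|)) * (1 + cos (z * x + p)))%:E =
  \int[mu]_(x in `[0%R, +oo[) (expR (- (e * x)) * (1 + cos (z * x + p)))%:E)%E.
  by apply: eq_integral => x; rewrite inE/= in_itv/= andbT => x0; rewrite ger0_norm.
have -> : (\int[mu]_(x in `[0%R, +oo[) (expR (- (e * `|- x|)) * (1 + cos (z * - x + p)))%:E =
  \int[mu]_(x in `[0%R, +oo[) (expR (- (e * x)) * (1 + cos (- z * x + p)))%:E)%E.
  apply: eq_integral => x; rewrite inE/= in_itv/= andbT => x0.
  by rewrite normrN ger0_norm// mulrN mulNr.
rewrite !integral_expR_cos_half// -EFinD; congr EFin.
have h0 := poisson_den_gt0 z e0.
by rewrite /poisson sqrrN; field; rewrite !lt0r_neq0.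
Qed.

Definition decay n (e : R) (x : 'rV[R]_n) := \prod_i expR (- (e * `|x ord0 i|)).

Definition poisson_rV n (e : R) (x : 'rV[R]_n) := \prod_i poisson e (x ord0 i).

Lemma decay_ge0 n e (x : 'rV[R]_n) : 0 <= decay e x.
Proof. by apply: prodr_ge0 => i _; exact: expR_ge0. Qed.

Lemma poisson_rV_ge0 n (e : R) (x : 'rV[R]_n) : 0 < e -> 0 <= poisson_rV e x.
Proof. by move=> e0; apply: prodr_ge0 => i _; exact: poisson_ge0. Qed.

Lemma measurable_decay n (e : R) : measurable_fun setT (@decay n e).
Proof.
apply: (measurable_funM_prod (h := fun i x => expR (- (e * `|x|)))) => i.
exact: measurable_expR_abs.
Qed.

Lemma measurable_poisson_rV n (e : R) : 0 < e -> measurable_fun setT (@poisson_rV n e).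
Proof.
move=> e0; apply: (measurable_funM_prod (h := fun i x => poisson e x)) => i.
exact: measurable_poisson.
Qed.

Lemma poisson_rVC n e (x y : 'rV[R]_n) : poisson_rV e (x - y) = poisson_rV e (y - x).
Proof. by apply: eq_bigr => i _; rewrite !mxE poissonC. Qed.

Lemma integral_poisson_rV n e (x : 'rV[R]_n) : 0 < e ->
  (\int[lam n]_y (poisson_rV e (x - y))%:E = ((2 * pi) ^+ n)%:E)%E.
Proof.
move=> e0.
have := @integral_prod_coord R n (fun i y => poisson e (x ord0 i - y)) (fun=> 2 * pi).
rewrite prodr_const card_ord => <-//.
- by apply: eq_integral => y _; congr EFin; apply: eq_bigr => i _; rewrite !mxE.
- move=> i; apply: measurableT_comp; first exact: measurable_poisson.
  exact: measurable_funB.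
- by move=> i y; exact: poisson_ge0.
- by move=> i; exact: integral_poisson.
Qed.

Lemma measurable_dot n (z : 'rV[R]_n) : measurable_fun setT (dot z).
Proof.
apply: measurable_sum => i; apply: measurable_funM => //; exact: measurable_coord.
Qed.

Lemma poisson_le e z : 0 < e -> poisson e z <= 2 / e.
Proof.
move=> e0; have h := poisson_den_gt0 z e0.
rewrite /poisson ler_pdivrMr// [leRHS](_ : _ = 2 * e + 2 / e * z ^+ 2); last first.
  by field; exact: lt0r_neq0.
by rewrite lerDl mulr_ge0 ?sqr_ge0// divr_ge0// ltW.
Qed.

Lemma poisson_rV_le n e (z : 'rV[R]_n) : 0 < e -> poisson_rV e z <= (2 / e) ^+ n.
Proof.
move=> e0; rewrite -[in leRHS](card_ord n) -prodr_const.
by apply: ler_prod => i _; rewrite poisson_ge0//= poisson_le.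
Qed.

(* [1 + cos] in place of [cos] keeps the integrand nonnegative, so that Tonelli
   applies without an integrability argument. *)
Lemma integral_decay_1cos n (e p : R) (z : 'rV[R]_n) : 0 < e ->
  (\int[lam n]_x (decay e x * (1 + cos (dot z x + p)))%:E =
   ((2 / e) ^+ n + cos p * poisson_rV e z)%:E)%E.
Proof.
(* The phase [p] must stay general in the induction: once the first coordinate [a] is split off, the
   term [z_0 a] joins the phase of the remaining coordinates. *)
move=> e0; elim: n p z => [|n IH] p z.
  rewrite ge0_integral_rV0/=; last first.
    by move=> x; rewrite lee_fin mulr_ge0 ?decay_ge0 ?cos1_ge0.
  by rewrite /decay /poisson_rV /dot !big_ord0 mul1r add0r mulr1 expr0.
have mint m (w : 'rV[R]_m) q : measurable_fun setT (fun x => (decay e x * (1 + cos (dot w x + q)))%:E).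
  apply/measurable_EFinP/measurable_funM; first exact: measurable_decay.
  apply: measurable_funD => //; apply: measurable_cos_comp.
  by apply: measurable_funD => //; exact: measurable_dot.
have int0 m (w : 'rV[R]_m) q x : (0 <= (decay e x * (1 + cos (dot w x + q)))%:E)%E.
  by rewrite lee_fin mulr_ge0 ?decay_ge0 ?cos1_ge0.
rewrite ge0_integral_rVS//.
pose z' := \row_i z ord0 (lift ord0 i) : 'rV[R]_n.
pose w (a : R) := expR (- (e * `|a|)).
have splitE a v : decay e (rVcons (a, v)) * (1 + cos (dot z (rVcons (a, v)) + p)) =
  w a * (decay e v * (1 + cos (dot z' v + (z ord0 ord0 * a + p)))).
  rewrite /decay big_ord_recl rVcons0/= -mulrA; congr (_ * (_ * (1 + cos _))).
    by apply: eq_bigr => i _; rewrite rVcons_lift.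
  rewrite /dot big_ord_recl rVcons0/= [z ord0 ord0 * _ + _]addrC -!addrA; congr (_ + _).
  by apply: eq_bigr => i _; rewrite rVcons_lift mxE.
pose A := (2 / e) ^+ n; pose K := poisson_rV e z'.
under eq_integral => a _.
  under eq_integral => v _ do rewrite splitE EFinM.
  rewrite ge0_integralZl//=; last 2 first.
  - exact: mint.
  - by rewrite lee_fin expR_ge0.
  rewrite IH -EFinM -/A -/K.
  over.
(* The integrand [w (A + K cos)] is rewritten as a nonnegative combination of integrands
   [w (1 + cos)]. The surplus [A - K], nonnegative since each kernel factor is at most [2 / e], is
   attached to frequency 0 and phase [pi / 2], where the cosine vanishes. *)
have AK : 0 <= A - K by rewrite subr_ge0 poisson_rV_le.
have K0 : 0 <= K by exact: poisson_rV_ge0.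
have -> : (\int[mu]_a (w a * (A + cos (z ord0 ord0 * a + p) * K))%:E =
  \int[mu]_a ((A - K)%:E * (w a * (1 + cos (0 * a + pi / 2)))%:E +
              K%:E * (w a * (1 + cos (z ord0 ord0 * a + p)))%:E))%E.
  apply: eq_integral => a _; rewrite -!EFinM -EFinD; congr EFin.
  rewrite mul0r add0r cos_pihalf; ring.
have mw y q : measurable_fun setT (fun a => (w a * (1 + cos (y * a + q)))%:E).
  apply/measurable_EFinP/measurable_funM; first exact: measurable_expR_abs.
  apply: measurable_funD => //; apply: measurable_cos_comp.
  by apply: measurable_funD => //; exact: measurable_funM.
have w0 y q a : (0 <= (w a * (1 + cos (y * a + q)))%:E)%E.
  by rewrite lee_fin mulr_ge0 ?expR_ge0 ?cos1_ge0.
rewrite ge0_integralD//=; last 4 first.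
- by move=> a _; rewrite mule_ge0.
- by apply: measurable_funeM; exact: mw.
- by move=> a _; rewrite mule_ge0.
- by apply: measurable_funeM; exact: mw.
rewrite ge0_integralZl//=; last exact: mw.
rewrite ge0_integralZl//=; last exact: mw.
rewrite !integral_expR_cos// -!EFinM -EFinD; congr EFin.
rewrite cos_pihalf exprS [in RHS]/poisson_rV big_ord_recl -/A.
have -> : \prod_(i < n) poisson e (z ord0 (lift ord0 i)) = K.
  by apply: eq_bigr => i _; rewrite mxE.
ring.
Qed.

End poisson.

(** * The Poisson energy of square-integrable functions *)

Section poisson_energy.
Variables (R : realType) (n : nat).
Local Notation T := 'rV[R]_n.
Local Notation lam := (@lebesgue_rV R n).
Local Notation K := (@poisson_rV R n).
Local Notation C := ((2 * pi) ^+ n : R).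

Lemma measurable_sub_rV : measurable_fun setT (fun p : T * T => p.1 - p.2).
Proof.
apply: measurable_fun_rV => i; under eq_fun do rewrite !mxE.
apply: measurable_funB.
  by apply: (measurableT_comp (measurable_coord i)); exact: measurable_fst.
by apply: (measurableT_comp (measurable_coord i)); exact: measurable_snd.
Qed.

Lemma measurable_poisson_sub (e : R) : 0 < e ->
  measurable_fun setT (fun p : T * T => K e (p.1 - p.2)).
Proof.
move=> e0.
exact: (measurableT_comp (measurable_poisson_rV e0) measurable_sub_rV).
Qed.

Lemma integral_kernel1 (Q w : T -> R) (c : R) :
  measurable_fun setT Q -> (forall z, 0 <= Q z) ->
  (forall x, \int[lam]_y (Q (x - y))%:E = c%:E)%E ->
  measurable_fun setT w -> (forall x, 0 <= w x) ->
  (\int[lam \x lam]_p (w p.1 * Q (p.1 - p.2))%:E = c%:E * \int[lam]_x (w x)%:E)%E.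
Proof.
move=> mQ Q0 hc mw w0.
have mQs := measurableT_comp mQ measurable_sub_rV.
rewrite fubini_tonelli1/=; last 2 first.
- apply/measurable_EFinP/measurable_funM; last exact: mQs.
  by apply: (measurableT_comp mw); exact: measurable_fst.
- by move=> p; rewrite lee_fin mulr_ge0.
rewrite /fubini_F/=; under eq_integral => x _.
  under eq_integral do rewrite EFinM.
  rewrite ge0_integralZl//=; last 3 first.
  - apply/measurable_EFinP.
    exact: (measurableT_comp mQs (pair1_measurable x)).
  - by move=> y _; rewrite lee_fin.
  - by rewrite lee_fin.
  rewrite hc muleC.
  over.
rewrite ge0_integralZl//=.
- exact/measurable_EFinP.
- by move=> x _; rewrite lee_fin.
- by rewrite -(hc 0); apply: integral_ge0 => y _; rewrite lee_fin.
Qed.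

Lemma integral_kernel2 (Q w : T -> R) (c : R) :
  measurable_fun setT Q -> (forall z, 0 <= Q z) ->
  (forall x y, Q (x - y) = Q (y - x)) ->
  (forall x, \int[lam]_y (Q (x - y))%:E = c%:E)%E ->
  measurable_fun setT w -> (forall x, 0 <= w x) ->
  (\int[lam \x lam]_p (w p.2 * Q (p.1 - p.2))%:E = c%:E * \int[lam]_x (w x)%:E)%E.
Proof.
move=> mQ Q0 QC hc mw w0.
have mQs := measurableT_comp mQ measurable_sub_rV.
rewrite fubini_tonelli2/=; last 2 first.
- apply/measurable_EFinP/measurable_funM; last exact: mQs.
  by apply: (measurableT_comp mw); exact: measurable_snd.
- by move=> p; rewrite lee_fin mulr_ge0.
rewrite -(integral_kernel1 mQ Q0 hc mw w0) fubini_tonelli1/=; last 2 first.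
- apply/measurable_EFinP/measurable_funM; last exact: mQs.
  by apply: (measurableT_comp mw); exact: measurable_fst.
- by move=> p; rewrite lee_fin mulr_ge0.
by apply: eq_integral => x _; apply: eq_integral => y _ /=; rewrite QC.
Qed.

Lemma integral_poisson_sub1 (e : R) (w : T -> R) : 0 < e ->
  measurable_fun setT w -> (forall x, 0 <= w x) ->
  (\int[lam \x lam]_p (w p.1 * K e (p.1 - p.2))%:E = C%:E * \int[lam]_x (w x)%:E)%E.
Proof.
move=> e0; apply: integral_kernel1; first exact: measurable_poisson_rV.
  by move=> z; exact: poisson_rV_ge0.
by move=> x; exact: integral_poisson_rV.
Qed.

Lemma integral_poisson_sub2 (e : R) (w : T -> R) : 0 < e ->
  measurable_fun setT w -> (forall x, 0 <= w x) ->
  (\int[lam \x lam]_p (w p.2 * K e (p.1 - p.2))%:E = C%:E * \int[lam]_x (w x)%:E)%E.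
Proof.
move=> e0; apply: integral_kernel2; first exact: measurable_poisson_rV.
- by move=> z; exact: poisson_rV_ge0.
- by move=> x y; exact: poisson_rVC.
- by move=> x; exact: integral_poisson_rV.
Qed.

(** For the real and imaginary parts of a function together, this is twice the mass that damping
    removes from the Plancherel integral, see [parseval_energy]. *)
Definition energy (e : R) (u : T -> R) : \bar R :=
  (\int[lam \x lam]_p ((u p.1 - u p.2) ^+ 2 * K e (p.1 - p.2))%:E)%E.

Lemma measurable_energy (e : R) (u : T -> R) : 0 < e -> measurable_fun setT u ->
  measurable_fun setT (fun p : T * T => (u p.1 - u p.2) ^+ 2 * K e (p.1 - p.2)).
Proof.
move=> e0 mu; apply: measurable_funM; last exact: measurable_poisson_sub.
apply: measurable_funX; apply: measurable_funB.
  by apply: (measurableT_comp mu); exact: measurable_fst.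
by apply: (measurableT_comp mu); exact: measurable_snd.
Qed.

Lemma energy_integrand_ge0 (e : R) (u : T -> R) (p : T * T) : 0 < e ->
  0 <= (u p.1 - u p.2) ^+ 2 * K e (p.1 - p.2).
Proof. by move=> e0; rewrite mulr_ge0 ?sqr_ge0 ?poisson_rV_ge0. Qed.

Lemma energy_ge0 (e : R) (u : T -> R) : 0 < e -> (0 <= energy e u)%E.
Proof. by move=> e0; apply: integral_ge0 => p _; rewrite lee_fin energy_integrand_ge0. Qed.

Lemma energy_le2 (e a b : R) (u v w : T -> R) : 0 < e -> 0 <= a -> 0 <= b ->
  measurable_fun setT u -> measurable_fun setT v -> measurable_fun setT w ->
  (forall x y, (w x - w y) ^+ 2 <= a * (u x - u y) ^+ 2 + b * (v x - v y) ^+ 2) ->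
  (energy e w <= a%:E * energy e u + b%:E * energy e v)%E.
Proof.
move=> e0 a0 b0 mu mv mw h.
have mE (f : T -> R) : measurable_fun setT f ->
    measurable_fun setT (fun p : T * T => ((f p.1 - f p.2) ^+ 2 * K e (p.1 - p.2))%:E).
  by move=> mf; apply/measurable_EFinP; exact: (measurable_energy e0 mf).
have E0 (f : T -> R) (p : T * T) : (0 <= ((f p.1 - f p.2) ^+ 2 * K e (p.1 - p.2))%:E)%E.
  by rewrite lee_fin energy_integrand_ge0.
rewrite /energy -!ge0_integralZl//; [|exact: mE|exact: mE].
rewrite -ge0_integralD//; last 4 first.
- by move=> p _; rewrite mule_ge0.
- by apply: measurable_funeM; exact: mE.
- by move=> p _; rewrite mule_ge0.
- by apply: measurable_funeM; exact: mE.
apply: ge0_le_integral => //.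
- exact: mE.
- by apply: emeasurable_funD; apply: measurable_funeM; exact: mE.
- move=> p _; rewrite -!EFinM -EFinD lee_fin [a * _]mulrA [b * _]mulrA -mulrDl.
  by rewrite ler_wpM2r ?h // poisson_rV_ge0.
Qed.

(** From [(a - b)^2 <= 2 a^2 + 2 b^2] and the mass [C] of the kernel in either variable. The bound
    does not depend on [e], which is what makes the limit [e -> 0] stable under L^2
    approximation. *)
Lemma energy_le_sqr (e : R) (u : T -> R) : 0 < e -> measurable_fun setT u ->
  (energy e u <= (4 * C)%:E * \int[lam]_x (u x ^+ 2)%:E)%E.
Proof.
move=> e0 mu.
have mu2 : measurable_fun setT (fun x => 2 * u x ^+ 2).
  by apply: measurable_funM => //; exact: measurable_funX.
have u20 x : 0 <= 2 * u x ^+ 2 by rewrite mulr_ge0// sqr_ge0.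
have -> : ((4 * C)%:E * \int[lam]_x (u x ^+ 2)%:E =
    \int[lam \x lam]_p (2 * u p.1 ^+ 2 * K e (p.1 - p.2))%:E +
    \int[lam \x lam]_p (2 * u p.2 ^+ 2 * K e (p.1 - p.2))%:E)%E.
  rewrite (integral_poisson_sub1 e0 mu2 u20) (integral_poisson_sub2 e0 mu2 u20).
  under [in RHS]eq_integral do rewrite EFinM.
  rewrite ge0_integralZl//; last 2 first.
  - by apply/measurable_EFinP; exact: measurable_funX.
  - by move=> x _; rewrite lee_fin sqr_ge0.
  have C0 : 0 <= C by rewrite exprn_ge0// mulr_ge0// pi_ge0.
  rewrite muleA -ge0_muleDl ?mule_ge0 ?lee_fin//.
  by rewrite -EFinM -EFinD; congr (_%:E * _)%E; ring.
have K0 p : 0 <= K e p by exact: poisson_rV_ge0.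
have m1 : measurable_fun setT (fun p : T * T => (2 * u p.1 ^+ 2 * K e (p.1 - p.2))%:E).
  apply/measurable_EFinP/measurable_funM; last exact: measurable_poisson_sub.
  by apply: (measurableT_comp mu2); exact: measurable_fst.
have m2 : measurable_fun setT (fun p : T * T => (2 * u p.2 ^+ 2 * K e (p.1 - p.2))%:E).
  apply/measurable_EFinP/measurable_funM; last exact: measurable_poisson_sub.
  by apply: (measurableT_comp mu2); exact: measurable_snd.
rewrite -ge0_integralD//; last 2 first.
- by move=> p _; rewrite lee_fin mulr_ge0.
- by move=> p _; rewrite lee_fin mulr_ge0.
apply: ge0_le_integral => //.
- by move=> p _; rewrite lee_fin energy_integrand_ge0.
- by apply/measurable_EFinP; exact: (measurable_energy e0 mu).
- exact: emeasurable_funD.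
- move=> p _; rewrite -EFinD lee_fin -mulrDl ler_wpM2r//.
  have := sqr_ge0 (u p.1 + u p.2); nra.
Qed.

(** Only the parameters [e = 1 / (k + 1)] occur, because the final limit is taken along this
    sequence. Measurability is bundled so that the closure properties transport it. *)
Definition energy_cvg0 (u : T -> R) := measurable_fun setT u /\
  forall eps, 0 < eps -> exists N, forall k, (N <= k)%N ->
    (energy k.+1%:R^-1 u <= eps%:E)%E.

Lemma energy_cvg0_le2 (a b : R) (u v w : T -> R) : 0 <= a -> 0 <= b ->
  measurable_fun setT w ->
  (forall x y, (w x - w y) ^+ 2 <= a * (u x - u y) ^+ 2 + b * (v x - v y) ^+ 2) ->
  energy_cvg0 u -> energy_cvg0 v -> energy_cvg0 w.
Proof.
move=> a0 b0 mw h [mu hu] [mv hv]; split=> // eps eps0.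
have s0 : 0 < a + b + 1 by lra.
have d0 : 0 < eps / (a + b + 1) by rewrite divr_gt0.
have [N1 h1] := hu _ d0; have [N2 h2] := hv _ d0.
exists (maxn N1 N2) => k; rewrite geq_max => /andP[k1 k2].
have k0 : 0 < k.+1%:R^-1 :> R by rewrite invr_gt0.
apply: (le_trans (energy_le2 k0 a0 b0 mu mv mw h)).
apply: (@le_trans _ _ (a%:E * (eps / (a + b + 1))%:E + b%:E * (eps / (a + b + 1))%:E)%E).
  by apply: leeD; apply: lee_wpmul2l; rewrite ?lee_fin//; [exact: h1|exact: h2].
rewrite -!EFinM -EFinD lee_fin -mulrDl mulrA ler_pdivrMr// mulrC ler_wpM2l; lra.
Qed.

(** Split [w] as [w_ m] minus the error [w_ m - w]. Domination makes the L^2 norm of the error small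
    for some [m], hence its energy small for all [e] at once; for this fixed [m] the energy of
    [w_ m] then tends to 0. *)
Lemma energy_cvg0_dominated (w_ : nat -> T -> R) (w G : T -> R) :
  (forall m, energy_cvg0 (w_ m)) -> measurable_fun setT w ->
  (forall x, w_ m x @[m --> \oo] --> w x) ->
  (forall m x, (w_ m x - w x) ^+ 2 <= G x) ->
  lam.-integrable setT (EFin \o G) -> energy_cvg0 w.
Proof.
move=> vw mw cw wG iG; split=> // eps eps0.
(* Chosen so that an L^2 error of [eps / 2 / C4] costs at most [eps / 2] after the factors 2 of
   [energy_le2] and [4 * C] of [energy_le_sqr]; the [+ 1] keeps the divisor positive. *)
pose C4 := 2 * (4 * C) + 1 : R.
have C0 : 0 <= C by rewrite exprn_ge0// mulr_ge0// pi_ge0.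
have C40 : 0 < C4 by rewrite /C4; lra.
have m2 m : measurable_fun setT (fun x => (w_ m x - w x) ^+ 2).
  by apply: measurable_funX; apply: measurable_funB => //; exact: (vw m).1.
have cvg0 : (\int[lam]_x ((w_ m x - w x) ^+ 2)%:E @[m --> \oo] --> \int[lam]_x (cst 0 x))%E.
  apply: (dominated_cvg _ _ _ _ iG) => //.
  - by move=> m; apply/measurable_EFinP; exact: m2.
  - move=> x _; apply/fine_cvgP; split; first exact: nearW.
    rewrite (_ : fine \o _ = fun m => (w_ m x - w x) ^+ 2)//.
    rewrite /= (_ : 0 = (w x - w x) ^+ 2 :> R); last by rewrite subrr expr0n.
    apply: (@cvg_comp _ _ _ (fun m => w_ m x - w x) (fun y => y ^+ 2) _ (nbhs (w x - w x))).
      by apply: cvgB; [exact: cw|exact: cvg_cst].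
    exact: exprn_continuous.
  - by move=> m x _; rewrite /= ger0_norm ?sqr_ge0// lee_fin.
rewrite integral0 in cvg0.
have d0 : 0 < eps / 2 / C4 by rewrite !divr_gt0.
have [m hm] : exists m, (\int[lam]_x ((w_ m x - w x) ^+ 2)%:E <= (eps / 2 / C4)%:E)%E.
  have /fine_cvgP[] := cvg0.
  move=> [N1 _ h1] /cvgrPdist_le /(_ _ d0)[N2 _ h2].
  exists (maxn N1 N2).
  have := h1 (maxn N1 N2) (leq_maxl _ _) => /fineK <-.
  have := h2 (maxn N1 N2) (leq_maxr _ _).
  by rewrite /= sub0r normrN => /(le_trans (ler_norm _)); rewrite lee_fin.
have [mwm hwm] := vw m.
have e40 : 0 < eps / 4 by rewrite divr_gt0.
have [N hN] := hwm _ e40; exists N => k Nk.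
have k0 : 0 < k.+1%:R^-1 :> R by rewrite invr_gt0.
have mwd : measurable_fun setT (fun x => w_ m x - w x) by exact: measurable_funB.
have := @energy_le2 _ 2 2 (w_ m) (fun x => w_ m x - w x) w k0 (ler0n _ 2) (ler0n _ 2) mwm mwd mw.
move=> /(_ _)/le_trans; apply.
  move=> x y; have := sqr_ge0 (w_ m x - w_ m y + ((w_ m x - w x) - (w_ m y - w y))); nra.
apply: (@le_trans _ _ (2%:E * (eps / 4)%:E + 2%:E * ((4 * C)%:E * (eps / 2 / C4)%:E))%E).
  apply: leeD; apply: lee_wpmul2l; rewrite ?lee_fin//; first exact: hN.
  apply: (le_trans (energy_le_sqr k0 mwd)).
  by apply: lee_wpmul2l; rewrite // lee_fin mulr_ge0.
rewrite -!EFinM -EFinD lee_fin.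
have : 2 * (4 * C * (eps / 2 / C4)) <= eps / 2.
  rewrite (_ : _ * _ = (2 * (4 * C)) * (eps / 2) / C4); last by ring.
  rewrite ler_pdivrMr// mulrC ler_wpM2l//; first by lra.
  by rewrite /C4; lra.
by lra.
Qed.

End poisson_energy.

Lemma sume_cst (R : realDomainType) n (x : \bar R) : (0 <= x)%E ->
  (\sum_(i < n) x = n%:R%:E * x)%E.
Proof.
move=> x0; elim: n => [|n IH]; first by rewrite big_ord0 mul0e.
by rewrite big_ord_recr/= IH -natr1 EFinD ge0_muleDl ?lee_fin// mul1e.
Qed.

(** * Energy of Lipschitz functions *)

Section lipschitz_energy.
Variables (R : realType) (n : nat).
Local Notation T := 'rV[R]_n.
Local Notation lam := (@lebesgue_rV R n).
Local Notation K := (@poisson_rV R n).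

(** Against [h ^ 2] the kernel is of order [e] but not integrable; truncating at 1 restores
    integrability. The majorant is again a multiple of a Poisson kernel, now with parameter 1, so
    its integral is already known. *)
Lemma poisson_min1_le (e h : R) : 0 < e ->
  Num.min 1 (h ^+ 2) * poisson e h <= 2 * e * poisson 1 h.
Proof.
move=> e0; have d0 := poisson_den_gt0 h e0.
have d1 := poisson_den_gt0 h (ltr01 : 0 < 1 :> R).
have h0 := sqr_ge0 h.
rewrite /poisson mulr1 expr1n in d1 *.
have -> : 2 * e * (2 / (1 + h ^+ 2)) = 2 * e * 2 / (1 + h ^+ 2) by rewrite mulrA.
rewrite mulrA ler_pdivrMr// mulrAC ler_pdivlMr//.
have ee : 0 <= e ^+ 2 by exact: sqr_ge0.
set H := h ^+ 2 in h0 d0 d1 *; set E := e ^+ 2 in ee d0 *.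
have : Num.min 1 H * (1 + H) <= 2 * (E + H) by have [H1|H1] := leP 1 H; nra.
by move=> /(ler_wpM2l (ltW e0)); nra.
Qed.

(** Majorant of [min 1 (z_i ^ 2) * K e z], obtained by applying [poisson_min1_le] to the [i]-th
    factor alone. It keeps the product form, which gives its mass [2 e (2 pi)^n]. *)
Let Q (e : R) (i : 'I_n) (z : T) :=
  \prod_j (if j == i then 2 * e * poisson 1 (z ord0 j) else poisson e (z ord0 j)).

Let Q_ge0 (e : R) i z : 0 < e -> 0 <= Q e i z.
Proof.
move=> e0; apply: prodr_ge0 => j _; case: ifP => _; last exact: poisson_ge0.
by rewrite mulr_ge0 ?poisson_ge0// mulr_ge0// ltW.
Qed.

Let measurable_Q (e : R) i : 0 < e -> measurable_fun setT (Q e i).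
Proof.
move=> e0; apply: (measurable_funM_prod (h := fun j x =>
  if j == i then 2 * e * poisson 1 x else poisson e x)) => j.
have [_|_] := eqVneq j i; last exact: measurable_poisson.
by apply: measurable_funM => //; exact: measurable_poisson.
Qed.

Let integral_Q (e : R) i (x : T) : 0 < e ->
  (\int[lam]_y (Q e i (x - y))%:E = (2 * e * (2 * pi) ^+ n)%:E)%E.
Proof.
move=> e0.
have := @integral_prod_coord R n (fun j y => if j == i then
    2 * e * poisson 1 (x ord0 j - y) else poisson e (x ord0 j - y))
  (fun j => if j == i then 2 * e * (2 * pi) else 2 * pi).
have -> : \prod_j (if j == i then 2 * e * (2 * pi) else 2 * pi) = 2 * e * (2 * pi) ^+ n :> R.
  have -> : (2 * pi) ^+ n = \prod_(j < n) (2 * pi) :> R by rewrite prodr_const card_ord.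
  rewrite (bigD1 i)//= eqxx [in RHS](bigD1 i)//= [RHS]mulrA; congr (_ * _).
  by apply: eq_bigr => j /negPf ->.
have mp (c : R) j : 0 < c -> measurable_fun setT (fun y : R => poisson c (x ord0 j - y)).
  move=> c0; apply: measurableT_comp; first exact: measurable_poisson.
  exact: measurable_funB.
move=> <-.
- apply: eq_integral => y _; congr EFin; apply: eq_bigr => j _.
  by rewrite !mxE.
- move=> j; have [_|_] := eqVneq j i; last exact: mp.
  by apply: measurable_funM => //; exact: mp.
- move=> j y; case: ifP => _; last exact: poisson_ge0.
  by rewrite mulr_ge0 ?poisson_ge0// mulr_ge0// ltW.
- move=> j; have [_|_] := eqVneq j i; last exact: integral_poisson.
  under eq_integral do rewrite EFinM.
  rewrite ge0_integralZl//= ?integral_poisson//.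
  + by apply/measurable_EFinP; exact: mp.
  + by move=> y _; rewrite lee_fin poisson_ge0.
  + by rewrite lee_fin mulr_ge0// ltW.
Qed.

Let QC (e : R) i (x y : T) : Q e i (x - y) = Q e i (y - x).
Proof. by apply: eq_bigr => j _; rewrite !mxE ![poisson _ (x _ _ - _)]poissonC. Qed.

Let min_poisson_le_Q (e : R) i (z : T) : 0 < e ->
  Num.min 1 (z ord0 i ^+ 2) * K e z <= Q e i z.
Proof.
move=> e0; rewrite /poisson_rV /Q (bigD1 i)//= [leRHS](bigD1 i)//= eqxx mulrA.
rewrite [X in _ <= _ * X](eq_bigr (fun j => poisson e (z ord0 j))); last first.
  by move=> j /negPf ->.
rewrite ler_wpM2r//; last exact: poisson_min1_le.
by apply: prodr_ge0 => j _; exact: poisson_ge0.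
Qed.

(* The Poisson kernel has mass [O(e)] against [min 1 (h_i ^ 2)], so that the
   energy of a compactly supported Lipschitz function is [O(e)]. *)
Lemma energy_lipschitz (e M : R) (S : set T) (u : T -> R) : 0 < e -> 0 <= M ->
  measurable_fun setT u -> measurable S -> (forall x, ~ S x -> u x = 0) ->
  (forall x y, (u x - u y) ^+ 2 <= M * \sum_i Num.min 1 ((x - y) ord0 i ^+ 2)) ->
  (energy e u <= (M * n%:R * (4 * e * (2 * pi) ^+ n))%:E * lam S)%E.
Proof.
move=> e0 M0 mu mS uS hu.
(* The increment vanishes unless [x] or [y] lies in [S]; [I1] dominates in the first case and [I2]
   in the second. *)
pose I1 (p : T * T) : \bar R := (\sum_i (\1_S p.1 * Q e i (p.1 - p.2))%:E)%E.
pose I2 (p : T * T) : \bar R := (\sum_i (\1_S p.2 * Q e i (p.1 - p.2))%:E)%E.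
have mI1 (i : 'I_n) : measurable_fun setT (fun p : T * T => (\1_S p.1 * Q e i (p.1 - p.2))%:E).
  apply/measurable_EFinP/measurable_funM; last first.
    exact: (measurableT_comp (measurable_Q i e0) (@measurable_sub_rV R n)).
  by apply: (measurableT_comp (measurable_indic mS)); exact: measurable_fst.
have mI2 (i : 'I_n) : measurable_fun setT (fun p : T * T => (\1_S p.2 * Q e i (p.1 - p.2))%:E).
  apply/measurable_EFinP/measurable_funM; last first.
    exact: (measurableT_comp (measurable_Q i e0) (@measurable_sub_rV R n)).
  by apply: (measurableT_comp (measurable_indic mS)); exact: measurable_snd.
have I10 p (i : 'I_n) : (0 <= (\1_S p.1 * Q e i (p.1 - p.2))%:E)%E.
  by rewrite lee_fin mulr_ge0// Q_ge0.
have I20 p (i : 'I_n) : (0 <= (\1_S p.2 * Q e i (p.1 - p.2))%:E)%E.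
  by rewrite lee_fin mulr_ge0// Q_ge0.
have intS : (\int[lam]_x (\1_S x)%:E = lam S)%E by rewrite integral_indic// setIT.
have J1 : (\int[lam \x lam]_p I1 p = (n%:R * (2 * e * (2 * pi) ^+ n))%:E * lam S)%E.
  rewrite ge0_integral_sum//.
  rewrite (eq_bigr (fun=> (2 * e * (2 * pi) ^+ n)%:E * lam S)%E); last first.
    move=> i _; rewrite (@integral_kernel1 _ _ (Q e i) (\1_S) (2 * e * (2 * pi) ^+ n)) ?intS//.
    - exact: measurable_Q.
    - by move=> z; exact: Q_ge0.
    - by move=> x; exact: (@integral_Q e i x e0).
  by rewrite sume_cst ?EFinM ?muleA// mule_ge0// lee_fin mulr_ge0 ?exprn_ge0 ?mulr_ge0 ?pi_ge0 ?ltW.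
have J2 : (\int[lam \x lam]_p I2 p = (n%:R * (2 * e * (2 * pi) ^+ n))%:E * lam S)%E.
  rewrite ge0_integral_sum//.
  rewrite (eq_bigr (fun=> (2 * e * (2 * pi) ^+ n)%:E * lam S)%E); last first.
    move=> i _; rewrite (@integral_kernel2 _ _ (Q e i) (\1_S) (2 * e * (2 * pi) ^+ n)) ?intS//.
    - exact: measurable_Q.
    - by move=> z; exact: Q_ge0.
    - by move=> x; exact: (@integral_Q e i x e0).
  by rewrite sume_cst ?EFinM ?muleA// mule_ge0// lee_fin mulr_ge0 ?exprn_ge0 ?mulr_ge0 ?pi_ge0 ?ltW.
have sI1 p : (0 <= I1 p)%E by apply: sume_ge0.
have sI2 p : (0 <= I2 p)%E by apply: sume_ge0.
have msI1 : measurable_fun setT I1 by exact: emeasurable_sum.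
have msI2 : measurable_fun setT I2 by exact: emeasurable_sum.
apply: (@le_trans _ _ (\int[lam \x lam]_p (M%:E * (I1 p + I2 p)))%E); last first.
  rewrite ge0_integralZl//; last 2 first.
  - exact: emeasurable_funD.
  - by move=> p _; rewrite adde_ge0.
  rewrite ge0_integralD// J1 J2.
  have c0 : 0 <= n%:R * (2 * e * (2 * pi) ^+ n) :> R.
    by rewrite mulr_ge0// mulr_ge0 ?exprn_ge0 ?mulr_ge0 ?pi_ge0// ltW.
  rewrite -ge0_muleDl ?lee_fin// muleA -EFinD -EFinM.
  by rewrite le_eqVlt; apply/orP; left; apply/eqP; congr (_%:E * _)%E; ring.
apply: ge0_le_integral => //.
- by move=> p _; rewrite lee_fin energy_integrand_ge0.
- by apply/measurable_EFinP; exact: measurable_energy.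
- by apply: measurable_funeM; exact: emeasurable_funD.
move=> [x y] _ /=.
have K0 : 0 <= K e (x - y) by exact: poisson_rV_ge0.
have bound : (((u x - u y) ^+ 2 * K e (x - y))%:E <= M%:E * (\sum_i (Q e i (x - y))%:E))%E.
  rewrite sumEFin -EFinM lee_fin (le_trans (ler_wpM2r K0 (hu x y)))//.
  rewrite -mulrA ler_wpM2l// mulr_suml ler_sum// => i _.
  exact: min_poisson_le_Q.
have [Sx|Sx] := pselect (S x).
  apply: (le_trans bound); rewrite lee_wpmul2l ?lee_fin//.
  apply: (@le_trans _ _ (I1 (x, y))); last by rewrite leeDl.
  by rewrite /I1 /= indicE mem_set//; under [leRHS]eq_bigr do rewrite mul1r.
have [Sy|Sy] := pselect (S y).
  apply: (le_trans bound); rewrite lee_wpmul2l ?lee_fin//.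
  apply: (@le_trans _ _ (I2 (x, y))); last by rewrite leeDr.
  by rewrite /I2 /= indicE mem_set//; under [leRHS]eq_bigr do rewrite mul1r.
rewrite (uS _ Sx) (uS _ Sy) subrr expr0n mul0r mule_ge0 ?lee_fin//.
by rewrite adde_ge0.
Qed.

Lemma energy_cvg0_lipschitz (M : R) (S : set T) (u : T -> R) : 0 <= M ->
  measurable_fun setT u -> measurable S -> (lam S < +oo)%E ->
  (forall x, ~ S x -> u x = 0) ->
  (forall x y, (u x - u y) ^+ 2 <= M * \sum_i Num.min 1 ((x - y) ord0 i ^+ 2)) ->
  energy_cvg0 u.
Proof.
move=> M0 mu mS Soo uS hu; split=> // eps eps0.
pose V := fine (lam S); have VE : lam S = V%:E.
  by rewrite fineK// ge0_fin_numE.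
have V0 : 0 <= V by exact: fine_ge0.
pose c := M * n%:R * (4 * (2 * pi) ^+ n) * V.
have c0 : 0 <= c by rewrite !mulr_ge0// exprn_ge0// mulr_ge0// pi_ge0.
have [N hN] : exists N : nat, forall k, (N <= k)%N -> c * k.+1%:R^-1 <= eps.
  have [N _ hN] := near_infty_natSinv_lt (PosNum (divr_gt0 eps0 (ltr_pwDr ltr01 c0))).
  exists N => k Nk; have /= := hN k Nk.
  rewrite ltr_pdivlMr; last by lra.
  have : 0 < k.+1%:R^-1 :> R by rewrite invr_gt0.
  by set t := k.+1%:R^-1; nra.
exists N => k Nk.
have k0 : 0 < k.+1%:R^-1 :> R by rewrite invr_gt0.
apply: (le_trans (energy_lipschitz k0 M0 mu mS uS hu)).
rewrite VE -EFinM lee_fin (le_trans _ (hN k Nk))// /c.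
by rewrite le_eqVlt; apply/orP; left; apply/eqP; ring.
Qed.

End lipschitz_energy.

(** * From Lipschitz functions to all of L^2 *)

Section density.
Variables (R : realType) (n : nat).
Local Notation T := 'rV[R]_n.
Local Notation lam := (@lebesgue_rV R n).

(** The sup norm is attained at one coordinate, whose term alone suffices. This turns a Lipschitz
    bound into the coordinatewise form required by [energy_lipschitz]. *)
Lemma min1_norm_le (z : T) :
  Num.min 1 `|z| ^+ 2 <= \sum_i Num.min 1 (z ord0 i ^+ 2).
Proof.
have m0 (j : 'I_n) : 0 <= Num.min 1 (z ord0 j ^+ 2) by rewrite le_min ler01 sqr_ge0.
have [->|z0] := eqVneq `|z| 0.
  by rewrite min_r// expr0n; exact: sumr_ge0.
have [[i j] /= zij] := mx_norm_neq0 z0.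
rewrite (bigD1 j)//= -[leLHS]addr0 lerD ?sumr_ge0//.
rewrite {1}/Num.norm/= zij (ord1 i) -[z ord0 j ^+ 2]real_normK ?num_real//.
have := normr_ge0 (z ord0 j); set t := `|_| => t0.
by have [H|H] := leP 1 t; have [H'|H'] := leP 1 (t ^+ 2); nra.
Qed.

Lemma coord_le_norm (z : T) i : `|z ord0 i| <= `|z|.
Proof.
rewrite [leRHS]/Num.norm/= mx_normrE.
exact: (le_bigmax _ (fun ij => `|z ij.1 ij.2|) (ord0, i)).
Qed.

Lemma lebesgue_rV_ball (x : T) (r : R) : 0 < r -> lam (ball x r) = ((r *+ 2) ^+ n)%:E.
Proof.
move=> r0.
rewrite ball_rVE// (_ : mkset _ = [set y : T | forall i, ball (x ord0 i) r (y ord0 i)])//.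
rewrite (lebesgue_rV_box (A := fun i => ball (x ord0 i) r)); last first.
  by move=> i; exact: measurable_ball.
under eq_bigr do rewrite lebesgue_measure_ball ?ltW//.
by rewrite prodEFin prodr_const card_ord.
Qed.

Lemma lebesgue_rV_ball_fin (x : T) (r : R) : (lam (ball x r) < +oo)%E.
Proof.
have [r0|r0] := ltP 0 r; first by rewrite lebesgue_rV_ball// ltry.
rewrite (_ : ball _ _ = set0) ?measure0//; apply/seteqP; split => // y [/lt_le_trans].
by move=> /(_ _ r0); rewrite ltxx.
Qed.

(** Half-spaces and complements may have infinite measure, so indicators are treated only after
    multiplication by this Lipschitz function supported in a ball. *)
Definition cutoff (N : nat) (x : T) : R := Num.max 0 (Num.min 1 (N%:R - `|x|)).

Lemma cutoff_ge0 N x : 0 <= cutoff N x.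
Proof. by rewrite /cutoff le_max lexx. Qed.

Lemma cutoff_le1 N x : cutoff N x <= 1.
Proof. by rewrite /cutoff ge_max ler01 ge_min lexx. Qed.

Lemma cutoff_out N x : ~ ball (0 : T) N%:R x -> cutoff N x = 0.
Proof.
move=> h; rewrite /cutoff max_l// ge_min; apply/orP; right.
rewrite leNgt; apply/negP => h'; apply: h.
by rewrite mx_norm_ball /ball_/= sub0r normrN; lra.
Qed.

Lemma cutoff_eq1 N (x : T) : `|x| + 1 <= N%:R -> cutoff N x = 1.
Proof. by move=> h; rewrite /cutoff min_l ?max_r//; lra. Qed.

Lemma cutoff_lip N x y : `|cutoff N x - cutoff N y| <= Num.min 1 `|x - y|.
Proof.
have := cutoff_ge0 N x; have := cutoff_ge0 N y.
have := cutoff_le1 N x; have := cutoff_le1 N y => h1 h2 h3 h4.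
rewrite le_min; apply/andP; split; first by rewrite ler_norml; lra.
have a1 := lerB_dist x y.
have a2 := lerB_dist y x; rewrite distrC in a2.
rewrite /cutoff ler_norml; apply/andP.
have [] := leP 1 (N%:R - `|x|); have [] := leP 1 (N%:R - `|y|);
  have [] := leP 0 (N%:R - `|x|); have [] := leP 0 (N%:R - `|y|);
  have [] := leP 0 (1 : R); split; lra.
Qed.

Lemma measurable_norm_rV : measurable_fun setT (fun x : T => `|x|).
Proof. by apply: continuous_measurable_rV; exact: norm_continuous. Qed.

Lemma measurable_cutoff N : measurable_fun setT (cutoff N).
Proof.
apply: measurable_maxr => //; apply: measurable_minr => //.
by apply: measurable_funB => //; exact: measurable_norm_rV.
Qed.

Lemma energy_cvg0_lipschitz_norm (L : R) (S : set T) (u : T -> R) : 0 <= L ->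
  measurable_fun setT u -> measurable S -> (lam S < +oo)%E ->
  (forall x, ~ S x -> u x = 0) ->
  (forall x y, `|u x - u y| <= L * Num.min 1 `|x - y|) -> energy_cvg0 u.
Proof.
move=> L0 mu mS Soo uS hu.
apply: (energy_cvg0_lipschitz (sqr_ge0 L) mu mS Soo uS) => x y.
rewrite -[leLHS]real_normK ?num_real//.
apply: (@le_trans _ _ ((L * Num.min 1 `|x - y|) ^+ 2)).
  by rewrite lerXn2r ?nnegrE// mulr_ge0// le_min ler01/=.
by rewrite exprMn ler_wpM2l ?sqr_ge0// min1_norm_le.
Qed.

Lemma energy_cvg0_cutoff N : energy_cvg0 (cutoff N).
Proof.
apply: (energy_cvg0_lipschitz_norm (L := 1) (S := ball (0 : T) N%:R)) => //.
- exact: measurable_cutoff.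
- exact: measurable_ball_rV.
- exact: lebesgue_rV_ball_fin.
- by move=> x; exact: cutoff_out.
- by move=> x y; rewrite mul1r; exact: cutoff_lip.
Qed.

Lemma integrable_indic_ball (N : nat) :
  lam.-integrable setT (EFin \o \1_(ball (0 : T) N%:R)).
Proof.
apply/integrableP; split; first by apply/measurable_EFinP/measurable_indic; exact: measurable_ball_rV.
under eq_integral do rewrite /= ger0_norm//.
rewrite integral_indic ?setIT//; last exact: measurable_ball_rV.
exact: lebesgue_rV_ball_fin.
Qed.

Lemma cutoff_le_indic N (x : T) : cutoff N x <= \1_(ball (0 : T) N%:R) x.
Proof.
rewrite indicE; have [h|h] := boolP (x \in _); first exact: cutoff_le1.
by rewrite cutoff_out//; move: h; rewrite notin_setE.
Qed.

Lemma sqr_sub_le (a b q : R) : 0 <= q <= 1 -> 0 <= a <= q -> 0 <= b <= q ->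
  (a - b) ^+ 2 <= q.
Proof.
move=> /andP[q0 q1] /andP[a0 aq] /andP[b0 bq].
apply: (@le_trans _ _ (q ^+ 2)); last by rewrite expr2 ler_piMr.
by rewrite -[leLHS]real_normK ?num_real// lerXn2r ?nnegrE// ler_norml; lra.
Qed.

(** The indicator of a union is a maximum, so this handles finite unions. *)
Lemma sqr_max_sub_le (a b c d : R) :
  (Num.max a b - Num.max c d) ^+ 2 <= (a - c) ^+ 2 + (b - d) ^+ 2.
Proof.
have := sqr_ge0 (a - c); have := sqr_ge0 (b - d).
have [ab|ab] := leP a b; have [cd|cd] := leP c d; try lra.
  by have [bc|bc] := leP b c; nra.
by have [ad|ad] := leP a d; nra.
Qed.

Lemma indic_mul_itv (A : set T) (x : T) (q : R) : 0 <= q ->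
  0 <= \1_A x * q <= q.
Proof. by move=> q0; rewrite indicE; case: (_ \in _); rewrite ?mul1r ?mul0r ?lexx q0. Qed.

Lemma energy_cvg0_halfspace N i (b : R) :
  energy_cvg0 (fun x : T => \1_[set x : T | b < x ord0 i] x * cutoff N x).
Proof.
have mA : measurable [set x : T | b < x ord0 i].
  rewrite -[X in measurable X]setTI -[X in _ `&` X]/((fun x : T => x ord0 i) @^-1` [set y | b < y]).
  by apply: measurable_coord => //; rewrite -set_itvoy; exact: measurable_itv.
(* Lipschitz ramps of slope [m] starting at the boundary of the half-space and capped by the cutoff;
   they increase to the function of the statement. *)
pose w (m : nat) (x : T) := Num.min (cutoff N x) (m%:R * Num.max 0 (x ord0 i - b)).
have q0 := cutoff_ge0 N; have q1 := cutoff_le1 N.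
have w0 m x : 0 <= w m x.
  by rewrite le_min q0 mulr_ge0// le_max lexx.
have wq m x : w m x <= cutoff N x by rewrite ge_min lexx.
have mw m : measurable_fun setT (w m).
  apply: measurable_minr; first exact: measurable_cutoff.
  apply: measurable_funM => //; apply: measurable_maxr => //.
  by apply: measurable_funB => //; exact: measurable_coord.
apply: (@energy_cvg0_dominated _ _ w _ (\1_(ball (0 : T) N%:R))).
- move=> m.
  (* The cutoff has Lipschitz constant 1 and the ramp [m], which settles close points; for
     [|x - y| >= 1] the values in [[0, 1]] differ by at most 1. *)
  apply: (energy_cvg0_lipschitz_norm (L := 1 + m%:R) (S := ball (0 : T) N%:R)) => //.
  + exact: measurable_ball_rV.
  + exact: lebesgue_rV_ball_fin.
  + move=> x /cutoff_out qx; apply/eqP; rewrite eq_le w0 andbT.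
    by rewrite -qx wq.
  + move=> x y.
    have m0 : 0 <= m%:R :> R by [].
    have := w0 m x; have := w0 m y; have := le_trans (wq m x) (q1 x).
    have := le_trans (wq m y) (q1 y) => a1 a2 a3 a4.
    have [h|h] := leP 1 `|x - y|.
      by rewrite mulr1 ler_norml; lra.
    rewrite mulrDl mul1r.
    have c1 : `|cutoff N x - cutoff N y| <= `|x - y|.
      by rewrite (le_trans (cutoff_lip N x y))// ge_min lexx orbT.
    have c2 : `|Num.max 0 (x ord0 i - b) - Num.max 0 (y ord0 i - b)| <= `|x - y|.
      have := coord_le_norm (x - y) i; rewrite !mxE; set t := `|x - y|.
      rewrite !ler_norml => /andP[g1 g2].
      by have [] := leP 0 (x ord0 i - b); have [] := leP 0 (y ord0 i - b);
        move=> *; apply/andP; split; lra.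
    have c3 : `|m%:R * Num.max 0 (x ord0 i - b) - m%:R * Num.max 0 (y ord0 i - b)| <= m%:R * `|x - y|.
      by rewrite -mulrBr normrM ger0_norm// ler_wpM2l.
    rewrite /w; move: c1 c3; set t := `|x - y|.
    have t0 : 0 <= t by exact: normr_ge0.
    have mt0 : 0 <= m%:R * t by rewrite mulr_ge0.
    move: mt0; set mt := m%:R * t => mt0.
    set A := m%:R * _; set B := m%:R * _.
    rewrite !ler_norml => /andP[g1 g2] /andP[g3 g4].
    by have [] := leP (cutoff N x) A; have [] := leP (cutoff N y) B; move=> *;
      apply/andP; split; lra.
- by apply: measurable_funM; [exact: measurable_indic|exact: measurable_cutoff].
- move=> x; rewrite indicE.
  have [/set_mem /= h|h] := boolP (x \in _); last first.
    rewrite mul0r; apply: cvg_near_cst; apply: nearW => m.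
    rewrite /w max_l ?mulr0 ?min_r//.
    by move: h; rewrite notin_setE/= => /negP; rewrite -leNgt subr_le0.
  rewrite mul1r; apply: cvg_near_cst; near=> m.
  rewrite /w min_l// (le_trans (q1 x))// max_r; last by rewrite subr_ge0 ltW.
  rewrite -ler_pdivrMr ?subr_gt0// div1r.
  near: m; exact: nbhs_infty_ger.
- move=> m x; apply: le_trans (cutoff_le_indic N x).
  apply: (@sqr_sub_le _ _ (cutoff N x)); rewrite ?q0 ?q1 ?w0 ?wq//.
  exact: indic_mul_itv.
- exact: integrable_indic_ball.
Unshelve. all: by end_near. Qed.

(* The sets [A] with this property form a sigma-algebra, by domination and the
   inequality of [energy_cvg0_le2], and contain the half-spaces. *)
Lemma energy_cvg0_indic_cutoff N (A : set T) : measurable A ->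
  energy_cvg0 (fun x => \1_A x * cutoff N x).
Proof.
pose M := [set A : set T | measurable A /\ energy_cvg0 (fun x => \1_A x * cutoff N x)].
have q0 := cutoff_ge0 N; have q1 := cutoff_le1 N.
have mq := measurable_cutoff N.
have mM (B : set T) : measurable B -> measurable_fun setT (fun x => \1_B x * cutoff N x).
  by move=> mB; apply: measurable_funM => //; exact: measurable_indic.
have v0 : energy_cvg0 (fun _ : T => 0 : R).
  apply: (@energy_cvg0_le2 R n 0 0 (cutoff N) (cutoff N)) => //; try exact: energy_cvg0_cutoff.
  by move=> x y; rewrite subrr expr0n !mul0r addr0.
have M0 : M set0.
  split=> //; rewrite (_ : (fun _ => _) = fun=> 0)//.
  by apply/funext => x; rewrite indic0 mul0r.
have MC B : M B -> M (setT `\` B).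
  move=> [mB vB]; split; first exact: measurableD.
  apply: (@energy_cvg0_le2 R n 2 2 (cutoff N) (fun x => \1_B x * cutoff N x)) => //; last exact: energy_cvg0_cutoff.
    by apply: mM; exact: measurableD.
  have E x : \1_(setT `\` B) x * cutoff N x = cutoff N x - \1_B x * cutoff N x.
    rewrite setTD !indicE in_setC; case: (x \in B) => /=; ring.
  move=> x y; rewrite !E.
  have := sqr_ge0 (cutoff N x - cutoff N y + (\1_B x * cutoff N x - \1_B y * cutoff N y)); nra.
have MU B B' : M B -> M B' -> M (B `|` B').
  move=> [mB vB] [mB' vB']; split; first exact: measurableU.
  apply: (@energy_cvg0_le2 R n 1 1 (fun x => \1_B x * cutoff N x) (fun x => \1_B' x * cutoff N x)) => //.
    by apply: mM; exact: measurableU.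
  have E x : \1_(B `|` B') x * cutoff N x =
      Num.max (\1_B x * cutoff N x) (\1_B' x * cutoff N x).
    rewrite !indicE in_setU; case: (x \in B); case: (x \in B') => /=;
      by rewrite ?mul1r ?mul0r ?maxxx ?(max_l (q0 x)) ?(max_r (q0 x)).
  move=> x y; rewrite !E !mul1r.
  set a := \1_B x * _; set b := \1_B' x * _; set c := \1_B y * _; set d := \1_B' y * _.
  exact: sqr_max_sub_le.
have sM : sigma_algebra setT M.
  split=> // F MF; split; first by apply: bigcupT_measurable => k; exact: (MF k).1.
  pose G m := \big[setU/set0]_(k < m) F k.
  have MG m : M (G m).
    rewrite /G; elim: m => [|m IH]; first by rewrite big_ord0.
    by rewrite big_ord_recr; exact: MU.
  apply: (@energy_cvg0_dominated _ _ (fun m x => \1_(G m) x * cutoff N x) _ (\1_(ball (0 : T) N%:R))).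
  - by move=> m; exact: (MG m).2.
  - by apply: mM; apply: bigcupT_measurable => k; exact: (MF k).1.
  - move=> x; apply: cvg_near_cst.
    have [[k _ Fk]|h] := pselect ((\bigcup_k F k) x).
      exists k.+1 => // m /= km.
      rewrite !indicE !mem_set//; first by exists k.
      by rewrite /G -bigcup_mkord; exists k.
    apply: nearW => m; rewrite !indicE !memNset// => h'; apply: h.
    by move: h'; rewrite /G -bigcup_mkord => -[k _ Fk]; exists k.
  - move=> m x; apply: le_trans (cutoff_le_indic N x).
    by apply: (@sqr_sub_le _ _ (cutoff N x)); rewrite ?q0 ?q1//; exact: indic_mul_itv.
  - exact: integrable_indic_ball.
move=> mA; suff : M A by case.
have : (measurable : set (set T)) `<=` M; last exact.
apply: smallest_sub => //.
move=> A0; rewrite -bigcup_seq/= => -[i _ [B mB <-]].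
(* The sets of reals whose preimage under the [i]-th coordinate lies in [M] form a sigma-algebra, so
   it is enough to test rays, whose preimages are half-spaces. *)
have : (@ocitv R).-sigma.-measurable `<=` image_set_system setT (fun x : T => x ord0 i) M; last by move=> h; exact: h.
rewrite RGenOInfty.measurableE; apply: smallest_sub.
  exact: sigma_algebra_image.
move=> _ [b ->]; rewrite /image_set_system /= setTI.
have -> : (fun x : T => x ord0 i) @^-1` `]b, +oo[ = [set x : T | b < x ord0 i].
  by rewrite set_itvoy.
split; last exact: energy_cvg0_halfspace.
rewrite -[X in measurable X]setTI -[X in _ `&` X]/((fun x : T => x ord0 i) @^-1` [set y | b < y]).
by apply: measurable_coord => //; rewrite -set_itvoy; exact: measurable_itv.
Qed.

Import HBNNSimple.

(** Simple functions [s k] increasing to [u], times [cutoff k], stay between 0 and [u]; so the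
    squared error is at most [u ^ 2] and dominated convergence applies. Each approximant is a finite
    combination of level-set indicators, added one at a time with [(a + b)^2 <= 2 a^2 + 2 b^2]. *)
Lemma energy_cvg0_ge0_L2 (u : T -> R) : measurable_fun setT u -> (forall x, 0 <= u x) ->
  lam.-integrable setT (EFin \o (fun x => u x ^+ 2)) -> energy_cvg0 u.
Proof.
move=> mu u0 iu.
have meu : measurable_fun setT (EFin \o u) by exact/measurable_EFinP.
pose s := nnsfun_approx measurableT meu.
have eu0 (x : T) : setT x -> (0 <= (EFin \o u) x)%E by rewrite lee_fin.
have cs (x : T) : s k x @[k --> \oo] --> u x.
  have /fine_cvgP[_] := cvg_nnsfun_approx measurableT meu eu0 (Logic.I : [set: T] x).
  exact.
have s0 k (x : T) : 0 <= s k x by [].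
have su k (x : T) : s k x <= u x.
  have nd : nondecreasing_seq (s^~ x).
    by move=> i j ij; have /lefP := nd_nnsfun_approx measurableT meu ij; exact.
  have cvgs : cvgn (s^~ x) by apply/cvg_ex; exists (u x); exact: cs.
  by rewrite -(cvg_lim _ (cs x))//; exact: nondecreasing_cvgn_le.
apply: (@energy_cvg0_dominated _ _ (fun k (x : T) => s k x * cutoff k x) _ (fun x => u x ^+ 2)) => //.
- move=> k.
  pose r : seq R := finmap.enum_fset (fset_set (range (s k))).
  have E (x : T) : s k x * cutoff k x =
      \sum_(i < size r) (r`_i * (\1_(s k @^-1` [set r`_i]) x * cutoff k x)).
    by rewrite {1}fimfunEord mulr_suml; apply: eq_bigr => i _; rewrite mulrA.
  rewrite (funext E).
  have mf (c : R) : measurable_fun setT (fun x => \1_(s k @^-1` [set c]) x * cutoff k x).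
    apply: measurable_funM; last exact: measurable_cutoff.
    by apply: measurable_indic; exact: measurable_funPTI.
  have V : forall m, energy_cvg0 (fun x : T => \sum_(i < m) (r`_i * (\1_(s k @^-1` [set r`_i]) x * cutoff k x))).
    elim=> [|m IH].
      under eq_fun do rewrite big_ord0.
      by apply: (@energy_cvg0_le2 R n 0 0 (cutoff 0) (cutoff 0)) => //; try exact: energy_cvg0_cutoff;
        move=> x y; rewrite subrr expr0n !mul0r addr0.
    under eq_fun do rewrite big_ord_recr/=.
    apply: (@energy_cvg0_le2 R n 2 (2 * r`_m ^+ 2)
      (fun x : T => \sum_(i < m) (r`_i * (\1_(s k @^-1` [set r`_i]) x * cutoff k x)))
      (fun x : T => \1_(s k @^-1` [set r`_m]) x * cutoff k x)) => //.
    - by rewrite mulr_ge0// sqr_ge0.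
    - apply: measurable_funD; last by apply: measurable_funM => //; exact: mf.
      by apply: measurable_sum => i; apply: measurable_funM => //; exact: mf.
    - move=> x y; set A := \sum_(i < m) _; set B := \sum_(i < m) _.
      set a := \1_ _ x * _; set b := \1_ _ y * _; set c := r`_m.
      have := sqr_ge0 (A - B - c * (a - b)); nra.
    - by apply: energy_cvg0_indic_cutoff; exact: measurable_funPTI.
  exact: V.
- move=> x; rewrite -[u x]mulr1; apply: cvgM => //.
  apply: cvg_near_cst; near=> k; apply: cutoff_eq1.
  near: k; exact: nbhs_infty_ger.
- move=> k x; have := s0 k x; have := su k x; have := cutoff_ge0 k x; have := cutoff_le1 k x.
  set q := cutoff k x; set t := s k x; set v := u x => a1 a2 a3 a4.
  have : 0 <= t * q <= v by apply/andP; split; nra.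
  move=> /andP[]; nra.
Unshelve. all: by end_near. Qed.

Lemma energy_cvg0_L2 (u : T -> R) : measurable_fun setT u ->
  lam.-integrable setT (EFin \o (fun x => u x ^+ 2)) -> energy_cvg0 u.
Proof.
move=> mu iu.
have part (v : T -> R) : measurable_fun setT v -> (forall x, v x ^+ 2 <= u x ^+ 2) ->
    (forall x, 0 <= v x) -> energy_cvg0 v.
  move=> mv vu v0; apply: energy_cvg0_ge0_L2 => //.
  apply: le_integrable iu => //.
    by apply/measurable_EFinP; exact: measurable_funX.
  by move=> x _ /=; rewrite !ger0_norm ?sqr_ge0// lee_fin.
apply: (@energy_cvg0_le2 R n 2 2 (fun x => Num.max (u x) 0) (fun x => Num.max (- u x) 0)) => //.
- have E z : z = Num.max z 0 - Num.max (- z) 0 :> R.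
    by have [] := leP z 0; have [] := leP (- z) 0; lra.
  move=> x y; rewrite {1}(E (u x)) {1}(E (u y)).
  set a := Num.max (u x) 0; set b := Num.max (- u x) 0.
  set c := Num.max (u y) 0; set d := Num.max (- u y) 0.
  have := sqr_ge0 (a - c + (b - d)); nra.
- apply: part => [|x|x]; last by rewrite le_max lexx orbT.
    exact: measurable_maxr.
  by have [] := leP (u x) 0; nra.
- apply: part => [|x|x]; last by rewrite le_max lexx orbT.
    by apply: measurable_maxr => //; exact: measurableT_comp.
  by have [] := leP (- u x) 0; nra.
Qed.

End density.

(** * The Plancherel identity *)

Section product_integrals.
Context d1 d2 (T1 : measurableType d1) (T2 : measurableType d2) (R : realType).
Variables (m1 : {sigma_finite_measure set T1 -> \bar R})
  (m2 : {sigma_finite_measure set T2 -> \bar R}).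

(** Equips the product with its sigma-finite structure, so that Fubini can be applied on
    [T * (T * T)] in [damped_parseval]. *)
Lemma product_measure1_sigma_finite :
  exists m : {sigma_finite_measure set (T1 * T2)%type -> \bar R},
    m = (m1 \x m2)%E :> (set (T1 * T2)%type -> \bar R).
Proof.
pose m : {measure set (T1 * T2)%type -> \bar R} :=
  lebesgue_integral_fubini_product_measure1__canonical__measure_function_Measure
    m1 m2.
pose H1 := lebesgue_integral_fubini.measure_function_Measure_isSigmaFinite__to__measure_function_isSigmaFinite m1 m2.
pose H2 := lebesgue_integral_fubini.measure_function_Measure_isSigmaFinite__to__measure_function_isSFinite m1 m2.
pose m' : {sigma_finite_measure set (T1 * T2)%type -> \bar R} :=
  HB.pack_for (SigmaFiniteMeasure.type (T1 * T2)%type R) (Measure.sort m) H1 H2.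
by exists m'.
Qed.

Lemma integrable_tensor (a : T1 -> R) (b : T2 -> R) :
  m1.-integrable setT (EFin \o a) -> m2.-integrable setT (EFin \o b) ->
  (m1 \x m2)%E.-integrable setT (fun p : T1 * T2 => (a p.1 * b p.2)%:E).
Proof.
move=> ia ib.
have ma : measurable_fun setT a by apply/measurable_EFinP; exact: measurable_int ia.
have mb : measurable_fun setT b by apply/measurable_EFinP; exact: measurable_int ib.
apply/integrable12ltyP.
  apply/measurable_EFinP/measurable_funM.
    by apply: (measurableT_comp ma); exact: measurable_fst.
  by apply: (measurableT_comp mb); exact: measurable_snd.
have /integrableP[_ bfin] := ib; have /integrableP[_ afin] := ia.
under eq_integral => x _.
  under eq_integral do rewrite /= normrM EFinM.
  rewrite ge0_integralZl//=; last by apply/measurable_EFinP; exact: measurableT_comp.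
  over.
rewrite ge0_integralZr//=.
- by rewrite lte_mul_pinfty ?integral_ge0// ge0_fin_numE// integral_ge0.
- by apply/measurable_EFinP; exact: measurableT_comp.
- exact: integral_ge0.
Qed.

Lemma Rintegral_tensor (a : T1 -> R) (b : T2 -> R) :
  m1.-integrable setT (EFin \o a) -> m2.-integrable setT (EFin \o b) ->
  (\int[(m1 \x m2)%E]_p (a p.1 * b p.2)%:E =
    (\int[m1]_x a x * \int[m2]_y b y)%:E)%E.
Proof.
move=> ia ib; rewrite -integral12_prod_meas1; last exact: integrable_tensor.
rewrite /fubini_F/=.
under eq_integral => x _.
  under eq_integral do rewrite EFinM.
  rewrite integralZl//.
  over.
rewrite /= -(fineK (integrable_fin_num measurableT ib)) integralZr//.
rewrite -[X in (X * _)%E](fineK (integrable_fin_num measurableT ia)).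
by rewrite -EFinM.
Qed.

Lemma measurable_integral_param (F : T1 * T2 -> \bar R) :
  measurable_fun setT F -> measurable_fun setT (fun x => \int[m2]_y F (x, y))%E.
Proof.
move=> mF; rewrite (_ : (fun x => _) =
    (fun x => \int[m2]_y F^\+ (x, y) - \int[m2]_y F^\- (x, y))%E); last first.
  apply/funext => x; rewrite [LHS]integralE.
  under eq_integral do rewrite funepos_comp/=.
  by under [X in (_ - X)%E = _]eq_integral do rewrite funeneg_comp/=.
apply: emeasurable_funB.
  by apply: measurable_fun_fubini_tonelli_F => //; exact: measurable_funepos.
by apply: measurable_fun_fubini_tonelli_F => //; exact: measurable_funeneg.
Qed.

End product_integrals.

(** * Damped Parseval identity and removal of the damping *)

Section parseval.
Variables (R : realType) (n : nat).
Local Notation T := 'rV[R]_n.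
Local Notation lam := (@lebesgue_rV R n).
Local Notation K := (@poisson_rV R n).
Local Notation W := (@decay R n).
Local Notation C := ((2 * pi) ^+ n : R).

Definition norm1 (x : T) : R := \sum_i `|x ord0 i|.

Lemma norm1_ge0 x : 0 <= norm1 x.
Proof. exact: sumr_ge0. Qed.

Lemma decayE (e : R) (x : T) : W e x = expR (- (e * norm1 x)).
Proof.
rewrite /norm1 mulr_sumr -sumrN expR_sum.
by apply: eq_bigr.
Qed.

Lemma decay_le1 (e : R) (x : T) : 0 < e -> W e x <= 1.
Proof.
by move=> e0; rewrite decayE expR_le1 oppr_le0 mulr_ge0 ?norm1_ge0// ltW.
Qed.

Lemma cvg_decay (x : T) : W k.+1%:R^-1 x @[k --> \oo] --> (1 : R).
Proof.
under eq_fun do rewrite decayE.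
have h : - (k.+1%:R^-1 * norm1 x) @[k --> \oo] --> (0 : R).
  rewrite -oppr0; apply: cvgN; rewrite -(mul0r (norm1 x)).
  by apply: cvgM; [exact: cvg_harmonic|exact: cvg_cst].
have := @continuous_cvg _ _ _ _ _ _ expR 0 (@continuous_expR R 0) h; rewrite expR0; exact.
Qed.

(* The real and imaginary parts of the Fourier transform of [u + i v], and its
   squared modulus. *)
Definition fourierRe (u v : T -> R) (xi : T) : R :=
  \int[lam]_x (cos (dot x xi) * u x + sin (dot x xi) * v x).

Definition fourierIm (u v : T -> R) (xi : T) : R :=
  \int[lam]_x (cos (dot x xi) * v x - sin (dot x xi) * u x).

Definition spectrum (u v : T -> R) (xi : T) : R :=
  fourierRe u v xi ^+ 2 + fourierIm u v xi ^+ 2.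

Lemma spectrum_ge0 u v xi : 0 <= spectrum u v xi.
Proof. by rewrite addr_ge0 ?sqr_ge0. Qed.

Lemma normc_fourier (f : T -> R[i]) xi :
  ComplexField.Normc.normc (fourier f xi) ^+ 2 =
  spectrum (fun x => complex.Re (f x)) (fun x => complex.Im (f x)) xi.
Proof.
rewrite /fourier /Cintegral /ComplexField.Normc.normc sqr_sqrtr; last first.
  by rewrite addr_ge0 ?sqr_ge0.
rewrite /spectrum /fourierRe /fourierIm; congr (_ ^+ 2 + _ ^+ 2);
  apply: eq_Rintegral => x _; rewrite /expi; case: (f x) => a b /=;
  rewrite cosN sinN; ring.
Qed.

Lemma dotC (x y : T) : dot x y = dot y x.
Proof. by apply: eq_bigr => i _; rewrite mulrC. Qed.

Lemma dotBl (x y z : T) : dot (x - y) z = dot x z - dot y z.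
Proof.
rewrite /dot -sumrB; apply: eq_bigr => i _; rewrite !mxE; ring.
Qed.

Lemma measurable_dot2 : measurable_fun setT (fun p : T * T => dot p.1 p.2).
Proof.
apply: measurable_sum => i; apply: measurable_funM.
  by apply: (measurableT_comp (measurable_coord i)); exact: measurable_fst.
by apply: (measurableT_comp (measurable_coord i)); exact: measurable_snd.
Qed.

Lemma measurable_sin_comp d (X : measurableType d) (f : X -> R) :
  measurable_fun setT f -> measurable_fun setT (fun x => sin (f x)).
Proof.
move=> mf; apply: (measurableT_comp (f := @sin R)) => //.
by apply: continuous_measurable_fun; exact: continuous_sin.
Qed.

Variables u v : T -> R.
Hypothesis iu : lam.-integrable setT (EFin \o u).
Hypothesis iv : lam.-integrable setT (EFin \o v).

Let mu : measurable_fun setT u.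
Proof. by apply/measurable_EFinP; exact: measurable_int iu. Qed.

Let mv : measurable_fun setT v.
Proof. by apply/measurable_EFinP; exact: measurable_int iv. Qed.

Let A (x xi : T) := cos (dot x xi) * u x + sin (dot x xi) * v x.
Let B (x xi : T) := cos (dot x xi) * v x - sin (dot x xi) * u x.

Let measurable_A : measurable_fun setT (fun p : T * T => A p.2 p.1).
Proof.
have md : measurable_fun setT (fun p : T * T => dot p.2 p.1).
  by under eq_fun do rewrite dotC; exact: measurable_dot2.
apply: measurable_funD; apply: measurable_funM.
- exact: measurable_cos_comp.
- by apply: (measurableT_comp mu); exact: measurable_snd.
- exact: measurable_sin_comp.
- by apply: (measurableT_comp mv); exact: measurable_snd.
Qed.

Let measurable_B : measurable_fun setT (fun p : T * T => B p.2 p.1).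
Proof.
have md : measurable_fun setT (fun p : T * T => dot p.2 p.1).
  by under eq_fun do rewrite dotC; exact: measurable_dot2.
apply: measurable_funB; apply: measurable_funM.
- exact: measurable_cos_comp.
- by apply: (measurableT_comp mv); exact: measurable_snd.
- exact: measurable_sin_comp.
- by apply: (measurableT_comp mu); exact: measurable_snd.
Qed.

Lemma measurable_spectrum : measurable_fun setT (spectrum u v).
Proof.
apply: measurable_funD; apply: measurable_funX.
  apply: (measurableT_comp (f := fine)); first exact: fine_measurable.
  apply: (@measurable_integral_param _ _ _ _ _ lam (fun p : T * T => (A p.2 p.1)%:E)).
  exact/measurable_EFinP.
apply: (measurableT_comp (f := fine)); first exact: fine_measurable.
apply: (@measurable_integral_param _ _ _ _ _ lam (fun p : T * T => (B p.2 p.1)%:E)).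
exact/measurable_EFinP.
Qed.

Let iuv : lam.-integrable setT (EFin \o (fun x => `|u x| + `|v x|)).
Proof.
rewrite (_ : _ \o _ = (fun x => `|u x|%:E + `|v x|%:E)%E); last by apply/funext.
by apply: integrableD => //; exact: integrable_norm.
Qed.

Let A_le x xi : `|A x xi| <= `|u x| + `|v x|.
Proof.
rewrite /A (le_trans (ler_normD _ _))// !normrM lerD// ler_piMl// ler_norml.
  by rewrite cos_geN1 cos_le1.
by rewrite sin_geN1 sin_le1.
Qed.

Let B_le x xi : `|B x xi| <= `|u x| + `|v x|.
Proof.
rewrite /B (le_trans (ler_normD _ _))// normrN !normrM addrC lerD// ler_piMl// ler_norml.
  by rewrite sin_geN1 sin_le1.
by rewrite cos_geN1 cos_le1.
Qed.

Let integrable_A xi : lam.-integrable setT (EFin \o (A ^~ xi)).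
Proof.
apply: le_integrable iuv => //.
  by apply/measurable_EFinP; exact: (measurableT_comp measurable_A (pair1_measurable xi)).
by move=> x _; rewrite /= lee_fin [leRHS]ger0_norm// addr_ge0.
Qed.

Let integrable_B xi : lam.-integrable setT (EFin \o (B ^~ xi)).
Proof.
apply: le_integrable iuv => //.
  by apply/measurable_EFinP; exact: (measurableT_comp measurable_B (pair1_measurable xi)).
by move=> x _; rewrite /= lee_fin [leRHS]ger0_norm// addr_ge0.
Qed.

Lemma integrable_fourierRe xi :
  lam.-integrable setT (EFin \o (fun x => cos (dot x xi) * u x + sin (dot x xi) * v x)).
Proof. exact: integrable_A. Qed.

Lemma integrable_fourierIm xi :
  lam.-integrable setT (EFin \o (fun x => cos (dot x xi) * v x - sin (dot x xi) * u x)).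
Proof. exact: integrable_B. Qed.

(** With [f = u + i v], [P] and [Q] are the real and imaginary parts of [f x] times the conjugate of
    [f y]. Hence [G] below is the real part of [exp (- i (x - y) . xi)] times this product. *)
Let P (p : T * T) := u p.1 * u p.2 + v p.1 * v p.2.
Let Q (p : T * T) := v p.1 * u p.2 - u p.1 * v p.2.

Let integrable_P : (lam \x lam)%E.-integrable setT (EFin \o P).
Proof.
rewrite (_ : _ \o _ = (fun p => (u p.1 * u p.2)%:E + (v p.1 * v p.2)%:E)%E); last by apply/funext.
by apply: integrableD => //; exact: integrable_tensor.
Qed.

Let integrable_Q : (lam \x lam)%E.-integrable setT (EFin \o Q).
Proof.
rewrite (_ : _ \o _ = (fun p => (v p.1 * u p.2)%:E - (u p.1 * v p.2)%:E)%E); last by apply/funext.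
by apply: integrableB => //; exact: integrable_tensor.
Qed.

Let G (xi : T) (p : T * T) :=
  cos (dot (p.1 - p.2) xi) * P p + sin (dot (p.1 - p.2) xi) * Q p.

Let spectrumE xi : ((spectrum u v xi)%:E = \int[lam \x lam]_p (G xi p)%:E)%E.
Proof.
have iA := integrable_A xi; have iB := integrable_B xi.
rewrite /spectrum EFinD !expr2 -(Rintegral_tensor iA iA) -(Rintegral_tensor iB iB).
rewrite -integralD//; [|exact: (integrable_tensor iA iA)|exact: (integrable_tensor iB iB)].
apply: eq_integral => p _; rewrite -EFinD; congr EFin.
rewrite /G /P /Q /A /B dotBl cosB sinB; ring.
Qed.

(** The constant 1 in [integral_decay_1cos] is removed by subtracting the instance with frequency 0
    and phase [pi / 2], where the cosine vanishes. *)
Lemma integral_decay_cos (e : R) (z : T) (q : R) : 0 < e ->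
  lam.-integrable setT (fun x => (W e x * cos (dot z x + q))%:E) /\
  (\int[lam]_x (W e x * cos (dot z x + q))%:E = (cos q * K e z)%:E)%E.
Proof.
move=> e0.
have mc c : measurable_fun setT (fun x => W e x * cos (dot z x + c)).
  apply: measurable_funM; first exact: measurable_decay.
  by apply: measurable_cos_comp; apply: measurable_funD => //; exact: measurable_dot.
have i1 c w : lam.-integrable setT (fun x => (W e x * (1 + cos (dot w x + c)))%:E).
  apply/integrableP; split.
    apply/measurable_EFinP/measurable_funM; first exact: measurable_decay.
    apply: measurable_funD => //; apply: measurable_cos_comp.
    by apply: measurable_funD => //; exact: measurable_dot.
  under eq_integral do rewrite /= ger0_norm ?mulr_ge0 ?decay_ge0 ?cos1_ge0//.
  by rewrite integral_decay_1cos// ltry.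
have E : (fun x => (W e x * cos (dot z x + q))%:E) =
    (fun x => (W e x * (1 + cos (dot z x + q)))%:E - (W e x * (1 + cos (dot 0 x + pi / 2)))%:E)%E.
  apply/funext => x; rewrite -EFinB; congr EFin.
  have -> : dot 0 x = 0 by rewrite /dot big1// => i _; rewrite mxE mul0r.
  rewrite add0r cos_pihalf; ring.
split; first by rewrite E; exact: (integrableB measurableT (i1 q z) (i1 (pi / 2) 0)).
rewrite E (integralB measurableT (i1 q z) (i1 (pi / 2) 0)) !integral_decay_1cos// -EFinB; congr EFin.
rewrite cos_pihalf; ring.
Qed.

Lemma integrable_decay (e : R) : 0 < e -> lam.-integrable setT (EFin \o W e).
Proof.
move=> e0; have [+ _] := @integral_decay_cos e 0 0 e0.
congr (lam.-integrable setT _); apply/funext => x /=; congr EFin.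
have -> : dot 0 x = 0 by rewrite /dot big1// => i _; rewrite mxE mul0r.
by rewrite addr0 cos0 mulr1.
Qed.

(** Fubini in [(xi, (x, y))], with [W e xi * (|P| + |Q|)] as integrable majorant. The sine is a
    cosine of phase [- pi / 2], so its integral against [W e] carries the factor [cos (pi / 2) = 0]
    and [Q] drops out. *)
Lemma damped_parseval (e : R) : 0 < e ->
  (\int[lam]_xi (W e xi * spectrum u v xi)%:E =
   \int[lam \x lam]_p (P p * K e (p.1 - p.2))%:E)%E.
Proof.
move=> e0.
pose F (q : T * (T * T)) := (W e q.1 * G q.1 q.2)%:E.
have mP : measurable_fun setT P by apply/measurable_EFinP; exact: measurable_int integrable_P.
have mQ : measurable_fun setT Q by apply/measurable_EFinP; exact: measurable_int integrable_Q.
have md : measurable_fun setT (fun q : T * (T * T) => dot (q.2.1 - q.2.2) q.1).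
  have h : measurable_fun setT (fun q : T * (T * T) => (q.2.1 - q.2.2, q.1)).
    apply: measurable_fun_pair; last exact: measurable_fst.
    by apply: (measurableT_comp (@measurable_sub_rV R n)); exact: measurable_snd.
  exact: (measurableT_comp measurable_dot2 h).
have mF : measurable_fun setT F.
  apply/measurable_EFinP/measurable_funM.
    by apply: (measurableT_comp (@measurable_decay R n e)); exact: measurable_fst.
  apply: measurable_funD; apply: measurable_funM.
  - exact: measurable_cos_comp.
  - by apply: (measurableT_comp mP); exact: measurable_snd.
  - exact: measurable_sin_comp.
  - by apply: (measurableT_comp mQ); exact: measurable_snd.
have iPQ : (lam \x lam)%E.-integrable setT (EFin \o (fun p => `|P p| + `|Q p|)).
  rewrite (_ : _ \o _ = (fun p => `|P p|%:E + `|Q p|%:E)%E); last by apply/funext.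
  by apply: integrableD => //; exact: integrable_norm.
have G_le xi p : `|G xi p| <= `| `|P p| + `|Q p| |.
  rewrite /G [leRHS]ger0_norm ?addr_ge0//.
  rewrite (le_trans (ler_normD _ _))// !normrM lerD// ler_piMl// ler_norml.
    by rewrite cos_geN1 cos_le1.
  by rewrite sin_geN1 sin_le1.
have [lam2 lam2E] := product_measure1_sigma_finite lam lam.
rewrite -lam2E in iPQ *.
have iF : (lam \x lam2)%E.-integrable setT F.
  have iWPQ := @integrable_tensor _ _ _ _ _ lam lam2 _ _ (integrable_decay e0) iPQ.
  apply: le_integrable iWPQ => //.
  move=> [xi p] _; rewrite /F /= lee_fin !normrM ler_wpM2l//.
transitivity (\int[lam]_xi \int[lam2]_p F (xi, p))%E.
  apply: eq_integral => xi _; rewrite EFinM spectrumE -lam2E /F /=.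
  under [RHS]eq_integral do rewrite EFinM.
  rewrite integralZl//; apply: le_integrable iPQ => //.
    apply/measurable_EFinP; apply: measurable_funD; apply: measurable_funM => //.
    - by apply: measurable_cos_comp; exact: (measurableT_comp md (pair1_measurable xi)).
    - by apply: measurable_sin_comp; exact: (measurableT_comp md (pair1_measurable xi)).
  by move=> p _; rewrite /= lee_fin G_le.
rewrite Fubini//; apply: eq_integral => p _; rewrite /F/=.
have [i1 h1] := integral_decay_cos (p.1 - p.2) 0 e0.
have [i2 h2] := integral_decay_cos (p.1 - p.2) (- (pi / 2)) e0.
have -> : (fun x => (W e x * G x p)%:E) =
  (fun x => (P p)%:E * (W e x * cos (dot (p.1 - p.2) x + 0))%:E +
            (Q p)%:E * (W e x * cos (dot (p.1 - p.2) x + - (pi / 2)))%:E)%E.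
  apply/funext => x; rewrite -!EFinM -EFinD; congr EFin.
  rewrite /G addr0 cosBpihalf; ring.
rewrite integralD//; [|exact: integrableZl|exact: integrableZl].
rewrite !integralZl// h1 h2 -!EFinM -EFinD; congr EFin.
rewrite cos0 cosN cos_pihalf; ring.
Qed.

Hypothesis iu2 : lam.-integrable setT (EFin \o (fun x => u x ^+ 2)).
Hypothesis iv2 : lam.-integrable setT (EFin \o (fun x => v x ^+ 2)).

(** Polarisation: [2 w(x) w(y) = w(x)^2 + w(y)^2 - (w(x) - w(y))^2], where the first two terms
    integrate exactly because the kernel has mass [C] in each variable. *)
Lemma integral_poisson_tensor (e : R) (w : T -> R) : 0 < e ->
  measurable_fun setT w ->
  lam.-integrable setT (EFin \o (fun x => w x ^+ 2)) ->
  (lam \x lam)%E.-integrable setT (fun p => (w p.1 * w p.2 * K e (p.1 - p.2))%:E) /\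
  (\int[lam \x lam]_p (w p.1 * w p.2 * K e (p.1 - p.2))%:E + 2^-1%:E * energy e w =
   C%:E * \int[lam]_x (w x ^+ 2)%:E)%E.
Proof.
move=> e0 mw iw.
have mw2 : measurable_fun setT (fun x => w x ^+ 2) by exact: measurable_funX.
have w20 x : 0 <= w x ^+ 2 by exact: sqr_ge0.
have mw1 : measurable_fun setT (fun p : T * T => w p.1).
  by apply: (measurableT_comp mw); exact: measurable_fst.
have mw2' : measurable_fun setT (fun p : T * T => w p.2).
  by apply: (measurableT_comp mw); exact: measurable_snd.
have mK := @measurable_poisson_sub R n e e0.
have K0 p : 0 <= K e p by exact: poisson_rV_ge0.
have fin : (\int[lam]_x (w x ^+ 2)%:E < +oo)%E by exact: integrable_lty.
have C0 : 0 <= C by rewrite exprn_ge0// mulr_ge0// pi_ge0.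
have Cfin : (C%:E * \int[lam]_x (w x ^+ 2)%:E < +oo)%E.
  by rewrite lte_mul_pinfty.
have i1 : (lam \x lam)%E.-integrable setT (fun p => (w p.1 ^+ 2 * K e (p.1 - p.2))%:E).
  apply/integrableP; split; first by apply/measurable_EFinP/measurable_funM => //; exact: measurable_funX.
  under eq_integral do rewrite /= ger0_norm ?(mulr_ge0 (w20 _) (K0 _))//.
  by rewrite (integral_poisson_sub1 e0 mw2 w20).
have i2 : (lam \x lam)%E.-integrable setT (fun p => (w p.2 ^+ 2 * K e (p.1 - p.2))%:E).
  apply/integrableP; split; first by apply/measurable_EFinP/measurable_funM => //; exact: measurable_funX.
  under eq_integral do rewrite /= ger0_norm ?(mulr_ge0 (w20 _) (K0 _))//.
  by rewrite (integral_poisson_sub2 e0 mw2 w20).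
have ie : (lam \x lam)%E.-integrable setT (fun p => ((w p.1 - w p.2) ^+ 2 * K e (p.1 - p.2))%:E).
  apply/integrableP; split; first by apply/measurable_EFinP; exact: measurable_energy.
  under eq_integral do rewrite /= ger0_norm ?energy_integrand_ge0//.
  apply: (le_lt_trans (energy_le_sqr e0 mw)).
  by rewrite EFinM -muleA; apply: lte_mul_pinfty; rewrite ?lee_fin.
have E : (fun p : T * T => (w p.1 * w p.2 * K e (p.1 - p.2))%:E) =
  (fun p => 2^-1%:E * ((w p.1 ^+ 2 * K e (p.1 - p.2))%:E + (w p.2 ^+ 2 * K e (p.1 - p.2))%:E
    - ((w p.1 - w p.2) ^+ 2 * K e (p.1 - p.2))%:E))%E.
  by apply/funext => p; rewrite -!EFinD -EFinM; congr EFin; field.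
have iD := integrableD measurableT i1 i2.
have iB := integrableB measurableT iD ie.
split; first by rewrite E; exact: (integrableZl measurableT _ iB).
rewrite E integralZl// integralB// integralD//.
rewrite (integral_poisson_sub1 e0 mw2 w20) (integral_poisson_sub2 e0 mw2 w20) -/(energy e w).
have fE : energy e w \is a fin_num by exact: (integrable_fin_num measurableT ie).
have fI : (\int[lam]_x (w x ^+ 2)%:E)%E \is a fin_num by exact: (integrable_fin_num measurableT iw).
rewrite -(fineK fE) -(fineK fI) -!(EFinM, EFinN, EFinD); congr EFin; by field.
Qed.

Lemma parseval_energy (e : R) : 0 < e ->
  (\int[lam]_xi (W e xi * spectrum u v xi)%:E +
     2^-1%:E * (energy e u + energy e v) =
   C%:E * \int[lam]_x (u x ^+ 2 + v x ^+ 2)%:E)%E.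
Proof.
move=> e0; rewrite damped_parseval//.
have [i1 h1] := integral_poisson_tensor e0 mu iu2.
have [i2 h2] := integral_poisson_tensor e0 mv iv2.
under eq_integral do rewrite /P mulrDl EFinD.
rewrite integralD//.
under [in RHS]eq_integral do rewrite EFinD.
rewrite [in RHS]integralD//.
have sq0 (w : T -> R) : (0 <= \int[lam]_x (w x ^+ 2)%:E)%E.
  by apply: integral_ge0 => x _; rewrite lee_fin sqr_ge0.
rewrite (ge0_muleDr _ (energy_ge0 u e0) (energy_ge0 v e0)).
by rewrite (ge0_muleDr _ (sq0 u) (sq0 v)) -h1 -h2 addeACA.
Qed.

(** Upper bound: drop the nonnegative energies and let [e] decrease to 0 by monotone convergence.
    Lower bound: replace [W] by 1 and use that the energies become smaller than any [eps]. *)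
Lemma plancherel :
  (\int[lam]_xi (spectrum u v xi)%:E =
   C%:E * \int[lam]_x (u x ^+ 2 + v x ^+ 2)%:E)%E.
Proof.
have vu : energy_cvg0 u by exact: energy_cvg0_L2.
have vv : energy_cvg0 v by exact: energy_cvg0_L2.
pose W_ (k : nat) := W k.+1%:R^-1.
have k0 (k : nat) : 0 < k.+1%:R^-1 :> R by rewrite invr_gt0.
have cv1 : (\int[lam]_xi (W_ k xi * spectrum u v xi)%:E @[k --> \oo] -->
    \int[lam]_xi (spectrum u v xi)%:E)%E.
  have cW xi : (W_ k xi * spectrum u v xi)%:E @[k --> \oo] --> (spectrum u v xi)%:E.
    apply: cvg_EFin; first exact: nearW.
    rewrite -[X in _ --> X]mul1r; apply: cvgM; last exact: cvg_cst.
    exact: cvg_decay.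
  rewrite (_ : (fun xi => (spectrum u v xi)%:E) =
      fun xi => limn (fun k => (W_ k xi * spectrum u v xi)%:E)); last first.
    by apply/funext => xi; apply/esym/cvg_lim => //; exact: cW.
  apply: cvg_monotone_convergence => //.
  - move=> k; apply/measurable_EFinP/measurable_funM; last exact: measurable_spectrum.
    exact: measurable_decay.
  - by move=> k xi _; rewrite lee_fin mulr_ge0 ?decay_ge0 ?spectrum_ge0.
  - move=> xi _ i j ij; rewrite lee_fin ler_wpM2r ?spectrum_ge0//.
    rewrite /W_ !decayE ler_expR lerN2 ler_wpM2r ?norm1_ge0//.
    by rewrite lef_pV2 ?posrE// ler_nat.
apply/eqP; rewrite eq_le; apply/andP; split.
  apply: (cvge_to_le cv1); apply: nearW => k.
  rewrite -(parseval_energy (k0 k)) leeDl// mule_ge0// ?lee_fin//.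
  by rewrite adde_ge0// energy_ge0.
apply/lee_addgt0Pr => eps eps0.
have [N1 h1] := vu.2 _ eps0; have [N2 h2] := vv.2 _ eps0.
pose k := maxn N1 N2.
rewrite -(parseval_energy (k0 k)) leeD//.
  apply: ge0_le_integral => //.
  - by move=> xi _; rewrite lee_fin mulr_ge0 ?decay_ge0 ?spectrum_ge0.
  - apply/measurable_EFinP/measurable_funM; last exact: measurable_spectrum.
    exact: measurable_decay.
  - by apply/measurable_EFinP; exact: measurable_spectrum.
  - by move=> xi _; rewrite lee_fin ler_piMl ?spectrum_ge0 ?decay_le1.
apply: (@le_trans _ _ (2^-1%:E * (eps%:E + eps%:E))%E).
  apply: lee_wpmul2l; first by rewrite lee_fin.
  by apply: leeD; [apply: h1; exact: leq_maxl|apply: h2; exact: leq_maxr].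
by rewrite -EFinD -EFinM lee_fin; lra.
Qed.

End parseval.

(** * The form domain *)

Section C1_lipschitz.
Variables (R : realType) (n : nat).
Local Notation T := 'rV[R]_n.

Lemma continuous_bounded_box (g : T -> R) (r : R) : continuous g ->
  exists2 M : R, 0 <= M & forall x : T, (forall i, `|x ord0 i| <= r) -> `|g x| <= M.
Proof.
move=> cg.
have cB : compact [set x : T | forall i, `[- r, r]%classic (x ord0 i)].
  by apply: (rV_compact (A := fun=> `[- r, r]%classic)) => _; exact: segment_compact.
have := continuous_compact (continuous_subspaceT cg) cB.
move=> /compact_bounded[M [_ hM]].
exists (`|M| + 1); first by rewrite addr_ge0.
move=> x hx; apply: (hM (`|M| + 1)).
  by rewrite (le_lt_trans (ler_norm _))// ltrDl.
exists x => //= i; rewrite in_itv/= -ler_norml; exact: hx.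
Qed.

Lemma derivable_line (u : T -> R) (v w : T) (t : R) : derivable u (w + t *: v) v ->
  is_derive t 1 (fun s : R => u (w + s *: v)) ('D_v u (w + t *: v)).
Proof.
move=> du.
have E : (fun h : R => h^-1 *: (((fun s : R => u (w + s *: v)) \o shift t) (h *: 1) - u (w + t *: v)))
   = (fun h => h^-1 *: ((u \o shift (w + t *: v)) (h *: v) - u (w + t *: v))).
  apply/funext => h /=; congr (_ *: (u _ - _)).
  by rewrite /shift/= [h *: 1]mulr1 scalerDl addrCA.
by split; rewrite /derivable /derive E.
Qed.

Lemma increment_le (f df : R -> R) (M a b : R) :
  (forall x : R, is_derive x 1 f (df x)) ->
  (forall x, Num.min a b <= x <= Num.max a b -> `|df x| <= M) ->
  `|f b - f a| <= M * `|b - a|.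
Proof.
move=> fd.
have cf : continuous f.
  by move=> x; apply: differentiable_continuous; apply/derivable1_diffP; have [] := fd x.
wlog ab : a b / a <= b.
  move=> W; case/orP: (le_total a b) => ba; first exact: (W _ _ ba).
  by rewrite minC maxC distrC [X in _ <= _ * X]distrC; exact: (W _ _ ba).
rewrite min_l// max_r// => h.
have [c] := MVT_segment ab (fun x _ => fd x) (continuous_subspaceT cf).
rewrite in_itv/= => cab ->; rewrite normrM ler_wpM2r//; exact: h.
Qed.

Variables (u : T -> R) (r : R).
Hypothesis cu : continuous u.
Hypothesis du : forall i x, derivable u x (delta_mx ord0 i).
Hypothesis cdu : forall i, continuous (fun x => 'D_(delta_mx ord0 i) u x).
Hypothesis u0 : forall x : T, r < `|x| -> u x = 0.

(** Only partial derivatives are at hand, so the increment is telescoped along a path that changes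
    one coordinate at a time, with the mean value theorem on each segment. The path stays in a box,
    where the continuous partial derivatives are bounded. *)
Lemma C1_lipschitz : exists2 L : R, 0 <= L &
  forall x y, `|u x - u y| <= L * Num.min 1 `|x - y|.
Proof.
(* The margin 1 serves points at distance below 1: if one of them lies outside radius [r + 1], the
   other lies outside radius [r], and [u] vanishes at both. *)
have [M0 M00 hM0] := continuous_bounded_box (r + 1) cu.
have /choice[m hm] : forall i : 'I_n, exists m : R, 0 <= m /\
    forall x : T, (forall j, `|x ord0 j| <= r + 1) -> `|'D_(delta_mx ord0 i) u x| <= m.
  by move=> i; have [m m0 hm] := continuous_bounded_box (r + 1) (@cdu i); exists m.
have box (x : T) : `|x| <= r + 1 -> forall i, `|x ord0 i| <= r + 1.
  by move=> xr i; rewrite (le_trans (coord_le_norm x i)).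
have uM (x : T) : `|u x| <= M0.
  have [xr|xr] := leP `|x| (r + 1); first by apply: hM0; exact: box.
  by rewrite u0 ?normr0//; lra.
pose S := \sum_i m i.
have S0 : 0 <= S by apply: sumr_ge0 => i _; exact: (hm i).1.
have main (x y : T) : `|x| <= r + 1 -> `|y| <= r + 1 -> `|u x - u y| <= S * `|x - y|.
  move=> xr yr.
  pose z (k : nat) : T := \row_i (if (i < k)%N then y ord0 i else x ord0 i).
  have z0 : z 0 = x by apply/rowP => i; rewrite mxE ltn0.
  have zn : z n = y by apply/rowP => i; rewrite mxE ltn_ord.
  have -> : u x - u y = \sum_(i < n) (u (z i) - u (z i.+1)).
    rewrite -(big_mkord xpredT (fun i => u (z i) - u (z i.+1))).
    rewrite -[in LHS]z0 -[in LHS]zn -opprB -(telescope_sumr (fun k => u (z k)) (leq0n n)) -sumrN.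
    by apply: eq_bigr => i _; rewrite opprB.
  rewrite (le_trans (ler_norm_sum _ _ _))// mulr_suml ler_sum// => k _.
  (* [z k] and [z k.+1] differ in coordinate [k] only; with that coordinate set to 0 they share the
     base point [w] of a line in direction [k]. *)
  pose w : T := \row_i (if i == k then 0 else z k ord0 i).
  have zE (a : R) (k' : nat) : z k' ord0 k = a -> (forall i, i != k -> z k' ord0 i = z k ord0 i) ->
      z k' = w + a *: delta_mx ord0 k.
    move=> ha hz; apply/rowP => i; have [->|ik] := eqVneq i k.
      by rewrite ha !mxE !eqxx/= add0r mulr1.
    by rewrite (hz i ik) !mxE eqxx/= (negPf ik) mulr0 addr0.
  have zk : z k = w + x ord0 k *: delta_mx ord0 k.
    by apply: zE => //; rewrite mxE ltnn.
  have zk1 : z k.+1 = w + y ord0 k *: delta_mx ord0 k.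
    apply: zE => [|i ik]; first by rewrite mxE ltnS leqnn.
    by rewrite !mxE ltnS leq_eqVlt; move: ik; rewrite -(inj_eq val_inj)/= => /negPf ->.
  rewrite zk zk1 distrC.
  apply: (@le_trans _ _ (m k * `|y ord0 k - x ord0 k|)); last first.
    rewrite ler_wpM2l ?(hm k).1// distrC.
    by have := coord_le_norm (x - y) k; rewrite !mxE.
  apply: (increment_le (f := fun s => u (w + s *: delta_mx ord0 k))
    (fun t => derivable_line (@du k (w + t *: delta_mx ord0 k)))).
  move=> t tk; apply: (hm k).2 => j; rewrite !mxE eqxx/=.
  have [_|jk] := eqVneq j k.
    rewrite add0r mulr1 ler_norml.
    have := box _ xr k; have := box _ yr k; rewrite !ler_norml.
    move: tk; have [] := leP (x ord0 k) (y ord0 k) => _ /andP[t1 t2] /andP[t3 t4] /andP[t5 t6];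
      apply/andP; split; lra.
  rewrite mulr0 addr0; case: ifP => _; exact: box.
(* [S] serves points at distance below 1, and [2 * M0] bounds the increment between distant ones. *)
exists (S + 2 * M0); first by rewrite addr_ge0// mulr_ge0.
have LS (x y : T) : S * `|x - y| <= (S + 2 * M0) * `|x - y|.
  by rewrite ler_wpM2r// lerDl mulr_ge0.
have L2 (x y : T) : `|u x - u y| <= S + 2 * M0.
  rewrite (le_trans (ler_normB _ _))//; have := uM x; have := uM y; lra.
move=> x y; have [xy|xy] := leP 1 `|x - y|; first by rewrite mulr1.
have [xr|xr] := leP `|x| (r + 1); have [yr|yr] := leP `|y| (r + 1).
- exact: le_trans (main _ _ xr yr) (LS _ _).
- have xr' : r < `|x| by have := lerB_dist y x; rewrite distrC; lra.
  by rewrite !u0 ?subrr ?normr0 ?mulr_ge0 ?addr_ge0 ?mulr_ge0//; lra.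
- have yr' : r < `|y| by have := lerB_dist x y; lra.
  by rewrite !u0 ?subrr ?normr0 ?mulr_ge0 ?addr_ge0 ?mulr_ge0//; lra.
- by rewrite !u0 ?subrr ?normr0 ?mulr_ge0 ?addr_ge0 ?mulr_ge0//; lra.
Qed.

End C1_lipschitz.

(** * Half a derivative from energies of order [e] *)

Section sobolev_half.
Variables (R : realType) (n : nat).
Local Notation T := 'rV[R]_n.
Local Notation lam := (@lebesgue_rV R n).
Local Notation W := (@decay R n).

(** From [1 + t <= expR t]: the right side is at least [t / (1 + t)], which is at least half of
    [min t 1]. *)
Lemma expR_half_le (t : R) : 0 <= t -> Num.min t 1 / 2 <= 1 - expR (- t).
Proof.
move=> t0; rewrite expRN.
have h : 1 + t <= expR t by exact: expR_ge1Dx.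
have h1 : (expR t)^-1 <= (1 + t)^-1 by rewrite lef_pV2// posrE; [exact: expR_gt0|lra].
have h2 : (1 + t)^-1 <= 1 - Num.min t 1 / 2.
  rewrite -[leLHS]div1r ler_pdivrMr; last by lra.
  by have [t1|t1] := leP t 1; nra.
by lra.
Qed.

Lemma measurable_norm1 : measurable_fun setT (@norm1 R n).
Proof.
apply: measurable_sum => i; apply: measurableT_comp => //.
exact: measurable_coord.
Qed.

(* Testing Plancherel against [1 - W e] shows that an energy of order [e]
   gives half a derivative in [L^2]. *)
Lemma integral_norm1_spectrum (u v : T -> R) (c : R) :
  lam.-integrable setT (EFin \o u) -> lam.-integrable setT (EFin \o v) ->
  lam.-integrable setT (EFin \o (fun x => u x ^+ 2)) ->
  lam.-integrable setT (EFin \o (fun x => v x ^+ 2)) ->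
  (forall k : nat, energy k.+1%:R^-1 u <= (c * k.+1%:R^-1)%:E)%E ->
  (forall k : nat, energy k.+1%:R^-1 v <= (c * k.+1%:R^-1)%:E)%E ->
  (\int[lam]_xi (norm1 xi * spectrum u v xi)%:E < +oo)%E.
Proof.
move=> iu iv iu2 iv2 hu hv.
have mS := measurable_spectrum iu iv.
have S0 := spectrum_ge0 u v.
have k0 (k : nat) : 0 < k.+1%:R^-1 :> R by rewrite invr_gt0.
(* Plancherel minus the damped identity leaves half the sum of the two energies; the subtraction is
   legitimate because the damped integral is finite. *)
have defect (k : nat) :
    (\int[lam]_xi ((1 - W k.+1%:R^-1 xi) * spectrum u v xi)%:E <= (c * k.+1%:R^-1)%:E)%E.
  set J := (X in (X <= _)%E).
  have p := parseval_energy iu iv iu2 iv2 (k0 k).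
  rewrite -(plancherel iu iv iu2 iv2) in p.
  have Wfin : (\int[lam]_xi (W k.+1%:R^-1 xi * spectrum u v xi)%:E)%E \is a fin_num.
    rewrite ge0_fin_numE; last first.
      by apply: integral_ge0 => x _; rewrite lee_fin mulr_ge0// decay_ge0.
    apply: (@le_lt_trans _ _ (\int[lam]_xi (spectrum u v xi)%:E)%E).
      rewrite -p leeDl// mule_ge0 ?lee_fin// adde_ge0 ?energy_ge0//.
    rewrite (plancherel iu iv iu2 iv2).
    under eq_integral do rewrite EFinD.
    rewrite integralD//; apply: lte_mul_pinfty => //.
      by rewrite lee_fin exprn_ge0// mulr_ge0// pi_ge0.
    by rewrite lte_add_pinfty// integrable_lty.
  have E : (\int[lam]_xi (spectrum u v xi)%:E =
      \int[lam]_xi (W k.+1%:R^-1 xi * spectrum u v xi)%:E + J)%E.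
    rewrite -ge0_integralD//=.
    - by apply: eq_integral => xi _; rewrite -EFinD; congr EFin; ring.
    - by move=> x _; rewrite lee_fin mulr_ge0// decay_ge0.
    - by apply/measurable_EFinP/measurable_funM => //; exact: measurable_decay.
    - by move=> x _; rewrite lee_fin mulr_ge0// subr_ge0 decay_le1.
    - apply/measurable_EFinP/measurable_funM => //; apply: measurable_funB => //.
      exact: measurable_decay.
  rewrite E in p; rewrite -(leeD2lE _ _ Wfin) -p (leeD2lE _ _ Wfin).
  apply: (@le_trans _ _ (2^-1%:E * ((c * k.+1%:R^-1)%:E + (c * k.+1%:R^-1)%:E))%E).
    by apply: lee_wpmul2l; rewrite ?lee_fin//; exact: leeD.
  by rewrite -EFinD -EFinM lee_fin; set a := c * _; lra.
(* By [expR_half_le] at [t = norm1 xi / (k + 1)], the truncated weight is at most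
   [2 (k + 1) (1 - W)]. The factor [k + 1] cancels the order of the defect, so the bound [2 c] is
   uniform in [k] and the truncation is removed by monotone convergence. *)
pose f (k : nat) (xi : T) := Num.min (norm1 xi) k.+1%:R * spectrum u v xi.
have f0 k xi : 0 <= f k xi by rewrite mulr_ge0// le_min norm1_ge0/=.
have mf k : measurable_fun setT (f k).
  by apply: measurable_funM => //; apply: measurable_minr => //; exact: measurable_norm1.
have fle k : (\int[lam]_xi (f k xi)%:E <= (2 * c)%:E)%E.
  have k1 : 0 < k.+1%:R :> R by [].
  apply: (@le_trans _ _ ((2 * k.+1%:R)%:E * (c * k.+1%:R^-1)%:E)%E); last first.
    by rewrite -EFinM lee_fin le_eqVlt; apply/orP; left; apply/eqP; field.
  apply: (@le_trans _ _ ((2 * k.+1%:R)%:E * \int[lam]_xi ((1 - W k.+1%:R^-1 xi) * spectrum u v xi)%:E)%E); last first.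
    by apply: lee_wpmul2l; rewrite ?lee_fin ?mulr_ge0.
  rewrite -ge0_integralZl//; last 2 first.
  - apply/measurable_EFinP/measurable_funM => //; apply: measurable_funB => //.
    exact: measurable_decay.
  - by move=> x _; rewrite lee_fin mulr_ge0// subr_ge0 decay_le1.
  apply: ge0_le_integral => //.
  - by move=> x _; rewrite lee_fin.
  - exact/measurable_EFinP.
  - apply: measurable_funeM; apply/measurable_EFinP/measurable_funM => //.
    by apply: measurable_funB => //; exact: measurable_decay.
  - move=> xi _; rewrite -EFinM lee_fin /f mulrA ler_wpM2r//.
    rewrite decayE; have t0 : 0 <= k.+1%:R^-1 * norm1 xi by rewrite mulr_ge0 ?norm1_ge0 ?ltW.
    have h := expR_half_le t0.
    have -> : Num.min (norm1 xi) k.+1%:R = k.+1%:R * Num.min (k.+1%:R^-1 * norm1 xi) 1.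
      by rewrite minr_pMr ?ltW// mulr1 mulrA divff ?mul1r// lt0r_neq0.
    rewrite [2 * _]mulrC -mulrA ler_wpM2l ?(ltW k1)//.
    move: h; set a := expR _; set m := Num.min _ 1; lra.
apply: (@le_lt_trans _ _ (2 * c)%:E); last exact: ltry.
rewrite (_ : (fun xi => (norm1 xi * spectrum u v xi)%:E) = fun xi => limn (fun k => (f k xi)%:E)); last first.
  apply/funext => xi; apply/esym/cvg_lim => //; apply: cvg_near_cst.
  near=> k; rewrite /f min_l//; near: k.
  have [N _ hN] := nbhs_infty_ger (norm1 xi).
  by exists N => // k Nk; rewrite (le_trans (hN k Nk))// ler_nat.
rewrite monotone_convergence//.
- apply: lime_le; last exact: nearW.
  apply: ereal_nondecreasing_is_cvgn => i j ij; apply: ge0_le_integral => //.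
  + by move=> x _; rewrite lee_fin.
  + exact/measurable_EFinP.
  + exact/measurable_EFinP.
  + move=> xi _; rewrite lee_fin ler_wpM2r//.
    by rewrite le_min ge_min lexx ge_min ler_nat ltnS ij orbT.
- by move=> k; exact/measurable_EFinP.
- by move=> k x _; rewrite lee_fin.
- move=> xi _ i j ij; rewrite lee_fin ler_wpM2r//.
  by rewrite le_min ge_min lexx ge_min ler_nat ltnS ij orbT.
Unshelve. all: by end_near. Qed.

End sobolev_half.

(** * Finiteness of the logarithmic integral on the form domain *)

Section form_domain.
Variables (R : realType) (n : nat).
Local Notation T := 'rV[R]_n.
Local Notation lam := (@lebesgue_rV R n).
Local Notation C := ((2 * pi) ^+ n : R).

Lemma C1_compact_energy (w : T -> R) (r : R) : Ck 1 w ->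
  (forall x, r < `|x| -> w x = 0) ->
  [/\ lam.-integrable setT (EFin \o w),
      lam.-integrable setT (EFin \o (fun x => w x ^+ 2)) &
      exists2 c : R, 0 <= c &
        forall k : nat, (energy k.+1%:R^-1 w <= (c * k.+1%:R^-1)%:E)%E].
Proof.
move=> [cw dw] w0.
have mw : measurable_fun setT w by exact: continuous_measurable_rV.
have [L L0 hL] := C1_lipschitz cw (fun i => (dw i).1) (fun i => (dw i).2.1) w0.
have [M M0 hM] := continuous_bounded_box r cw.
have wM x : `|w x| <= M.
  have [xr|xr] := leP `|x| r; last by rewrite w0 ?normr0.
  by apply: hM => i; rewrite (le_trans (coord_le_norm x i)).
pose S : set T := ball (0 : T) (`|r| + 1).
have wS x : ~ S x -> w x = 0.
  move=> Sx; apply: w0; rewrite ltNge; apply/negP => xr; apply: Sx.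
  rewrite /S mx_norm_ball /ball_/= sub0r normrN.
  by have := ler_norm r; lra.
have mS : measurable S by exact: measurable_ball_rV.
have Sfin : (lam S < +oo)%E by exact: lebesgue_rV_ball_fin.
have iS (c : R) : lam.-integrable setT (EFin \o (fun x => c * \1_S x)).
  rewrite (_ : _ \o _ = (fun x => c%:E * (\1_S x)%:E)%E); last exact/funext.
  apply: integrableZl => //; apply/integrableP; split.
    exact/measurable_EFinP/measurable_indic.
  under eq_integral do rewrite /= ger0_norm//.
  by rewrite integral_indic ?setIT.
have dom (f : T -> R) (c : R) : measurable_fun setT f -> (forall x, ~ S x -> f x = 0) ->
    (forall x, `|f x| <= c) -> lam.-integrable setT (EFin \o f).
  move=> mf f0 fc; apply: le_integrable (iS c) => //; first exact/measurable_EFinP.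
  move=> x _ /=; rewrite lee_fin (le_trans _ (ler_norm _))// indicE.
  have [xS|xS] := boolP (x \in S); first by rewrite mulr1.
  rewrite f0 ?normr0 ?mulr0//; move: xS; by rewrite notin_setE.
split.
- exact: (dom _ M).
- apply: (dom _ (M ^+ 2)); first exact: measurable_funX.
    by move=> x /wS ->; rewrite expr0n.
  by move=> x; rewrite normrX lerXn2r ?nnegrE.
- pose V := fine (lam S); have VE : lam S = V%:E by rewrite fineK// ge0_fin_numE.
  have V0 : 0 <= V by exact: fine_ge0.
  exists (L ^+ 2 * n%:R * (4 * C) * V).
    by rewrite !mulr_ge0 ?exprn_ge0 ?mulr_ge0 ?pi_ge0.
  move=> k; have k0 : 0 < k.+1%:R^-1 :> R by rewrite invr_gt0.
  apply: (le_trans (energy_lipschitz k0 (sqr_ge0 L) mw mS wS _)).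
    move=> x y; rewrite -[leLHS]real_normK ?num_real//.
    apply: (@le_trans _ _ ((L * Num.min 1 `|x - y|) ^+ 2)).
      by rewrite lerXn2r ?nnegrE// mulr_ge0// le_min ler01/=.
    by rewrite exprMn ler_wpM2l ?sqr_ge0// min1_norm_le.
  rewrite VE -EFinM lee_fin le_eqVlt; apply/orP; left; apply/eqP; ring.
Qed.

Lemma Cc_infty_component Omega (g : T -> R[i]) : Cc_infty Omega g ->
  exists r : R, [/\ Ck 1 (fun x => complex.Re (g x)), Ck 1 (fun x => complex.Im (g x)),
    (forall x, r < `|x| -> complex.Re (g x) = 0) &
    (forall x, r < `|x| -> complex.Im (g x) = 0)].
Proof.
move=> [sg cg _].
have /compact_bounded[M [_ hM]] := cg.
have g0 x : `|M| + 1 < `|x| -> g x = 0.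
  move=> xM; apply/eqP; apply: contraTT xM => gx; rewrite -leNgt.
  apply: hM; first by rewrite (le_lt_trans (ler_norm _))// ltrDl.
  exact: subset_closure.
exists (`|M| + 1); split; [exact: (sg 1%N).1|exact: (sg 1%N).2| |];
  by move=> x /g0 ->.
Qed.

Lemma euclidean_norm_ge0 (x : T) : 0 <= euclidean_norm x.
Proof. exact: sqrtr_ge0. Qed.

Lemma euclidean_norm_le_norm1 (x : T) : euclidean_norm x <= norm1 x.
Proof.
rewrite -[leRHS]ger0_norm ?norm1_ge0// -sqrtr_sqr ler_wsqrtr//.
rewrite /dot /norm1 expr2 mulr_suml ler_sum// => i _.
rewrite -expr2 -[leLHS]real_normK ?num_real// expr2 ler_wpM2l//.
by rewrite (bigD1 i)//= lerDl sumr_ge0.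
Qed.

Lemma ln_expR1D_ge0 (t : R) : 0 <= t -> 0 <= ln (expR 1 + t).
Proof.
move=> t0; rewrite ln_ge0//; have := expR_ge1Dx (1 : R); lra.
Qed.

Lemma ln_expR1D_le (t : R) : 0 <= t -> ln (expR 1 + t) <= expR 1 + t.
Proof.
move=> t0; have e0 := expR_gt0 (1 : R).
rewrite -ler_expR lnK ?posrE; last by lra.
by rewrite (le_trans _ (expR_ge1Dx _))//; lra.
Qed.

Lemma measurable_euclidean_norm : measurable_fun setT (@euclidean_norm R n).
Proof.
apply: (measurableT_comp (f := @Num.sqrt R)).
  by apply: continuous_measurable_fun; exact: sqrt_continuous.
by apply: measurable_sum => i; apply: measurable_funM; exact: measurable_coord.
Qed.

Lemma measurable_ln_weight :
  measurable_fun setT (fun x : T => ln (expR 1 + euclidean_norm x)).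
Proof.
apply: (measurableT_comp (f := @ln R)); first exact: measurable_ln.
by apply: measurable_funD => //; exact: measurable_euclidean_norm.
Qed.

Section spectrum_add.
Variables u1 v1 u2 v2 : T -> R.
Hypotheses (iu1 : lam.-integrable setT (EFin \o u1)) (iv1 : lam.-integrable setT (EFin \o v1))
  (iu2 : lam.-integrable setT (EFin \o u2)) (iv2 : lam.-integrable setT (EFin \o v2)).

Lemma spectrumD_le xi :
  spectrum (fun x => u1 x + u2 x) (fun x => v1 x + v2 x) xi <=
  2 * spectrum u1 v1 xi + 2 * spectrum u2 v2 xi.
Proof.
have ReE : fourierRe (fun x => u1 x + u2 x) (fun x => v1 x + v2 x) xi =
    fourierRe u1 v1 xi + fourierRe u2 v2 xi.
  rewrite /fourierRe -RintegralD//.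
  - by apply: eq_Rintegral => x _; ring.
  - exact: integrable_fourierRe.
  - exact: integrable_fourierRe.
have ImE : fourierIm (fun x => u1 x + u2 x) (fun x => v1 x + v2 x) xi =
    fourierIm u1 v1 xi + fourierIm u2 v2 xi.
  rewrite /fourierIm -RintegralD//.
  - by apply: eq_Rintegral => x _; ring.
  - exact: integrable_fourierIm.
  - exact: integrable_fourierIm.
rewrite /spectrum ReE ImE.
have := sqr_ge0 (fourierRe u1 v1 xi - fourierRe u2 v2 xi).
have := sqr_ge0 (fourierIm u1 v1 xi - fourierIm u2 v2 xi).
set a := fourierRe _ _ _; set b := fourierRe _ _ _; set c := fourierIm _ _ _; set d := fourierIm _ _ _.
nra.
Qed.

End spectrum_add.

(** The crude bound [ln (expR 1 + |xi|) <= expR 1 + norm1 xi] suffices: Plancherel controls the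
    constant and the half derivative controls [norm1]. *)
Lemma star_norm_Cc_infty Omega (g : T -> R[i]) : Cc_infty Omega g ->
  [/\ lam.-integrable setT (fun x => (complex.Re (g x))%:E),
      lam.-integrable setT (fun x => (complex.Im (g x))%:E) &
      (star_norm_sq g < +oo)%E].
Proof.
move=> /Cc_infty_component[r [cu cv u0 v0]].
have [iu iu2 [c1 c10 hc1]] := C1_compact_energy cu u0.
have [iv iv2 [c2 c20 hc2]] := C1_compact_energy cv v0.
split=> //.
have fin1 := @integral_norm1_spectrum _ _ _ _ (c1 + c2) iu iv iu2 iv2.
set u := fun x => complex.Re (g x) in iu iu2 hc1 fin1.
set v := fun x => complex.Im (g x) in iv iv2 hc2 fin1.
have {}fin1 : (\int[lam]_xi (norm1 xi * spectrum u v xi)%:E < +oo)%E.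
  apply: fin1 => k.
    by apply: (le_trans (hc1 k)); rewrite lee_fin ler_wpM2r// lerDl.
  by apply: (le_trans (hc2 k)); rewrite lee_fin ler_wpM2r// lerDr.
have mS := measurable_spectrum iu iv.
have fin0 : (\int[lam]_xi (spectrum u v xi)%:E < +oo)%E.
  rewrite (plancherel iu iv iu2 iv2).
  under eq_integral do rewrite EFinD.
  rewrite integralD//; apply: lte_mul_pinfty => //.
    by rewrite lee_fin exprn_ge0// mulr_ge0// pi_ge0.
  by rewrite lte_add_pinfty// integrable_lty.
rewrite /star_norm_sq.
under eq_integral do rewrite normc_fourier -/u -/v.
apply: (@le_lt_trans _ _ ((expR 1)%:E * \int[lam]_xi (spectrum u v xi)%:E +
   \int[lam]_xi (norm1 xi * spectrum u v xi)%:E)%E); last first.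
  by rewrite lte_add_pinfty// lte_mul_pinfty// lee_fin expR_ge0.
rewrite -ge0_integralZl//; last 2 first.
- exact/measurable_EFinP.
- by move=> x _; rewrite lee_fin spectrum_ge0.
rewrite -ge0_integralD//; last 4 first.
- by move=> x _; rewrite mule_ge0// lee_fin ?expR_ge0 ?spectrum_ge0.
- by apply: measurable_funeM; exact/measurable_EFinP.
- by move=> x _; rewrite lee_fin mulr_ge0 ?norm1_ge0 ?spectrum_ge0.
- by apply/measurable_EFinP/measurable_funM => //; exact: measurable_norm1.
apply: ge0_le_integral => //.
- by move=> x _; rewrite lee_fin mulr_ge0 ?spectrum_ge0 ?ln_expR1D_ge0 ?euclidean_norm_ge0.
- by apply/measurable_EFinP/measurable_funM => //; exact: measurable_ln_weight.
- apply: emeasurable_funD; first by apply: measurable_funeM; exact/measurable_EFinP.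
  by apply/measurable_EFinP/measurable_funM => //; exact: measurable_norm1.
- move=> x _; rewrite -EFinM -EFinD lee_fin -mulrDl ler_wpM2r ?spectrum_ge0//.
  rewrite (le_trans (ln_expR1D_le (euclidean_norm_ge0 x)))// lerD2l.
  exact: euclidean_norm_le_norm1.
Qed.

(** L^2 lies in L^1 here because [|w| <= 1_Omega + w^2] for [w] vanishing outside a set of finite
    measure. *)
Lemma L2_integrable Omega (f : T -> R[i]) : measurable Omega -> (lam Omega < +oo)%E ->
  L2 Omega f ->
  [/\ lam.-integrable setT (fun x => (complex.Re (f x))%:E),
      lam.-integrable setT (fun x => (complex.Im (f x))%:E),
      lam.-integrable setT (fun x => (complex.Re (f x) ^+ 2)%:E) &
      lam.-integrable setT (fun x => (complex.Im (f x) ^+ 2)%:E)].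
Proof.
move=> mO Ofin [mu mv fin f0].
have normcE x : ComplexField.Normc.normc (f x) ^+ 2 = complex.Re (f x) ^+ 2 + complex.Im (f x) ^+ 2.
  by case: (f x) => a b /=; rewrite sqr_sqrtr// addr_ge0 ?sqr_ge0.
have i2 : lam.-integrable setT (fun x => (complex.Re (f x) ^+ 2 + complex.Im (f x) ^+ 2)%:E).
  apply/integrableP; split.
    by apply/measurable_EFinP; apply: measurable_funD; exact: measurable_funX.
  move: fin; under eq_integral do rewrite normcE.
  by under [X in _ -> (X < _)%E]eq_integral do rewrite /= ger0_norm ?addr_ge0 ?sqr_ge0//.
have iO : lam.-integrable setT (EFin \o \1_Omega).
  apply/integrableP; split; first exact/measurable_EFinP/measurable_indic.
  under eq_integral do rewrite /= ger0_norm//.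
  by rewrite integral_indic ?setIT.
have dom2 (w : T -> R) : measurable_fun setT w ->
   (forall x, w x ^+ 2 <= complex.Re (f x) ^+ 2 + complex.Im (f x) ^+ 2) ->
   lam.-integrable setT (EFin \o (fun x => w x ^+ 2)).
  move=> mw hw; apply: le_integrable i2 => //.
    by apply/measurable_EFinP; exact: measurable_funX.
  by move=> x _ /=; rewrite lee_fin (ger0_norm (sqr_ge0 _)) (le_trans (hw x))// ler_norm.
have dom1 (w : T -> R) : measurable_fun setT w -> (forall x, ~ Omega x -> w x = 0) ->
   lam.-integrable setT (EFin \o (fun x => w x ^+ 2)) ->
   lam.-integrable setT (EFin \o w).
  move=> mw w0 iw; have iD := integrableD measurableT iO iw.
  apply: le_integrable iD => //; first exact/measurable_EFinP.
  move=> x _ /=; rewrite lee_fin (le_trans _ (ler_norm _))// indicE.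
  have [xO|xO] := boolP (x \in Omega); last first.
    by rewrite w0 ?normr0 ?add0r ?sqr_ge0//; move: xO; rewrite notin_setE.
  rewrite -(real_normK (num_real (w x))); have := normr_ge0 (w x).
  by move: (`|w x|) => t t0 /=; have := sqr_ge0 (t - 1); nra.
have iu2 : lam.-integrable setT (fun x => (complex.Re (f x) ^+ 2)%:E).
  by apply: dom2 => // x; rewrite lerDl sqr_ge0.
have iv2 : lam.-integrable setT (fun x => (complex.Im (f x) ^+ 2)%:E).
  by apply: dom2 => // x; rewrite lerDr sqr_ge0.
split=> //; apply: dom1 => // x Ox; by rewrite f0.
Qed.

(** A single test function [g] with squared *-distance to [f] below 1 is enough: [f = (f - g) + g],
    both summands have finite *-norm, and the spectrum of a sum is at most twice the sum of the
    spectra. *)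
Lemma HH_log_integrable Omega (f : T -> R[i]) : measurable Omega ->
  (lam Omega < +oo)%E -> HH Omega f ->
  (\int[lam]_xi (ln (expR 1 + euclidean_norm xi) *
     spectrum (fun x => complex.Re (f x)) (fun x => complex.Im (f x)) xi)%:E < +oo)%E.
Proof.
move=> mO Ofin [Lf hf].
have [iu iv _ _] := L2_integrable mO Ofin Lf.
have [g Cg fg] := hf 1 ltr01.
have [iug ivg fing] := star_norm_Cc_infty Cg.
move: fg fing; rewrite /star_norm_sq.
under eq_integral do rewrite normc_fourier.
under [X in _ -> (X < _)%E -> _]eq_integral do rewrite normc_fourier.
set u := fun x => complex.Re (f x) in iu *; set v := fun x => complex.Im (f x) in iv *.
set ug := fun x => complex.Re (g x) in iug *; set vg := fun x => complex.Im (g x) in ivg *.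
have -> : (fun x => complex.Re (f x - g x)) = (fun x => u x - ug x).
  by apply/funext => x; rewrite /u /ug; case: (f x) => ? ?; case: (g x).
have -> : (fun x => complex.Im (f x - g x)) = (fun x => v x - vg x).
  by apply/funext => x; rewrite /v /vg; case: (f x) => ? ?; case: (g x).
move=> fin1 fin2.
have iud : lam.-integrable setT (EFin \o (fun x => u x - ug x)).
  exact: (integrableB measurableT iu iug).
have ivd : lam.-integrable setT (EFin \o (fun x => v x - vg x)).
  exact: (integrableB measurableT iv ivg).
have mS := measurable_spectrum iu iv.
have mSg := measurable_spectrum iug ivg.
have mSd := measurable_spectrum iud ivd.
have mL := measurable_ln_weight.
have L0 (x : T) : 0 <= ln (expR 1 + euclidean_norm x) by exact: (ln_expR1D_ge0 (euclidean_norm_ge0 x)).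
pose Ig := (\int[lam]_xi (ln (expR 1 + euclidean_norm xi) * spectrum ug vg xi)%:E)%E.
pose Id := (\int[lam]_xi (ln (expR 1 + euclidean_norm xi) *
  spectrum (fun x => u x - ug x) (fun x => v x - vg x) xi)%:E)%E.
apply: (@le_lt_trans _ _ (2%:E * Id + 2%:E * Ig)%E); last first.
  rewrite lte_add_pinfty//; apply: lte_mul_pinfty => //.
  by apply: (lt_trans fin1); rewrite ltry.
have mI (S : T -> R) : measurable_fun setT S ->
    measurable_fun setT (fun xi => (ln (expR 1 + euclidean_norm xi) * S xi)%:E).
  by move=> m; apply/measurable_EFinP; exact: measurable_funM.
have I0 (a b : T -> R) (xi : T) : (0 <= (ln (expR 1 + euclidean_norm xi) * spectrum a b xi)%:E)%E.
  by rewrite lee_fin; apply: mulr_ge0; [exact: L0|exact: spectrum_ge0].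
rewrite /Id /Ig -!ge0_integralZl//; [|exact: mI|exact: mI].
rewrite -ge0_integralD//; last 4 first.
- by move=> x _; rewrite mule_ge0.
- by apply: measurable_funeM; exact: mI.
- by move=> x _; rewrite mule_ge0.
- by apply: measurable_funeM; exact: mI.
apply: ge0_le_integral => //.
- exact: mI.
- by apply: emeasurable_funD; apply: measurable_funeM; exact: mI.
move=> xi _; rewrite -!EFinM -EFinD lee_fin.
have := spectrumD_le iud ivd iug ivg xi.
under eq_fun do rewrite subrK.
under [X in spectrum _ X _]eq_fun do rewrite subrK.
move=> h; apply: (le_trans (ler_wpM2l (L0 xi) h)).
by rewrite le_eqVlt; apply/orP; left; apply/eqP; ring.
Qed.

End form_domain.

(** * The layer-cake integral of the logarithm *)

Section euclidean_ball.
Variables (R : realType) (n : nat).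
Local Notation T := 'rV[R]_n.
Local Notation lam := (@lebesgue_rV R n).

Lemma measurable_euclidean_ball (t : R) :
  measurable [set x : T | euclidean_norm x < t].
Proof.
rewrite -[X in measurable X]setTI -[X in _ `&` X]/((@euclidean_norm R n) @^-1` [set y | y < t]).
by apply: measurable_euclidean_norm => //; rewrite -set_itvNyo; exact: measurable_itv.
Qed.

Lemma euclidean_normZ (t : R) (x : T) : 0 <= t ->
  euclidean_norm (t *: x) = t * euclidean_norm x.
Proof.
move=> t0; rewrite /euclidean_norm.
have -> : dot (t *: x) (t *: x) = t ^+ 2 * dot x x.
  by rewrite /dot mulr_sumr; apply: eq_bigr => i _; rewrite !mxE; ring.
by rewrite sqrtrM ?sqr_ge0// sqrtr_sqr ger0_norm.
Qed.

Lemma lebesgue_rV_euclidean_ball (t : R) : 0 < t ->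
  (lam [set x : T | (euclidean_norm x < t)%R] =
   (t ^+ n)%:E * lam (euclidean_unit_ball R n))%E.
Proof.
move=> t0; rewrite -(lebesgue_rV_scale t0 (measurable_euclidean_ball t)).
congr (_ * lam _)%E; apply/seteqP; split => x /=;
  by rewrite /euclidean_unit_ball/= euclidean_normZ ?ltW// gtr_pMr.
Qed.

Lemma coord_le_euclidean (x : T) i : `|x ord0 i| <= euclidean_norm x.
Proof.
rewrite -sqrtr_sqr ler_wsqrtr// /dot (bigD1 i)//= expr2 lerDl.
by apply: sumr_ge0 => j _; rewrite -expr2 sqr_ge0.
Qed.

Lemma euclidean_unit_ball_fin : (lam (euclidean_unit_ball R n) < +oo)%E.
Proof.
apply: le_lt_trans (lebesgue_rV_ball_fin (0 : T) 1).
apply: le_measure; rewrite ?inE.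
- exact: measurable_euclidean_ball.
- exact: measurable_ball_rV.
- move=> x /= x1; rewrite ball_rVE// => i; rewrite mxE sub0r normrN.
  exact: le_lt_trans (coord_le_euclidean x i) x1.
Qed.

Lemma euclidean_unit_ball_gt0 : (0 < lam (euclidean_unit_ball R n))%E.
Proof.
(* On the sup-norm ball of radius [1 / (n + 1)] the Euclidean norm is at most [n / (n + 1) < 1];
   [n.+1] rather than [n] also covers dimension 0. *)
have c0 : 0 < n.+1%:R^-1 :> R by rewrite invr_gt0.
apply: (@lt_le_trans _ _ (lam (ball (0 : T) n.+1%:R^-1))).
  by rewrite lebesgue_rV_ball// lte_fin exprn_gt0// mulrn_wgt0.
apply: le_measure; rewrite ?inE.
- exact: measurable_ball_rV.
- exact: measurable_euclidean_ball.
- move=> x; rewrite ball_rVE// /euclidean_unit_ball/= => h.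
  apply: (le_lt_trans (euclidean_norm_le_norm1 x)).
  apply: (@le_lt_trans _ _ (\sum_(i < n) n.+1%:R^-1)).
    apply: ler_sum => i _; have := h i; rewrite mxE sub0r normrN; exact: ltW.
  by rewrite sumr_const card_ord -[_ *+ n]mulr_natl ltr_pdivrMr// mul1r ltr_nat.
Qed.

Lemma volume_unit_ball_gt0 : 0 < volume (euclidean_unit_ball R n).
Proof.
by rewrite fine_gt0// euclidean_unit_ball_gt0 euclidean_unit_ball_fin.
Qed.

Lemma volume_unit_ballE :
  lam (euclidean_unit_ball R n) = (volume (euclidean_unit_ball R n))%:E.
Proof. by rewrite fineK// ge0_fin_numE// euclidean_unit_ball_fin. Qed.

End euclidean_ball.

Section layer_cake.
Variables (R : realType) (n : nat).
Local Notation T := 'rV[R]_n.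
Local Notation mu := (@lebesgue_measure R).
Local Notation lam := (@lebesgue_rV R n).
Local Notation V := (volume (euclidean_unit_ball R n)).

Lemma integral_ln (s r : R) : 0 < s -> s < r ->
  (\int[mu]_(t in `[s, r]) (t^-1)%:E = (ln r - ln s)%:E)%E.
Proof.
move=> s0 sr.
have pos x : x \in `[s, r] -> 0 < x.
  by rewrite in_itv/= => /andP[sx _]; exact: lt_le_trans sx.
have dln (x : R) : 0 < x -> is_derive x 1 (@ln R) x^-1 by move=> x0; exact: is_derive1_ln.
have cln (x : R) : 0 < x -> {for x, continuous (@ln R)}.
  by move=> x0; apply: differentiable_continuous; apply/derivable1_diffP; have [] := dln x x0.
rewrite (@continuous_FTC2 _ _ (@ln R))//.
- apply: continuous_in_subspaceT => x /set_mem xs; apply: cvgV; last exact: cvg_id.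
  exact/lt0r_neq0/pos.
- split.
  + move=> x; rewrite in_itv/= => /andP[sx _].
    by have [] := dln x (lt_trans s0 sx).
  + by apply: cvg_at_right_filter; exact: cln.
  + by apply: cvg_at_left_filter; apply: cln; exact: lt_trans sr.
- move=> x; rewrite in_itv/= => /andP[sx _]; rewrite derive1E.
  by have [_ ->] := dln x (lt_trans s0 sx).
Qed.

Lemma integral_expr (m : nat) (r : R) : 0 < r ->
  (\int[mu]_(t in `[0%R, r]) (t ^+ m)%:E = (r ^+ m.+1 / m.+1%:R)%:E)%E.
Proof.
move=> r0.
pose F (t : R) := m.+1%:R^-1 * t ^+ m.+1.
have dF (x : R) : is_derive x 1 F (x ^+ m).
  have d1 := @is_deriveX R _ id m.+1 x 1 1 (is_derive_id x 1).
  refine (is_derive1_eq (is_deriveZ m.+1%:R^-1 d1) _ _).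
    by move=> y; rewrite /F /= exprfctE.
  by rewrite /GRing.scale/= mulr1 mulKf.
have cF (x : R) : {for x, continuous F}.
  by apply: differentiable_continuous; apply/derivable1_diffP; have [] := dF x.
rewrite (@continuous_FTC2 _ _ F)//.
- by rewrite /F expr0n mulr0 sube0 mulrC.
- by apply: continuous_subspaceT => x; exact: exprn_continuous.
- split.
  + by move=> x _; have [] := dF x.
  + by apply: cvg_at_right_filter; exact: cF.
  + by apply: cvg_at_left_filter; exact: cF.
- by move=> x _; rewrite derive1E; have [_ ->] := dF x.
Qed.

(* [layer r xi] is [log (r / |xi|)] on the ball of radius [r], written as
   [\int_0^r 1_(|xi| < t) dt / t]; on [t > 0], [expR (- ln t)] is [t^-1]. *)
Definition layer (r : R) (xi : T) : \bar R :=
  (\int[mu]_t (\1_(`]0%R, r[) t * expR (- ln t) *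
     \1_[set p : T * R | euclidean_norm p.1 < p.2] (xi, t))%:E)%E.

Let measurable_layer_set : measurable [set p : T * R | euclidean_norm p.1 < p.2].
Proof.
have mf : measurable_fun setT (fun p : T * R => p.2 - euclidean_norm p.1).
  apply: measurable_funB; first exact: measurable_snd.
  by apply: (measurableT_comp (@measurable_euclidean_norm R n)); exact: measurable_fst.
have -> : [set p : T * R | euclidean_norm p.1 < p.2] =
    setT `&` (fun p : T * R => p.2 - euclidean_norm p.1) @^-1` [set y | 0 < y].
  by rewrite setTI; apply/seteqP; split => p /=; rewrite subr_gt0.
by apply: mf => //; rewrite -set_itvoy; exact: measurable_itv.
Qed.

Let measurable_weight (r : R) :
  measurable_fun setT (fun t : R => \1_(`]0%R, r[) t * expR (- ln t)).
Proof.
apply: measurable_funM; first by apply: measurable_indic; exact: measurable_itv.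
apply: measurableT_comp => //; apply: measurableT_comp; first exact: oppr_measurable.
exact: measurable_ln.
Qed.

Let measurable_layer_fun (r : R) : measurable_fun setT
  (fun p : T * R => \1_(`]0%R, r[) p.2 * expR (- ln p.2) *
    \1_[set p : T * R | euclidean_norm p.1 < p.2] p).
Proof.
apply: measurable_funM; last exact: measurable_indic.
by apply: (measurableT_comp (measurable_weight r)); exact: measurable_snd.
Qed.

Lemma layer_ge0 r xi : (0 <= layer r xi)%E.
Proof. by apply: integral_ge0 => t _; rewrite lee_fin mulr_ge0. Qed.

Lemma measurable_layer r : measurable_fun setT (layer r).
Proof.
apply: (measurable_fun_fubini_tonelli_F (m2 := mu)
  (fun p : T * R => (\1_(`]0%R, r[) p.2 * expR (- ln p.2) *
    \1_[set p : T * R | euclidean_norm p.1 < p.2] p)%:E)).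
  by apply/measurable_EFinP; exact: (measurable_layer_fun r).
by move=> p; rewrite lee_fin mulr_ge0.
Qed.

(** After Tonelli, the slice at height [t] is a ball of measure [V t^n], and against [dt / t] it
    leaves [V] times the integral of [t^(n-1)] over []0, r[]; [0 < n] makes this converge at 0. *)
Lemma integral_layer (r : R) : (0 < n)%N -> 0 < r ->
  (\int[lam]_xi layer r xi = (V * (r ^+ n / n%:R))%:E)%E.
Proof.
move=> n0 r0.
rewrite (fubini_tonelli (m1 := lam) (m2 := mu)
  (fun p : T * R => (\1_(`]0%R, r[) p.2 * expR (- ln p.2) *
    \1_[set p : T * R | euclidean_norm p.1 < p.2] p)%:E))/=; last 2 first.
- by apply/measurable_EFinP; exact: (measurable_layer_fun r).
- by move=> p; rewrite lee_fin mulr_ge0.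
have V0 : 0 <= V by exact/ltW/volume_unit_ball_gt0.
transitivity (\int[mu]_(t in `]0%R, r[) (V%:E * (t ^+ n.-1)%:E))%E.
  rewrite [RHS]integral_mkcond; apply: eq_integral => t _.
  rewrite patchE; case: ifPn => tr; last first.
    by rewrite [RHS](_ : _ = 0%E)// integral0_eq// => x _; rewrite indicE (negPf tr) !mul0r.
  have tE : \1_(`]0%R, r[) t = 1 :> R by rewrite indicE tr.
  move/set_mem : tr => tr.
  move: tr; rewrite /= in_itv/= => /andP[t0 tr].
  transitivity (\int[lam]_x ((t^-1)%:E * (\1_[set x : T | (euclidean_norm x < t)%R] x)%:E))%E.
    apply: eq_integral => x _.
    by rewrite tE mul1r expRN lnK ?posrE// EFinM; congr (_ * _)%E; rewrite !indicE.
  have mB := @measurable_euclidean_ball R n t.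
  rewrite ge0_integralZl//=; last 2 first.
  - exact/measurable_EFinP/measurable_indic.
  - by rewrite lee_fin invr_ge0 ltW.
  have -> : (\int[lam]_x (\1_[set x : T | (euclidean_norm x < t)%R] x)%:E = (t ^+ n)%:E * V%:E)%E.
    by rewrite integral_indic// setIT -volume_unit_ballE; exact: lebesgue_rV_euclidean_ball.
  rewrite -!EFinM; congr EFin.
  rewrite -{1}(prednK n0) exprS; field; exact: lt0r_neq0.
have mVm (D : set R) : measurable_fun D (fun t : R => (V%:E * (t ^+ n.-1)%:E)%E).
  by apply: measurable_funTS; apply: measurable_funeM; apply/measurable_EFinP; exact: measurable_funX.
rewrite -(@integral_itv_bndoo _ 0 r _ true false)//.
rewrite ge0_integralZl//=.
- by rewrite integral_expr// prednK// -EFinM.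
- by apply/measurable_EFinP; exact: measurable_funX.
- by move=> t; rewrite in_itv/= => /andP[t0 _]; rewrite lee_fin exprn_ge0.
Qed.

(** Keeps only the part of the layer integral over []s, r[]. Asking [|xi| <= s] instead of equality
    covers the origin, where any [s > 0] may be used. *)
Lemma layer_lower (s r : R) (xi : T) : 0 < s -> s <= r -> euclidean_norm xi <= s ->
  ((ln r - ln s)%:E <= layer r xi)%E.
Proof.
move=> s0; rewrite le_eqVlt => /predU1P[<- _|sr xs].
  by rewrite subrr layer_ge0.
have mV : measurable_fun `]s, r[ (fun t : R => (expR (- ln t))%:E).
  apply: measurable_funTS; apply/measurable_EFinP; apply: measurableT_comp => //.
  by apply: measurableT_comp; [exact: oppr_measurable|exact: measurable_ln].
have E t : s <= t -> t^-1 = expR (- ln t) :> R.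
  by move=> st; rewrite expRN lnK// posrE; exact: lt_le_trans st.
have <- : (\int[mu]_(t in `]s, r[) (expR (- ln t))%:E = (ln r - ln s)%:E)%E.
  rewrite -(integral_ln s0 sr) -(@integral_itv_bndoo _ s r _ true false)//.
  by apply: eq_integral => t; rewrite inE/= in_itv/= => /andP[st _]; rewrite E.
rewrite [leLHS]integral_mkcond.
apply: ge0_le_integral => //.
- by move=> t _; apply: erestrict_ge0 => y _; rewrite lee_fin expR_ge0.
- exact/(measurable_restrictT _ _).1.
- apply/measurable_EFinP.
  exact: (measurableT_comp (measurable_layer_fun r) (pair1_measurable xi)).
move=> t _; rewrite patchE; case: ifPn => [/set_mem|_]; last first.
  by rewrite [leLHS](_ : _ = 0%E)// lee_fin mulr_ge0.
rewrite /= in_itv/= => /andP[st tr].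
rewrite !indicE !mem_set//= ?mul1r ?mulr1//; first exact: le_lt_trans st.
by rewrite in_itv/= tr (lt_trans s0).
Qed.

End layer_cake.

(** * The bathtub argument *)

Section eigenvalue_bound.
Variables (R : realType) (n : nat).
Local Notation T := 'rV[R]_n.
Local Notation lam := (@lebesgue_rV R n).
Local Notation C := ((2 * pi) ^+ n : R).
Local Notation V := (volume (euclidean_unit_ball R n)).

Variable Omega : set T.
Hypothesis Omega_open : open Omega.
Hypothesis Omega_neq0 : Omega !=set0.
Hypothesis Omega_fin : (lam Omega < +oo)%E.

Let mO : measurable Omega. Proof. exact: open_measurable_rV. Qed.

Lemma volumeE : lam Omega = (volume Omega)%:E.
Proof. by rewrite fineK// ge0_fin_numE. Qed.

Lemma volume_gt0 : 0 < volume Omega.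
Proof.
rewrite -lte_fin -volumeE.
have [x Ox] := Omega_neq0.
have /nbhs_ballP[e /= e0 xe] : nbhs x Omega by exact: open_nbhs_nbhs.
apply: (@lt_le_trans _ _ (lam (ball x e))).
  by rewrite lebesgue_rV_ball// lte_fin exprn_gt0// mulrn_wgt0.
by apply: le_measure => //; rewrite ?inE//; exact: measurable_ball_rV.
Qed.

Section spectrum_bound.
Variables u v : T -> R.
Hypotheses (iu : lam.-integrable setT (EFin \o u)) (iv : lam.-integrable setT (EFin \o v)).
Hypotheses (iu2 : lam.-integrable setT (EFin \o (fun x => u x ^+ 2)))
  (iv2 : lam.-integrable setT (EFin \o (fun x => v x ^+ 2))).
Hypotheses (u0 : forall x, ~ Omega x -> u x = 0) (v0 : forall x, ~ Omega x -> v x = 0).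

Let N := \int[lam]_x (u x ^+ 2 + v x ^+ 2).

Let iN : lam.-integrable setT (EFin \o (fun x => u x ^+ 2 + v x ^+ 2)).
Proof. exact: (integrableD measurableT iu2 iv2). Qed.

Let iO : lam.-integrable setT (EFin \o \1_Omega).
Proof.
apply/integrableP; split; first exact/measurable_EFinP/measurable_indic.
under eq_integral do rewrite /= ger0_norm//.
by rewrite integral_indic ?setIT.
Qed.

(* Cauchy-Schwarz, integrating [a A + b B <= (X / |Omega| + |Omega| (u^2 + v^2)) / 2]
   with [a], [b] the real and imaginary parts and [X = a^2 + b^2]. *)
Lemma spectrum_le xi : spectrum u v xi <= volume Omega * N.
Proof.
have V0 := volume_gt0; set vol := volume Omega in V0 *.
set X := spectrum u v xi.
pose a := fourierRe u v xi; pose b := fourierIm u v xi.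
(* [a] and [b] are themselves the integrals of the two brackets, so [X = a^2 + b^2] is recovered by
   pairing the transform with its own value; half of [X] is absorbed on the left at the end. *)
have XE : X = \int[lam]_x (a * (cos (dot x xi) * u x + sin (dot x xi) * v x) +
    b * (cos (dot x xi) * v x - sin (dot x xi) * u x)).
  have iA := integrable_fourierRe iu iv xi; have iB := integrable_fourierIm iu iv xi.
  rewrite RintegralD//; last 2 first.
  - exact: (integrableZl measurableT a iA).
  - exact: (integrableZl measurableT b iB).
  by rewrite !RintegralZl.
have BE : \int[lam]_x (2^-1 * (X / vol) * \1_Omega x + 2^-1 * vol * (u x ^+ 2 + v x ^+ 2)) =
    2^-1 * X + 2^-1 * vol * N.
  rewrite RintegralD//; last 2 first.
  - exact: (integrableZl measurableT _ iO).
  - exact: (integrableZl measurableT _ iN).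
  rewrite !RintegralZl//; congr (_ + _).
  rewrite [X in _ * X](_ : _ = vol); first by field; exact: lt0r_neq0.
  by rewrite /Rintegral integral_indic// setIT.
suff : X <= 2^-1 * X + 2^-1 * vol * N by lra.
rewrite -BE [leLHS]XE; apply: le_Rintegral => //.
- exact: (integrableD measurableT (integrableZl measurableT a (integrable_fourierRe iu iv xi))
    (integrableZl measurableT b (integrable_fourierIm iu iv xi))).
- exact: (integrableD measurableT (integrableZl measurableT _ iO) (integrableZl measurableT _ iN)).
move=> x _; rewrite indicE; have [xO|xO] := boolP (x \in Omega); last first.
  have nO : ~ Omega x by move: xO; rewrite notin_setE.
  by rewrite u0// v0// expr0n /= !(mulr0, addr0, subrr).
rewrite mulr1; set c := cos _; set s := sin _.
have cs : c ^+ 2 + s ^+ 2 = 1 by exact: cos2Dsin2.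
have -> : u x ^+ 2 + v x ^+ 2 = (c * u x + s * v x) ^+ 2 + (c * v x - s * u x) ^+ 2.
  rewrite -[LHS]mul1r -cs; ring.
have -> : X = a ^+ 2 + b ^+ 2 by [].
set p := c * u x + _; set q := c * v x - _.
have i0 : 0 < vol^-1 by rewrite invr_gt0.
have h1 : 0 <= vol^-1 * (a - vol * p) ^+ 2 by rewrite mulr_ge0 ?sqr_ge0 ?ltW.
have h2 : 0 <= vol^-1 * (b - vol * q) ^+ 2 by rewrite mulr_ge0 ?sqr_ge0 ?ltW.
have e1 : vol^-1 * (a - vol * p) ^+ 2 = a ^+ 2 / vol - 2 * (a * p) + vol * p ^+ 2.
  by field; exact: lt0r_neq0.
have e2 : vol^-1 * (b - vol * q) ^+ 2 = b ^+ 2 / vol - 2 * (b * q) + vol * q ^+ 2.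
  by field; exact: lt0r_neq0.
rewrite e1 in h1; rewrite e2 in h2.
rewrite [_ / vol]mulrDl mulrDr; lra.
Qed.

Lemma integral_spectrum : \int[lam]_xi spectrum u v xi = C * N.
Proof.
rewrite /Rintegral (plancherel iu iv iu2 iv2).
rewrite fineM//; exact: (integrable_fin_num measurableT iN).
Qed.

Lemma integrable_spectrum : lam.-integrable setT (EFin \o spectrum u v).
Proof.
apply/integrableP; split; first by apply/measurable_EFinP; exact: measurable_spectrum.
under eq_integral do rewrite /= ger0_norm ?spectrum_ge0//.
rewrite (plancherel iu iv iu2 iv2); apply: lte_mul_pinfty => //.
- by rewrite lee_fin exprn_ge0// mulr_ge0// pi_ge0.
- exact: (integrable_lty measurableT iN).
Qed.

Hypothesis n_gt0 : (0 < n)%N.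
Hypothesis log_fin : (\int[lam]_xi (ln (expR 1 + euclidean_norm xi) *
  spectrum u v xi)%:E < +oo)%E.

Let c := volume Omega * N.

Let c_ge0 : 0 <= c.
Proof. exact: le_trans (spectrum_ge0 u v 0) (spectrum_le 0). Qed.

Let integrable_layer (r : R) : 0 < r ->
  lam.-integrable setT (fun xi => (c%:E * layer r xi)%E).
Proof.
move=> r0; apply: integrableZl => //.
apply/integrableP; split; first exact: measurable_layer.
under eq_integral do rewrite gee0_abs ?layer_ge0//.
by rewrite integral_layer// ltry.
Qed.

(** Outside the unit ball the logarithm is at most the weight of the *-norm. Inside, the spectrum is
    at most [c] and the singularity [- log |xi|] is dominated by [layer 1], which is integrable. *)
Lemma integrable_log_spectrum :
  lam.-integrable setT (EFin \o (fun xi => ln (euclidean_norm xi) * spectrum u v xi)).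
Proof.
have mS := measurable_spectrum iu iv.
have i1 : lam.-integrable setT (fun xi => (ln (expR 1 + euclidean_norm xi) * spectrum u v xi)%:E).
  apply/integrableP; split.
    by apply/measurable_EFinP/measurable_funM => //; exact: measurable_ln_weight.
  under eq_integral do rewrite /= ger0_norm ?mulr_ge0 ?spectrum_ge0 ?ln_expR1D_ge0 ?euclidean_norm_ge0//.
  exact: log_fin.
apply: le_integrable (integrableD measurableT i1 (integrable_layer ltr01)) => //.
  apply/measurable_EFinP/measurable_funM => //.
  by apply: (measurableT_comp (f := @ln R)); [exact: measurable_ln|exact: measurable_euclidean_norm].
move=> xi _; have S0 := spectrum_ge0 u v xi; have en0 := euclidean_norm_ge0 xi.
have L0 := ln_expR1D_ge0 en0.
rewrite [leRHS]gee0_abs; last first.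
  by rewrite adde_ge0 ?mule_ge0 ?layer_ge0// lee_fin// mulr_ge0.
have [x1|x1] := leP 1 (euclidean_norm xi).
  apply: (@le_trans _ _ (ln (expR 1 + euclidean_norm xi) * spectrum u v xi)%:E); last first.
    by rewrite leeDl// mule_ge0 ?layer_ge0.
  rewrite /= lee_fin ger0_norm ?mulr_ge0 ?ln_ge0// ler_wpM2r// ler_ln ?posrE.
  - by rewrite lerDr expR_ge0.
  - by lra.
  - by have := expR_gt0 (1 : R); lra.
apply: (@le_trans _ _ (c%:E * layer 1 xi)%E); last by rewrite leeDr// lee_fin mulr_ge0.
have [x0|x0] := leP (euclidean_norm xi) 0.
  by rewrite /= ln0// mul0r normr0 mule_ge0 ?layer_ge0.
apply: (@le_trans _ _ (c%:E * (ln 1 - ln (euclidean_norm xi))%:E)%E); last first.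
  by rewrite lee_wpmul2l// layer_lower// ltW.
have l0 : ln (euclidean_norm xi) <= 0 by rewrite ln_le0// ltW.
rewrite /= -EFinM lee_fin ln1 sub0r normrM (ler0_norm l0) ger0_norm//.
by rewrite [leRHS]mulrC ler_wpM2l ?oppr_ge0//; exact: spectrum_le.
Qed.

(** Pointwise, [(log r - log |xi|) S <= c * layer r xi]: inside the ball because [S <= c], outside
    because the left side is not positive. Equality would hold for [S] equal to [c] on the ball and
    0 elsewhere, the filled bathtub. *)
Lemma bathtub (r : R) : 0 < r ->
  ln r * (C * N) <= \int[lam]_xi (ln (euclidean_norm xi) * spectrum u v xi) +
    c * (V * (r ^+ n / n%:R)).
Proof.
move=> r0.
have iL := integrable_log_spectrum.
have iR := integrableD measurableT iL (integrable_layer r0).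
have iS := integrableZl measurableT (ln r) integrable_spectrum.
have := @le_integral _ _ _ lam _ measurableT _ _ iS iR.
have -> : (\int[lam]_xi ((ln r)%:E * (EFin \o spectrum u v) xi) = (ln r * (C * N))%:E)%E.
  rewrite integralZl//; last exact: integrable_spectrum.
  rewrite EFinM -integral_spectrum fineK//.
  exact: (integrable_fin_num measurableT integrable_spectrum).
rewrite integralD//; last exact: integrable_layer.
rewrite ge0_integralZl//; last 2 first.
- exact: measurable_layer.
- by move=> xi _; exact: layer_ge0.
rewrite integral_layer// -(fineK (integrable_fin_num measurableT iL)) -EFinM -EFinD lee_fin.
apply=> xi _ /=.
have S0 := spectrum_ge0 u v xi; have en0 := euclidean_norm_ge0 xi.
have Sc := spectrum_le xi.
have [xr|xr] := leP r (euclidean_norm xi).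
  rewrite -EFinM; apply: (@le_trans _ _ (ln (euclidean_norm xi) * spectrum u v xi)%:E).
    by rewrite lee_fin ler_wpM2r// ler_ln// posrE// (lt_le_trans r0).
  by rewrite leeDl// mule_ge0 ?layer_ge0.
have [x0|x0] := leP (euclidean_norm xi) 0.
  rewrite [X in (X + _)%E](_ : _ = 0%E) ?add0e; last by rewrite /= ln0// mul0r.
  (* At the origin the logarithm has the default value 0, so the layer alone must dominate
     [ln r * S]. With [s = min 1 r] its lower bound [ln r - ln s] is at least both 0 and [ln r]. *)
  pose s := Num.min 1 r; have s0 : 0 < s by rewrite lt_min ltr01.
  have sr : s <= r by rewrite ge_min lexx orbT.
  apply: (@le_trans _ _ (c%:E * (ln r - ln s)%:E)%E); last first.
    by rewrite lee_wpmul2l// layer_lower// (le_trans x0) ?ltW.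
  rewrite -!EFinM lee_fin.
  have l1 : 0 <= ln r - ln s by rewrite subr_ge0 ler_ln.
  have l2 : ln r <= ln r - ln s by rewrite lerDl oppr_ge0 ln_le0// ge_min lexx.
  have := spectrum_le xi; rewrite -/c; nra.
apply: (@le_trans _ _ ((ln (euclidean_norm xi) * spectrum u v xi)%:E +
  c%:E * (ln r - ln (euclidean_norm xi))%:E)%E); last first.
  by rewrite leeD2l// lee_wpmul2l// layer_lower// ltW.
rewrite -!EFinM -EFinD lee_fin.
have l1 : 0 <= ln r - ln (euclidean_norm xi) by rewrite subr_ge0 ler_ln// ?posrE// ltW.
move: Sc; rewrite -/c; nra.
Qed.

End spectrum_bound.

Lemma log_formE (f : T -> R[i]) :
  complex.Re (log_form f f) = C^-1 * \int[lam]_xi (ln (euclidean_norm xi) *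
    spectrum (fun x => complex.Re (f x)) (fun x => complex.Im (f x)) xi).
Proof.
rewrite /log_form /Cintegral /=.
rewrite mul0r subr0; congr (_ * _); apply: eq_Rintegral => xi _.
rewrite -normc_fourier /fourier /Cintegral /=.
rewrite sqr_sqrtr ?addr_ge0 ?sqr_ge0//; ring.
Qed.

Lemma L2_innerE (f : T -> R[i]) : (forall x, ~ Omega x -> f x = 0) ->
  complex.Re (L2_inner Omega f f) =
  \int[lam]_x (complex.Re (f x) ^+ 2 + complex.Im (f x) ^+ 2).
Proof.
move=> f0; rewrite /L2_inner /Cintegral /= Rintegral_mkcond.
apply: eq_Rintegral => x _; rewrite patchE; case: ifPn => [_|xO].
  by case: (f x) => a b /=; ring.
by rewrite f0 ?expr0n ?addr0//=; move: xO; rewrite notin_setE.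
Qed.

(** The bathtub inequality divided by [C N]; positivity of [N] is exactly the non-triviality of the
    eigenfunction. The radius stays free for the final optimisation. *)
Lemma dirichlet_eigenvalue_ge (lambda r : R) : (0 < n)%N -> 0 < r ->
  dirichlet_eigenvalue Omega lambda ->
  ln r - C^-1 * (volume Omega * (V * (r ^+ n / n%:R))) <= lambda.
Proof.
move=> n0 r0 [f [Hf fN0 eqf]].
have [Lf _] := Hf; have [mu mv _ f0] := Lf.
have [iu iv iu2 iv2] := L2_integrable mO Omega_fin Lf.
have log_fin := HH_log_integrable mO Omega_fin Hf.
set u := fun x => complex.Re (f x) in iu iu2 log_fin mu.
set v := fun x => complex.Im (f x) in iv iv2 log_fin mv.
have u0 x : ~ Omega x -> u x = 0 by move=> /f0; rewrite /u => ->.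
have v0 x : ~ Omega x -> v x = 0 by move=> /f0; rewrite /v => ->.
have := congr1 (@complex.Re R) (eqf f Hf).
have -> : complex.Re ((lambda%:C)%C * L2_inner Omega f f) = lambda * complex.Re (L2_inner Omega f f).
  by case: (L2_inner _ _ _) => a b /=; ring.
rewrite log_formE L2_innerE// -/u -/v => eqN.
have := bathtub iu iv iu2 iv2 u0 v0 n0 log_fin r0.
set I := \int[lam]_xi _ in eqN *; set N := \int[lam]_x _ in eqN * => bt.
have C0 : 0 < C by rewrite exprn_gt0// mulr_gt0// pi_gt0.
have iN : lam.-integrable setT (EFin \o (fun x => u x ^+ 2 + v x ^+ 2)).
  exact: (integrableD measurableT iu2 iv2).
have N0 : 0 < N.
  rewrite lt_neqAle Rintegral_ge0 ?andbT; last first.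
    by move=> x _; rewrite addr_ge0 ?sqr_ge0.
  apply/eqP => N0; apply: fN0.
  have : (\int[lam]_x `|(u x ^+ 2 + v x ^+ 2)%:E| = 0)%E.
    under eq_integral do rewrite gee0_abs ?lee_fin ?addr_ge0 ?sqr_ge0//.
    by rewrite -(fineK (integrable_fin_num measurableT iN)); congr EFin.
  have mN := measurable_int _ iN.
  move/(ae_eq_integral_abs lam measurableT mN).
  apply: filterS => x /= /(_ Logic.I) [].
  rewrite /u /v; case: (f x) => a b /= /eqP.
  by rewrite paddr_eq0 ?sqr_ge0// !sqrf_eq0 => /andP[/eqP-> /eqP->].
have IE : I = C * (lambda * N) by rewrite -eqN mulrA divff ?mul1r// lt0r_neq0.
rewrite IE in bt.
set y := V * _ in bt *.
have : ln r * (C * N) <= (lambda + C^-1 * (volume Omega * y)) * (C * N).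
  apply: (le_trans bt); rewrite le_eqVlt; apply/orP; left; apply/eqP.
  by field; exact: lt0r_neq0.
rewrite ler_pM2r ?mulr_gt0//; lra.
Qed.

End eigenvalue_bound.

(** * Optimisation over the radius *)

Theorem theorem4p1 (R : realType) (d : nat) (Omega : set 'rV[R]_d)
    (d_ge1 : (1 <= d)%N) (Omega_open : open Omega) (Omega_neq0 : Omega !=set0)
    (Omega_fin : (lebesgue_rV Omega < +oo)%E) :
  (forall lambda1 : R, first_eigenvalue Omega lambda1 ->
    lambda1 >= d%:R^-1 *
      ln ((2 * pi) ^+ d /
          (expR 1 * volume Omega * volume (euclidean_unit_ball R d)))) /\
  (volume Omega <=
     (2 * pi) ^+ d / (expR 1 * volume (euclidean_unit_ball R d)) ->
   ~ exists2 lambda : R, dirichlet_eigenvalue Omega lambda & lambda < 0).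
Proof.
have O0 := volume_gt0 Omega_open Omega_neq0 Omega_fin.
have V0 := volume_unit_ball_gt0 R d.
have C0 : 0 < (2 * pi) ^+ d :> R by rewrite exprn_gt0// mulr_gt0// pi_gt0.
have e0 : 0 < expR 1 :> R := expR_gt0 1.
have lower lambda : dirichlet_eigenvalue Omega lambda -> lambda >= d%:R^-1 *
    ln ((2 * pi) ^+ d / (expR 1 * volume Omega * volume (euclidean_unit_ball R d))).
  pose X := (2 * pi) ^+ d / (volume Omega * volume (euclidean_unit_ball R d)).
  have X0 : 0 < X by rewrite divr_gt0// mulr_gt0.
  have d0 : d%:R != 0 :> R by rewrite pnatr_eq0 -lt0n.
  (* The maximiser [r ^ d = X] of the lower bound. Its subtracted term becomes [1 / d], and
     [log r - 1 / d] is [(ln X - 1) / d], the logarithm of [X / expR 1] divided by [d]. *)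
  pose r := expR (ln X / d%:R).
  have rd : r ^+ d = X.
    by rewrite -expRM_natl mulrC divfK// lnK.
  move=> /(dirichlet_eigenvalue_ge Omega_open Omega_neq0 Omega_fin d_ge1 (expR_gt0 (ln X / d%:R))).
  rewrite expRK -/r rd; apply: le_trans.
  have -> : (2 * pi) ^+ d / (expR 1 * volume Omega * volume (euclidean_unit_ball R d)) = X / expR 1.
    by rewrite /X; field; rewrite !lt0r_neq0.
  rewrite ln_div ?posrE// expRK.
  rewrite le_eqVlt; apply/orP; left; apply/eqP.
  by rewrite /X; field; rewrite d0 !lt0r_neq0.
split=> [_ [lambda [_ _ _ [phi _ eig]] ->]|le_vol [lambda /lower lambda_ge lambda_lt0]].
  by apply: lower; exists (phi 0%N).
(* The volume condition says precisely that the argument of the logarithm is at least 1, so [lower]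
   makes every eigenvalue nonnegative. *)
have : 0 <= d%:R^-1 * ln ((2 * pi) ^+ d / (expR 1 * volume Omega * volume (euclidean_unit_ball R d))).
  rewrite mulr_ge0 ?invr_ge0// ln_ge0// ler_pdivlMr ?mulr_gt0// mul1r.
  move: le_vol; rewrite ler_pdivlMr ?mulr_gt0//; lra.
lra.
Qed.
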